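(* Let $k$ be an odd integer. Let $(A,d_A)$, $(B,d_B)$ be DG commutative unitary algebras, $(\sigma,\tau,h)$ a semifull DG algebra contraction of $(A,d_A)$ onto $(B,d_B)$, extended $\mathbb{K}[[t]]$-linearly, and $\Delta=\sum_{n\ge0}t^n\Delta_n$ a degree $k$ derived $BV$ algebra structure on $A$ with $\Delta_0=d_A$. Put $\Delta_+=\sum_{n\ge1}t^n\Delta_n$ and let \[ \Delta'=d_B+\sum_{n\ge0}\sigma\Delta_+(h\Delta_+)^n\tau,\quad \breve\sigma=\sum_{n\ge0}\sigma(\Delta_+h)^n,\quad \breve\tau=\sum_{n\ge0}(h\Delta_+)^n\tau,\quad \breve h=\sum_{n\ge0}(h\Delta_+)^nh. \] Assume moreover that $A$ is equipped with a complete filtration making $(A,\Delta)$ into a complete derived $BV$ algebra, that $h$ and $\tau\sigma$ are continuous with respect to this filtration, and equip $B$ with the induced filtration (the only one making $\sigma$ and $\tau$ continuous). Then there is a bijective correspondence \[ \operatorname{MC}_{BV}(B)\cong\operatorname{MC}_{BV}(A)\cap\operatorname{Ker}(\breve h). \] In one direction it is given by the push-forward $\operatorname{MC}(\breve\tau):\operatorname{MC}_{BV}(B)\to\operatorname{MC}_{BV}(A)$, $b\mapsto\sum_{n\ge1}\frac{1}{n!}\kappa(\breve\tau)_n(b,\ldots,b)$, along the continuous morphism of complete derived $BV$ algebras $\breve\tau:(B,\Delta')\to(A,\Delta)$; in the other direction, it sends $a\in\operatorname{MC}_{BV}(A)\cap\operatorname{Ker}(\breve h)$ to the Maurer-Cartan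 element $\breve\sigma(a)\in\operatorname{MC}_{BV}(B)$.
   Context: $\mathbb{K}$ is a field of characteristic zero; spaces are $\mathbb{Z}$-graded; $\pm_K$ denotes Koszul signs, $S(i,n-i)$ the $(i,n-i)$-unshuffles. $t$ is a central variable of (even) degree $1-k$. Koszul brackets: for $\Delta\in\operatorname{End}_u(A)$ (i.e. $\Delta(\mathbf{1}_A)=0$), $\mathcal{K}(\Delta)_n(a_1,\ldots,a_n)=\sum_{i=1}^n\sum_{\pi\in S(i,n-i)}\pm_K(-1)^{n-i}\Delta(a_{\pi(1)}\cdots a_{\pi(i)})a_{\pi(i+1)}\cdots a_{\pi(n)}$. Cumulants: for a degree zero $f$ with $f(\mathbf{1})=\mathbf{1}$, $\kappa(f)_n(a_1,\ldots,a_n)=\sum_{k=1}^n\sum_{I_1\sqcup\cdots\sqcup I_k=\{1,\ldots,n\}}(-1)^{k-1}(k-1)!\pm_K\prod_{j=1}^kf(\prod_{i\in I_j}a_i)$, summed over unordered partitions into nonempty subsets. All maps are extended $\mathbb{K}((t))$-linearly to $A((t))$, $B((t))$ (formal Laurent series) where needed. Degree $k$ derived $BV$ algebra: a graded commutative unitary algebra $A$ with a degree one $\mathbb{K}[[t]]$-linear $\Delta=\sum_{n\ge0}t^n\Delta_n$ on $A[[t]]$, $\Delta_n\in\operatorname{End}_u(A)$, $|\Delta_n|=1+n(k-1)$, with $\Delta^2=0$ and $\mathcal{K}(\Delta)_n(a_1,\ldots,a_n)\equiv0\pmod{t^{n-1}}$ for all $n\ge2$, $a_i\in A$. Morphism $(A,\Delta)\to(B,\Delta')$: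 a degree zero $\mathbb{K}[[t]]$-linear $f:A[[t]]\to B[[t]]$ with $f(\mathbf{1}_A)=\mathbf{1}_B$, $f\Delta=\Delta'f$, $\kappa(f)_n(a_1,\ldots,a_n)\equiv0\pmod{t^{n-1}}$ for all $n\ge2$, $a_i\in A$. Complete derived $BV$ algebra: $A$ has an augmentation $\epsilon:A\to\mathbb{K}$ and a complete descending filtration $A=F^0A\supset F^1A=\operatorname{Ker}\epsilon\supset F^2A\supset\cdots$ (i.e. $A\to\varprojlim A/F^pA$ is an isomorphism) compatible with the product ($F^pA\cdot F^qA\subset F^{p+q}A$) and with the $BV$ operator ($\Delta_n(F^pA)\subset F^pA$). Maps are continuous if they respect the filtrations. Maurer-Cartan elements: $\operatorname{MC}_{BV}(A)$ is the set of degree zero elements $a=\sum_{i\ge-1}t^ia_i\in\frac1tA[[t]]$, $a_i\in (F^1A)^{i(k-1)}$, with $\sum_{n\ge1}\frac1{n!}\mathcal{K}(\Delta)_n(a,\ldots,a)=0$ (equivalently $\Delta(e^a)=0$); similarly for $B$ with $\Delta'$. Contraction $(\sigma,\tau,h)$ of $(A,d_A)$ onto $(B,d_B)$: DG maps $\sigma:A\to B$, $\tau:B\to A$, a degree $-1$ map $h:A\to A$ with $\sigma\tau=\mathrm{id}_B$, $hd_A+d_Ah=\tau\sigma-\mathrm{id}_A$, $\sigma h=0$, $h\tau=0$, $h^2=0$. It is a semifull DG algebra contraction if $d_A$ is an algebra derivation and for all $a,b\in A$, $x,y\in B$: $h(h(a)h(b))=h(h(a)\tau(x))=h(\tau(x)\tau(y))=h(\mathbf{1}_A)=0$,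 $\sigma(h(a)h(b))=\sigma(h(a)\tau(x))=0$, $\sigma(\tau(x)\tau(y))=xy$, $\sigma(\mathbf{1}_A)=\mathbf{1}_B$. *)

(* Defs.v *)
From HB Require Import structures.
From mathcomp Require Import all_boot all_order all_fingroup all_algebra.
From mathcomp Require Import boolp classical_sets functions cardinality fsbigop.
From mathcomp Require Import zify.

Set Implicit Arguments.
Unset Strict Implicit.
Unset Printing Implicit Defensive.

Import Order.TTheory GRing.Theory Num.Theory.

Local Open Scope classical_set_scope.
Local Open Scope ring_scope.

(* Formal Laurent series A((t)). The variable t has degree 1 - k with k odd, so
   it is central without signs. *)

Section Laurent.
Variables (K : fieldType) (A : algType K).

Definition bounded_below : pred (int -> A) :=
  fun x => `[< exists m : int, forall i, i < m -> x i = 0 >].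

Record laurent := Laurent { lcoef :> int -> A; _ : bounded_below lcoef }.

HB.instance Definition _ := [isSub for lcoef].
HB.instance Definition _ := [Choice of laurent by <:].

Lemma bounded_below_submod : submod_closed bounded_below.
Proof.
split; first by apply/asboolP; exists 0.
move=> c x y /asboolP[m xm] /asboolP[p yp]; apply/asboolP.
exists (Order.min m p) => i; rewrite lt_min => /andP[im ip].
by rewrite /GRing.add /GRing.scale /= xm // yp // scaler0 addr0.
Qed.
HB.instance Definition _ :=
  GRing.isSubmodClosed.Build K (int -> A) bounded_below bounded_below_submod.
HB.instance Definition _ :=
  [SubChoice_isSubLmodule of laurent by <:].

Lemma laurentP (x y : laurent) : (forall i, x i = y i) -> x = y.
Proof. by move=> xy; apply/val_inj/funext. Qed.

Lemma laurent_bound (x : laurent) : exists m : int, forall i, i < m -> x i = 0.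
Proof. by case: x => x /= /asboolP. Qed.

Lemma lcoefD (x y : laurent) i : (x + y) i = x i + y i.
Proof. by []. Qed.

Definition lconst_coef (a : A) (i : int) : A := if i == 0 then a else 0.

Lemma lconst_subproof a : bounded_below (lconst_coef a).
Proof. by apply/asboolP; exists 0 => i i0; rewrite /lconst_coef lt_eqF. Qed.

Definition lconst (a : A) : laurent := Laurent (lconst_subproof a).

(* The sum below has finite support because x and y are bounded below. *)
Definition lmul_coef (x y : int -> A) (n : int) : A :=
  \sum_(i \in [set: int]) x i * y (n - i).

Lemma lmul_coefE (x y : int -> A) (m p n : int) (N : nat) :
  (forall i, i < m -> x i = 0) -> (forall i, i < p -> y i = 0) ->
  n - m - p < N%:Z ->
  lmul_coef x y n = \sum_(j < N) x (m + j%:Z) * y (n - m - j%:Z).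
Proof.
move=> xm yp nN; rewrite /lmul_coef.
have injm : injective (fun j : nat => m + j%:Z) by move=> i j /addrI [].
rewrite (@fsbigE _ _ _ _ _ [seq m + j%:Z | j <- iota 0 N]) //.
- rewrite big_map -{1}(subn0 N) -/(index_iota 0 N).
  under eq_bigl do rewrite in_setT.
  by rewrite big_mkord; apply: eq_bigr => j _; rewrite opprD addrA.
- by rewrite map_inj_uniq ?iota_uniq.
move=> i _ iN; case: (ltP i m) => im; first by rewrite xm // mul0r.
rewrite [y _]yp ?mulr0 // ltNge; apply: contraNN iN => ip.
apply/mapP; exists (`|i - m|%N); last by lia.
by rewrite mem_iota /=; lia.
Qed.

Lemma lmul_coef0 (x y : int -> A) (m p n : int) :
  (forall i, i < m -> x i = 0) -> (forall i, i < p -> y i = 0) ->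
  n < m + p -> lmul_coef x y n = 0.
Proof.
move=> xm yp nmp; rewrite (@lmul_coefE x y m p n 0) ?big_ord0 //; lia.
Qed.

Lemma lmul_subproof (x y : laurent) : bounded_below (lmul_coef x y).
Proof.
have [m xm] := laurent_bound x; have [p yp] := laurent_bound y.
by apply/asboolP; exists (m + p) => i; exact: lmul_coef0.
Qed.

Definition lmul (x y : laurent) : laurent := Laurent (lmul_subproof x y).

Let trunc (x : int -> A) (m : int) (N : nat) : {poly A} :=
  \poly_(j < N) x (m + j%:Z).

Let lmul_poly (x y : int -> A) (m p : int) (l N : nat) :
  (forall i, i < m -> x i = 0) -> (forall i, i < p -> y i = 0) -> (l < N)%N ->
  lmul_coef x y (m + p + l%:Z) = (trunc x m N * trunc y p N)`_l.
Proof.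
move=> xm yp lN; rewrite (@lmul_coefE x y m p _ l.+1) //; last by lia.
rewrite coefM; apply: eq_bigr => j _; rewrite !coef_poly.
have jl := ltn_ord j.
rewrite !ifT; [|lia..].
by congr (_ * y _); lia.
Qed.

Let lmulA : associative lmul.
Proof.
move=> x y z; apply: laurentP => n /=.
have [m xm] := laurent_bound x; have [p yp] := laurent_bound y.
have [q zq] := laurent_bound z.
have xy0 i : i < m + p -> lmul_coef x y i = 0 by exact: lmul_coef0.
have yz0 i : i < p + q -> lmul_coef y z i = 0 by exact: lmul_coef0.
case: (ltP n (m + p + q)) => nmpq.
  by rewrite (lmul_coef0 xm yz0) ?(lmul_coef0 xy0 zq) //; lia.
pose l := absz (n - (m + p + q))%R.
have -> : n = m + p + q + l%:Z by lia.
rewrite (lmul_poly xy0 zq (ltnSn l)) -(addrA m) (lmul_poly xm yz0 (ltnSn l)).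
have E1 : (trunc x m l.+1 * (trunc y p l.+1 * trunc z q l.+1))`_l =
          (trunc x m l.+1 * trunc (lmul_coef y z) (p + q) l.+1)`_l.
  rewrite !coefM; apply: eq_bigr => j _; congr (_ * _).
  rewrite [RHS]coef_poly ifT; last by lia.
  by rewrite (@lmul_poly y z p q _ l.+1) //; lia.
have E2 : (trunc x m l.+1 * trunc y p l.+1 * trunc z q l.+1)`_l =
          (trunc (lmul_coef x y) (m + p) l.+1 * trunc z q l.+1)`_l.
  rewrite !coefM; apply: eq_bigr => j _; congr (_ * _); have jl := ltn_ord j.
  rewrite [RHS]coef_poly ifT; last by lia.
  by rewrite (@lmul_poly x y m p _ l.+1) //; lia.
by rewrite -E1 -E2 mulrA.
Qed.

Let lmul1x : left_id (lconst 1) lmul.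
Proof.
move=> x; apply: laurentP => n /=; rewrite /lmul_coef.
rewrite (@fsbigE _ _ _ _ _ [:: 0]) //=.
  by rewrite big_mkcond big_seq1 in_setT /lconst_coef eqxx mul1r subr0.
by move=> i _; rewrite inE /lconst_coef => /negPf ->; rewrite mul0r.
Qed.

Let lmulx1 : right_id (lconst 1) lmul.
Proof.
move=> x; apply: laurentP => n /=; rewrite /lmul_coef.
rewrite (@fsbigE _ _ _ _ _ [:: n]) //=.
  by rewrite big_mkcond big_seq1 in_setT /lconst_coef subrr eqxx mulr1.
move=> i _; rewrite inE /lconst_coef subr_eq0 eq_sym => /negPf ->.
by rewrite mulr0.
Qed.

Let lmulDl : left_distributive lmul +%R.
Proof.
move=> x y z; apply: laurentP => n; rewrite lcoefD /=.
have [m xm] := laurent_bound x; have [p yp] := laurent_bound y.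
have [q zq] := laurent_bound z; set r := Order.min m p.
have xr i : i < r -> x i = 0 by rewrite lt_min => /andP[/xm].
have yr i : i < r -> y i = 0 by rewrite lt_min => /andP[_ /yp].
have xyr i : i < r -> (x + y) i = 0.
  by move=> ir; rewrite lcoefD xr // yr // addr0.
pose N := (absz (n - r - q)%R).+1; have nN : n - r - q < N%:Z by lia.
rewrite (lmul_coefE xyr zq nN) (lmul_coefE xr zq nN) (lmul_coefE yr zq nN).
by rewrite -big_split; apply: eq_bigr => j _; rewrite lcoefD mulrDl.
Qed.

Let lmulDr : right_distributive lmul +%R.
Proof.
move=> z x y; apply: laurentP => n; rewrite lcoefD /=.
have [m xm] := laurent_bound x; have [p yp] := laurent_bound y.
have [q zq] := laurent_bound z; set r := Order.min m p.
have xr i : i < r -> x i = 0 by rewrite lt_min => /andP[/xm].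
have yr i : i < r -> y i = 0 by rewrite lt_min => /andP[_ /yp].
have xyr i : i < r -> (x + y) i = 0.
  by move=> ir; rewrite lcoefD xr // yr // addr0.
pose N := (absz (n - q - r)%R).+1; have nN : n - q - r < N%:Z by lia.
rewrite (lmul_coefE zq xyr nN) (lmul_coefE zq xr nN) (lmul_coefE zq yr nN).
by rewrite -big_split; apply: eq_bigr => j _; rewrite lcoefD mulrDr.
Qed.

Let lone_neq0 : lconst 1 != 0.
Proof.
apply/eqP => /(congr1 (fun x : laurent => x 0)).
by rewrite /= /lconst_coef eqxx => /eqP; rewrite oner_eq0.
Qed.

HB.instance Definition _ := GRing.Zmodule_isNzRing.Build laurent
  lmulA lmul1x lmulx1 lmulDl lmulDr lone_neq0.

(* x lies in t^m A[[t]]. *)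
Definition in_tpow (m : int) (x : laurent) := forall i, i < m -> x i = 0.

End Laurent.

(* A K[[t]]-linear map A[[t]] -> B[[t]] is determined by its restriction to A,
   hence is the same thing as a sequence f_n of K-linear maps A -> B, standing
   for f = \sum_n t^n f_n. *)
Definition tops (K : fieldType) (A B : lmodType K) := nat -> {linear A -> B}.

Section LinSum.
Variables (K : fieldType) (A B : lmodType K).
Variables (n : nat) (f : nat -> {linear A -> B}).

Definition lin_sum (x : A) : B := \sum_(i < n) f i x.

Lemma lin_sum_is_linear : linear lin_sum.
Proof.
move=> a x y; rewrite /lin_sum scaler_sumr -big_split.
by apply: eq_bigr => i _; rewrite linearP.
Qed.
HB.instance Definition _ :=
  GRing.isLinear.Build K A B *:%R lin_sum lin_sum_is_linear.

End LinSum.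

Definition tconst (K : fieldType) (A B : lmodType K) (f : {linear A -> B}) :
  tops A B := fun n => if n is 0 then f else \0.

Definition tadd (K : fieldType) (A B : lmodType K) (f g : tops A B) :
  tops A B := fun n => f n \+ g n.

Definition tcomp (K : fieldType) (A B C : lmodType K)
  (g : tops B C) (f : tops A B) : tops A C :=
  fun n => lin_sum n.+1 (fun i => g i \o f (n - i)%N).

Notation "g '\ot' f" := (tcomp g f) (at level 50, left associativity).

Definition texp (K : fieldType) (A : lmodType K) (f : tops A A) (m : nat) :
  tops A A := iter m (tcomp f) (tconst idfun).

(* The t-adically convergent sum \sum_m u_m, for u_m divisible by t^m: only
   u_0, ..., u_n contribute to the coefficient of t^n. *)
Definition tsum (K : fieldType) (A B : lmodType K) (u : nat -> tops A B) :
  tops A B := fun n => lin_sum n.+1 (fun m => u m n).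

Definition tpos (K : fieldType) (A B : lmodType K) (f : tops A B) :
  tops A B := fun n => if n is 0 then \0 else f n.

Section Extension.
Variables (K : fieldType) (A B : algType K) (f : tops A B).

Definition text_coef (x : laurent A) (n : int) : B :=
  \sum_(j \in [set: nat]) f j (x (n - j%:Z)).

Lemma text_subproof x : bounded_below (text_coef x).
Proof.
have [m xm] := laurent_bound x; apply/asboolP; exists m => i im.
by apply: fsbig1 => j _; rewrite xm ?linear0 //; lia.
Qed.

(* The K((t))-linear extension A((t)) -> B((t)). *)
Definition text (x : laurent A) : laurent B := Laurent (text_subproof x).

End Extension.

Section Brackets.
Variables (n : nat) (d : 'I_n -> int).

(* For w an enumeration of 'I_n and a_i of degree d i, the Koszul sign of
   a_0 ... a_(n-1) |-> a_(w_0) ... a_(w_(n-1)) is (-1) ^+ (koszul_exp w). *)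
Definition koszul_exp (w : seq 'I_n) : nat :=
  \sum_(i < n) \sum_(j < n | (i < j)%N && (index j w < index i w)%N)
    (`|d i|%N * `|d j|%N)%N.

Definition unshuffle (i : nat) (s : 'S_n) : bool :=
  [forall p : 'I_n, forall q : 'I_n,
    [&& (p < q)%N & (q < i)%N || (i <= p)%N] ==> (s p < s q)%N].

Definition koszul_bracket (R : nzRingType) (D : R -> R) (a : 'I_n -> R) : R :=
  \sum_(1 <= i < n.+1) \sum_(s : 'S_n | unshuffle i s)
    (-1) ^+ koszul_exp [seq s p | p <- enum 'I_n] * (-1) ^+ (n - i) *
    (D (\prod_(p < n | (p < i)%N) a (s p)) *
     \prod_(p < n | (i <= p)%N) a (s p)).

(* The summand does not depend on the order in which enum P lists the blocks:
   the Koszul sign compensates. *)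
Definition cumulant (R S : nzRingType) (f : R -> S) (a : 'I_n -> R) : S :=
  \sum_(P : {set {set 'I_n}} | finset.partition P (finset.setTfor 'I_n))
    (-1) ^+ #|P|.-1 * (#|P|.-1)`!%:R *
    (-1) ^+ koszul_exp (flatten [seq enum J | J : {set 'I_n} <- enum P]) *
    \prod_(J <- enum P) f (\prod_(i <- enum J) a i).

End Brackets.

Definition subspace (K : fieldType) (A : lmodType K) (V : set A) : Prop :=
  V 0 /\ forall (c : K) u v, V u -> V v -> V (c *: u + v).

(* V is the sum of its intersections with the A^i. *)
Definition graded_subspace (K : fieldType) (A : lmodType K)
  (gr : int -> set A) (V : set A) : Prop :=
  subspace V /\ forall x, V x -> exists (s : seq int) (c : int -> A),
    (forall i, gr i (c i) /\ V (c i)) /\ x = \sum_(i <- s) c i.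

Record grading (K : fieldType) (A : lmodType K) (gr : int -> set A) : Prop := {
  grading_subspace : forall i, subspace (gr i);
  grading_span : graded_subspace gr [set: A];
  grading_free : forall (s : seq int) (c : int -> A), uniq s ->
    (forall i, gr i (c i)) -> \sum_(i <- s) c i = 0 ->
    forall i, i \in s -> c i = 0 }.

Definition homogeneous (T U : Type) (grA : int -> set T) (grB : int -> set U)
  (m : int) (f : T -> U) : Prop :=
  forall i x, grA i x -> grB (i + m) (f x).

Record graded_comm_alg (K : fieldType) (A : algType K) (gr : int -> set A) :
  Prop := {
  gca_grading : grading gr;
  gca_one : gr 0 1;
  gca_mul : forall i j x y, gr i x -> gr j y -> gr (i + j) (x * y);
  gca_comm : forall i j x y, gr i x -> gr j y ->
    x * y = (-1) ^+ (`|i|%N * `|j|%N) * (y * x) }.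

Record dg_comm_alg (K : fieldType) (A : algType K) (gr : int -> set A)
  (d : A -> A) : Prop := {
  dga_alg : graded_comm_alg gr;
  dga_deg : homogeneous gr gr 1 d;
  dga_sq : forall x, d (d x) = 0;
  dga_der : forall i x y, gr i x ->
    d (x * y) = d x * y + (-1) ^+ `|i|%N * (x * d y) }.

Record contraction (K : fieldType) (A B : algType K) (grA : int -> set A)
  (grB : int -> set B) (dA : A -> A) (dB : B -> B)
  (sigma : A -> B) (tau : B -> A) (h : A -> A) : Prop := {
  ctr_sigma_deg : homogeneous grA grB 0 sigma;
  ctr_tau_deg : homogeneous grB grA 0 tau;
  ctr_h_deg : homogeneous grA grA (-1) h;
  ctr_sigma_d : forall a, sigma (dA a) = dB (sigma a);
  ctr_tau_d : forall x, tau (dB x) = dA (tau x);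
  ctr_sigma_tau : forall x, sigma (tau x) = x;
  ctr_homotopy : forall a, h (dA a) + dA (h a) = tau (sigma a) - a;
  ctr_sigma_h : forall a, sigma (h a) = 0;
  ctr_h_tau : forall x, h (tau x) = 0;
  ctr_h_h : forall a, h (h a) = 0 }.

Record semifull_contraction (K : fieldType) (A B : algType K)
  (grA : int -> set A) (grB : int -> set B) (dA : A -> A) (dB : B -> B)
  (sigma : A -> B) (tau : B -> A) (h : A -> A) : Prop := {
  sf_contraction : contraction grA grB dA dB sigma tau h;
  sf_hhh : forall a b, h (h a * h b) = 0;
  sf_hht : forall a x, h (h a * tau x) = 0;
  sf_htt : forall x y, h (tau x * tau y) = 0;
  sf_h1 : h 1 = 0;
  sf_shh : forall a b, sigma (h a * h b) = 0;
  sf_sht : forall a x, sigma (h a * tau x) = 0;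
  sf_stt : forall x y, sigma (tau x * tau y) = x * y;
  sf_s1 : sigma 1 = 1 }.

(* As t has degree 1 - k, an operator \sum_n t^n f_n has degree m when f_n has
   degree m + n (k - 1). Conditions on multilinear operations are imposed on
   homogeneous arguments, where the Koszul signs make sense. *)

Record derived_BV (K : fieldType) (k : int) (A : algType K)
  (gr : int -> set A) (D : tops A A) : Prop := {
  dbv_alg : graded_comm_alg gr;
  dbv_unit : forall n, D n 1 = 0;
  dbv_deg : forall n : nat, homogeneous gr gr (1 + n%:Z * (k - 1)) (D n);
  dbv_sq : forall n x, (D \ot D) n x = 0;
  dbv_koszul : forall n (d : 'I_n -> int) (a : 'I_n -> A), (2 <= n)%N ->
    (forall i, gr (d i) (a i)) ->
    in_tpow (n%:Z - 1) (koszul_bracket d (text D) (fun i => lconst (a i))) }.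

Record derived_BV_morphism (K : fieldType) (k : int) (A B : algType K)
  (grA : int -> set A) (DA : tops A A) (grB : int -> set B) (DB : tops B B)
  (f : tops A B) : Prop := {
  mor_deg : forall n : nat, homogeneous grA grB (n%:Z * (k - 1)) (f n);
  mor_unit : forall n, f n 1 = if n is 0 then 1 else 0;
  mor_comm : forall n x, (f \ot DA) n x = (DB \ot f) n x;
  mor_cumulant : forall n (d : 'I_n -> int) (a : 'I_n -> A), (2 <= n)%N ->
    (forall i, grA (d i) (a i)) ->
    in_tpow (n%:Z - 1) (cumulant d (text f) (fun i => lconst (a i))) }.

Definition filtered_map (T U : Type) (F : nat -> set T) (G : nat -> set U)
  (f : T -> U) : Prop := forall p x, F p x -> G p (f x).

(* A -> lim A/F^p A is an isomorphism of graded spaces: the limit is taken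
   degree by degree, and its elements are given by compatible sequences of
   representatives. *)
Record complete_filtration (K : fieldType) (A : algType K)
  (gr : int -> set A) (F : nat -> set A) : Prop := {
  filt_subspace : forall p, graded_subspace gr (F p);
  filt_zero : F 0%N = [set: A];
  filt_decr : forall p, F p.+1 `<=` F p;
  filt_separated : forall x, (forall p, F p x) -> x = 0;
  filt_complete : forall i (x : nat -> A), (forall p, gr i (x p)) ->
    (forall p, F p (x p.+1 - x p)) ->
    exists2 l, gr i l & forall p, F p (l - x p) }.

Record augmentation (K : fieldType) (A : algType K) (gr : int -> set A)
  (eps : A -> K) : Prop := {
  aug_linear : scalar eps;
  aug_one : eps 1 = 1;
  aug_mul : forall x y, eps (x * y) = eps x * eps y;
  aug_deg : forall i x, i != 0 -> gr i x -> eps x = 0 }.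

Record complete_derived_BV (K : fieldType) (k : int) (A : algType K)
  (gr : int -> set A) (D : tops A A) (eps : A -> K) (F : nat -> set A) :
  Prop := {
  cdbv_dbv : derived_BV k gr D;
  cdbv_aug : augmentation gr eps;
  cdbv_filt : complete_filtration gr F;
  cdbv_ker : F 1%N = [set x | eps x = 0];
  cdbv_mul : forall p q x y, F p x -> F q y -> F (p + q)%N (x * y);
  cdbv_BV : forall n, filtered_map F F (D n) }.

(* Convergence in A((t)) for the topology defined by the F^p A((t)). *)
Definition F_cvg (K : fieldType) (A : algType K) (F : nat -> set A)
  (s : nat -> laurent A) (l : laurent A) : Prop :=
  forall p, exists N : nat, forall m, (N <= m)%N -> forall i, F p (s m i - l i).

Definition F_series (K : fieldType) (A : algType K) (F : nat -> set A)
  (u : nat -> laurent A) (l : laurent A) : Prop :=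
  F_cvg F (fun m => \sum_(1 <= n < m.+1) (n`!%:R : K)^-1 *: u n) l.

(* Elements of MC_BV have degree 0 in A((t)), hence degrees fun=> 0 in the
   Koszul bracket. *)
Definition MC_BV (K : fieldType) (k : int) (A : algType K)
  (gr : int -> set A) (D : tops A A) (F : nat -> set A) : set (laurent A) :=
  [set a | [/\ in_tpow (-1) a,
    forall i, -1 <= i -> F 1%N (a i) /\ gr (i * (k - 1)) (a i) &
    F_series F (fun n => koszul_bracket (fun _ : 'I_n => 0) (text D)
                           (fun _ => a)) 0]].

(* a is the push-forward MC(f)(b), for f : (B, DB) -> (A, DA). *)
Definition is_pushforward (K : fieldType) (A B : algType K) (F : nat -> set A)
  (f : tops B A) (b : laurent B) (a : laurent A) : Prop :=
  F_series F (fun n => cumulant (fun _ : 'I_n => 0) (text f) (fun _ => b)) a.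

Section Perturbation.
Variables (K : fieldType) (A B : algType K) (dB : {linear B -> B}).
Variables (sigma : {linear A -> B}) (tau : {linear B -> A}).
Variables (h : {linear A -> A}) (D : tops A A).

Let Dp := tpos D.
Let hDp := tconst h \ot Dp.

Definition pert_BV : tops B B := tadd (tconst dB)
  (tsum (fun n => tconst sigma \ot Dp \ot texp hDp n \ot tconst tau)).

Definition pert_sigma : tops A B :=
  tsum (fun n => tconst sigma \ot texp (Dp \ot tconst h) n).

Definition pert_tau : tops B A := tsum (fun n => texp hDp n \ot tconst tau).

Definition pert_h : tops A A := tsum (fun n => texp hDp n \ot tconst h).

End Perturbation.

Definition induced_filtration (T U : Type) (sigma : T -> U)
  (F : nat -> set T) : nat -> set U := fun p => sigma @` F p.

(* Main.v *)
(* The kernel of h is a subalgebra of A on which sigma is multiplicative, and T,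
   the perturbation of tau, is the inverse of sigma from the set of v with
   h v = h (D v) = 0, where D stands for Delta. Let x be a formal sum of
   arguments in B with Koszul signs. Then Y = log (T e^x), whose coefficients are
   the cumulants of T, stays in ker h with sigma Y = x, and comparing
   h (D e^Y . e^(-Y)) = 0 with the expansion
   D e^Y . e^(-Y) = D Y + (brackets of order >= 2 of Y) gives a fixed point
   equation for Y, whence the divisibility by powers of t of the cumulants of T;
   applying sigma yields that of the brackets of Delta'. The signs are dealt with
   by a convolution algebra of functions on the subsets of the set of arguments,
   where x is even and nilpotent.

   Up to F^p the Maurer-Cartan equation reads D e^a = 0. If moreover h a = 0, then
   h (e^a) = h (D e^a) = 0, so that e^a = T (sigma e^a) = T (e^(sigma a)): a is the
   push-forward of sigma a. *)
Require Import Defs.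
From HB Require Import structures.
From mathcomp Require Import all_boot all_order all_fingroup all_algebra.
From mathcomp Require Import zify.
Set Implicit Arguments.
Unset Strict Implicit.
Unset Printing Implicit Defensive.
Import Order.TTheory GRing.Theory Num.Theory.
Local Open Scope ring_scope.

(** * Truncated exponentials and logarithms *)

(** The exponential of an element of t^(-1) A[[t]] is in general not a Laurent series. Exponentials
    and logarithms are therefore truncated polynomials [aexp N] and [alog N], and their identities
    are first proved with an explicit remainder, a multiple of the N-th power of the argument. The
    remainder is zero in the convolution algebra, where functions vanishing on the empty set are
    nilpotent, and it lies in F^N when the argument lies in F^1; one polynomial identity serves both
    settings. The inductive bound says that the value of Y on S is divisible by t^(e |S| - 1) when
    the arguments are divisible by t^(e - 1). Its shape is dictated by the brackets: over m disjoint
    blocks with union S the exponents add up to e |S| - m, and the derived BV axiom restores m - 1.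
    The case e = 1, constant arguments, gives the divisibility by t^(n-1) of cumulants and brackets;
    the case e = 0, arguments starting at t^(-1), keeps all cumulants of a Maurer-Cartan element in
    t^(-1) A[[t]]. *)

Section TruncatedExpLog.
Variables (K : fieldType) (charK : [pchar K] =i pred0).

Definition exp_coef (i : nat) : K := (i`!%:R)^-1.
Definition log_coef (i : nat) : K := if i is j.+1 then (-1) ^+ j / j.+1%:R else 0.
Definition exp_poly (N : nat) : {poly K} := \poly_(i < N) exp_coef i.
Definition log_poly (N : nat) : {poly K} := \poly_(i < N) log_coef i.

Lemma natrK_neq0 n : (0 < n)%N -> n%:R != 0 :> K.
Proof.
by move=> n0; move/charf0P: charK => ->; rewrite -lt0n.
Qed.

Lemma fact_natr_neq0 n : n`!%:R != 0 :> K.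
Proof. exact: natrK_neq0 (fact_gt0 n). Qed.

Lemma exp_coefS i : i.+1%:R * exp_coef i.+1 = exp_coef i.
Proof.
rewrite /exp_coef factS natrM invfM mulrA divff ?mul1r //.
exact: natrK_neq0.
Qed.

Lemma exp_coef_bin n i : (i <= n)%N ->
  exp_coef i * exp_coef (n - i) = 'C(n, i)%:R * exp_coef n.
Proof.
move=> le_in; rewrite /exp_coef -(bin_fact le_in) !natrM invfM mulrA.
by rewrite divff ?mul1r ?invfM // natrK_neq0 // bin_gt0.
Qed.

(** Integration modulo X^(n+1), possible in characteristic zero; it reduces the inversion of exp and
    log to differential equations. *)
Lemma coef_deriv_eq (P Q : {poly K}) n :
  P`_0 = Q`_0 -> (forall i, (i < n)%N -> P^`()`_i = Q^`()`_i) ->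
  forall i, (i < n.+1)%N -> P`_i = Q`_i.
Proof.
move=> PQ0 dPQ [_|i lin]; first exact: PQ0.
have := dPQ i lin; rewrite !coef_deriv -[LHS]mulr_natl -[RHS]mulr_natl.
exact: (mulfI (natrK_neq0 (ltn0Sn i))).
Qed.

Lemma modXnP (P Q : {poly K}) n :
  (forall i, (i < n)%N -> P`_i = Q`_i) -> exists R, P = Q + R * 'X^n.
Proof.
move=> PQ; exists (drop_poly n (P - Q)).
rewrite -[LHS](addrNK Q) addrC; congr (_ + _).
rewrite -[LHS](poly_take_drop n) [take_poly _ _](_ : _ = 0) ?add0r //.
apply/polyP => i; rewrite coef_take_poly coefB coef0.
by case: ifP => // /PQ ->; rewrite subrr.
Qed.

Lemma coef_eqM (P P' Q Q' : {poly K}) n :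
  (forall i, (i < n)%N -> P`_i = P'`_i) -> (forall i, (i < n)%N -> Q`_i = Q'`_i) ->
  forall i, (i < n)%N -> (P * Q)`_i = (P' * Q')`_i.
Proof.
move=> PP QQ i lin; rewrite !coefM; apply: eq_bigr => j _.
by rewrite PP ?QQ //; have := ltn_ord j; lia.
Qed.

Lemma comp_mulX_pow_lt (R U : {poly K}) n i : U`_0 = 0 -> (i < n)%N ->
  ((R * 'X^n) \Po U)`_i = 0.
Proof.
move=> U0 lin; rewrite comp_polyM comp_Xn_poly.
have [V ->] : exists V, U = V * 'X.
  have [|V ->] := @modXnP U 0 1; first by case=> //= _; rewrite coef0.
  by exists V; rewrite add0r expr1.
by rewrite exprMn mulrA coefMXn lin.
Qed.

Lemma coef_eq_comp (P P' U : {poly K}) n : U`_0 = 0 ->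
  (forall i, (i < n)%N -> P`_i = P'`_i) ->
  forall i, (i < n)%N -> (P \Po U)`_i = (P' \Po U)`_i.
Proof.
move=> U0 /modXnP[R ->] i lin.
by rewrite comp_polyD coefD comp_mulX_pow_lt // addr0.
Qed.

Lemma coef0_comp (P U : {poly K}) : U`_0 = 0 -> (P \Po U)`_0 = P`_0.
Proof.
by move=> U0; rewrite -!horner_coef0 horner_comp [U.[0]]horner_coef0 U0.
Qed.

Lemma exp_poly_deriv N i : (i < N.-1)%N -> (exp_poly N)^`()`_i = (exp_poly N)`_i.
Proof.
move=> iN; rewrite coef_deriv !coef_poly -(exp_coefS i) mulr_natl.
by have [-> ->] : (i.+1 < N)%N /\ (i < N)%N by lia.
Qed.

Lemma log_poly_deriv N i : (i < N.-1)%N ->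
  ((log_poly N)^`() * (1 + 'X))`_i = (1 : {poly K})`_i.
Proof.
move=> iN; rewrite mulrDr mulr1 coefD coefMX !coef_deriv !coef_poly coef1.
have L j : (j < N.-1)%N -> (if (j.+1 < N)%N then log_coef j.+1 else 0) *+ j.+1 =
    (-1) ^+ j.
  move=> jN; rewrite ifT; last by lia.
  by rewrite /log_coef -[LHS]mulr_natr divfK //; exact: natrK_neq0.
rewrite L //; case: i iN => [|i] iN; first by rewrite expr0 addr0.
by rewrite /= L ?exprS ?mulN1r ?addNr //; lia.
Qed.

(** With V = e^X - 1, the chain rule gives the derivative L'(V) e^X modulo a power of X; as e^X is
    (1 + X) composed with V, this is L' (1 + X) composed with V, hence 1. *)
Lemma log_exp_poly N i : (i < N)%N ->
  (log_poly N \Po (exp_poly N - 1))`_i = ('X : {poly K})`_i.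
Proof.
case: N => [//|N].
have E0 : (exp_poly N.+1 - 1)`_0 = 0.
  by rewrite coefB coef_poly coef1 /= /exp_coef fact0 invr1 subrr.
apply: coef_deriv_eq; first by rewrite coef0_comp // coef_poly coefX.
move=> j jN; rewrite deriv_comp derivX derivB derivC subr0.
rewrite (coef_eqM (n := N) (fun=> fun=> erefl) (@exp_poly_deriv N.+1)) //.
set V := exp_poly N.+1 - 1.
have EV : exp_poly N.+1 = (1 + 'X) \Po V.
  by rewrite comp_polyD comp_polyX -polyC1 comp_polyC addrC polyC1 subrK.
rewrite [X in _ * X]EV -comp_polyM.
rewrite (coef_eq_comp E0 (@log_poly_deriv N.+1)) //.
by rewrite -polyC1 comp_polyC.
Qed.

(** The composite G satisfies (1 + X) G' = G modulo X^N and G(0) = 1; this determines its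
    coefficients one after the other, and they are those of 1 + X. *)
Lemma exp_log_poly N i : (i < N)%N ->
  (exp_poly N \Po log_poly N)`_i = (1 + 'X : {poly K})`_i.
Proof.
case: N => [//|N]; set G := _ \Po _ => iN.
have L0 : (log_poly N.+1)`_0 = 0 by rewrite coef_poly.
have G0 : G`_0 = 1 by rewrite coef0_comp // coef_poly /= /exp_coef fact0 invr1.
have dG j : (j < N)%N -> (G^`() * (1 + 'X))`_j = G`_j.
  move=> jN; rewrite deriv_comp -mulrA.
  rewrite (coef_eqM (coef_eq_comp L0 (@exp_poly_deriv N.+1))
                    (@log_poly_deriv N.+1)) //.
  by rewrite mulr1.
rewrite coefD coef1 coefX.
elim/ltn_ind: i iN => -[|[|i]] IH iN; first by rewrite addr0.
  have := dG 0 iN; rewrite mulrDr mulr1 coefD coefMX coef_deriv G0 !addr0 add0r.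
  by [].
have := dG i.+1 iN.
rewrite mulrDr mulr1 coefD coefMX !coef_deriv /= (IH i.+1) //; last exact: ltnW.
case: i {IH} iN => [|i] iN.
  rewrite /= add0r mulr1n => /(canRL (addrK _)); rewrite subrr addr0 => /eqP.
  by rewrite -[_ *+ _]mulr_natl mulf_eq0 (negPf (natrK_neq0 _)) //= => /eqP.
rewrite /= !addr0 mul0rn addr0 => /eqP.
by rewrite -[_ *+ _]mulr_natl mulf_eq0 (negPf (natrK_neq0 _)) //= => /eqP.
Qed.

Lemma exp_polyN N i : (i < N)%N ->
  (exp_poly N * \poly_(j < N) (exp_coef j * (-1) ^+ j))`_i = (1 : {poly K})`_i.
Proof.
move=> iN; rewrite coefM coef1.
transitivity (exp_coef i * \sum_(j < i.+1) (-1) ^+ (i - j) *+ 'C(i, j)).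
  rewrite mulr_sumr; apply: eq_bigr => j _; have ji := ltn_ord j.
  rewrite !coef_poly !ifT; [|lia..].
  rewrite mulrA exp_coef_bin; last by lia.
  by rewrite -mulrA mulr_natl mulrnAr.
rewrite -[\sum_(_ < _) _](_ : (-1 + 1) ^+ i = _); last first.
  by rewrite exprDn; apply: eq_bigr => j _; rewrite expr1n mulr1.
rewrite addNr expr0n; case: eqP => [->|]; rewrite ?mulr0 // mulr1.
by rewrite /exp_coef fact0 invr1.
Qed.

Variable E : algType K.

Definition aexp N (a : E) : E := \sum_(i < N) exp_coef i *: a ^+ i.
Definition alog N (a : E) : E := \sum_(i < N) log_coef i *: a ^+ i.

Lemma signZ e (x : E) : (-1 : K) ^+ e *: x = (-1) ^+ e * x.
Proof.
elim: e => [|e IH]; first by rewrite !expr0 scale1r mul1r.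
by rewrite !exprS -scalerA IH scaleN1r !mulN1r mulNr.
Qed.

Lemma horner_alg_poly N (c : nat -> K) (a : E) :
  horner_alg a (\poly_(i < N) c i) = \sum_(i < N) c i *: a ^+ i.
Proof.
rewrite poly_def raddf_sum; apply: eq_bigr => i _ /=.
by rewrite -mul_polyC rmorphM rmorphXn /= horner_algC horner_algX mulr_algl.
Qed.

Lemma horner_alg_comp (a : E) (P Q : {poly K}) :
  horner_alg a (P \Po Q) = horner_alg (horner_alg a Q) P.
Proof.
elim/poly_ind: P => [|P c IH]; first by rewrite comp_poly0 !rmorph0.
by rewrite comp_poly_MXaddC !rmorphD !rmorphM /= IH horner_algX !horner_algC.
Qed.

Lemma exp_log_alg N (u : E) :
  exists Q : {poly K}, aexp N (alog N u) = 1 + u + horner_alg u Q * u ^+ N.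
Proof.
have [Q EQ] := modXnP (@exp_log_poly N); exists Q.
rewrite /aexp -horner_alg_poly /alog -[\sum_(i < N) log_coef _ *: _]horner_alg_poly.
rewrite -horner_alg_comp [_ \Po _]EQ !rmorphD rmorphM rmorph1 rmorphXn /=.
by rewrite horner_algX.
Qed.

Lemma log_exp_alg N (a : E) :
  exists Q : {poly K}, alog N (aexp N a - 1) = a + horner_alg a Q * a ^+ N.
Proof.
have [Q EQ] := modXnP (@log_exp_poly N); exists Q.
rewrite /aexp -horner_alg_poly -(rmorph1 (horner_alg a)) -rmorphB /=.
rewrite /alog -horner_alg_poly -horner_alg_comp [_ \Po _]EQ.
by rewrite !rmorphD rmorphM rmorphXn /= horner_algX.
Qed.

Lemma exp_oppr_alg N (a : E) :
  exists Q : {poly K}, aexp N a * aexp N (- a) = 1 + horner_alg a Q * a ^+ N.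
Proof.
have [Q EQ] := modXnP (@exp_polyN N); exists Q.
have -> : aexp N (- a) = horner_alg a (\poly_(i < N) (exp_coef i * (-1) ^+ i)).
  rewrite horner_alg_poly; apply: eq_bigr => i _.
  by rewrite (exprNn a) -[RHS]scalerA signZ.
rewrite /aexp -horner_alg_poly -rmorphM /= [_ * _]EQ.
by rewrite !rmorphD rmorphM rmorph1 rmorphXn /= horner_algX.
Qed.

Lemma aexp_logK N (u : E) : u ^+ N = 0 -> aexp N (alog N u) = 1 + u.
Proof. by move=> uN; have [Q ->] := exp_log_alg N u; rewrite uN mulr0 addr0. Qed.

Lemma alog_expK N (a : E) : a ^+ N = 0 -> alog N (aexp N a - 1) = a.
Proof. by move=> aN; have [Q ->] := log_exp_alg N a; rewrite aN mulr0 addr0. Qed.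

Lemma aexpVr N (a : E) : a ^+ N = 0 -> aexp N a * aexp N (- a) = 1.
Proof. by move=> aN; have [Q ->] := exp_oppr_alg N a; rewrite aN mulr0 addr0. Qed.

Lemma aexpVl N (a : E) : a ^+ N = 0 -> aexp N (- a) * aexp N a = 1.
Proof. by move=> aN; rewrite -{2}(opprK a) aexpVr // exprNn aN mulr0. Qed.

End TruncatedExpLog.

(** * Koszul signs and the signed convolution algebra *)

(* Functions on subsets of 'I_n stand for the elements \sum_U f_U eps_U of the
   tensor product of R with the free graded commutative algebra on variables
   eps_i of degree - d i, modulo the squares of the eps_i. *)
Definition conv (K : fieldType) (R : algType K) (n : nat) (d : 'I_n -> int) :
  Type := {ffun {set 'I_n} -> R}.

Arguments conv {K} R {n} d.

Section SignedConvolution.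
Variables (K : fieldType) (R : algType K) (n : nat) (d : 'I_n -> int).
Implicit Types U V W S : {set 'I_n}.

(* The Koszul sign of a_S |-> a_U a_V, for S the disjoint union of U and V, is
   (-1) ^+ cross U V, where a_S is the product of the a_i in increasing order. *)
Definition inv_exp (i j : 'I_n) : nat :=
  if (j < i)%N then (`|d i|%N * `|d j|%N)%N else 0%N.
Definition cross (U V : {set 'I_n}) : nat :=
  (\sum_(i in U) \sum_(j in V) inv_exp i j)%N.

Lemma crossUl U U' V : [disjoint U & U'] ->
  cross (U :|: U') V = (cross U V + cross U' V)%N.
Proof. by move=> dUU; rewrite /cross -bigU //; apply: eq_bigl => i; rewrite !inE. Qed.

Lemma crossUr U V V' : [disjoint V & V'] ->
  cross U (V :|: V') = (cross U V + cross U V')%N.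
Proof.
move=> dVV; rewrite /cross -big_split; apply: eq_bigr => i _ /=.
by rewrite -bigU //; apply: eq_bigl => j; rewrite !inE.
Qed.

Lemma cross0s V : cross set0 V = 0%N.
Proof. by rewrite /cross big_set0. Qed.

Lemma crosss0 U : cross U set0 = 0%N.
Proof. by rewrite /cross big1 // => i _; rewrite big_set0. Qed.

Definition sgn (e : nat) : K := (-1) ^+ e.

Lemma sgnD e f : sgn (e + f) = sgn e * sgn f.
Proof. exact: exprD. Qed.

HB.instance Definition _ := GRing.Lmodule.on (conv R d).

Implicit Types f g h : conv R d.

Definition cmul f g : conv R d := [ffun S : {set 'I_n} =>
  \sum_(U : {set 'I_n} | U \subset S) sgn (cross U (S :\: U)) *: (f U * g (S :\: U))].

Definition cone : conv R d := [ffun S : {set 'I_n} => if S == set0 then 1 else 0].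

(** Both sides sum over the ordered decompositions of S into three blocks V, W and the rest, the
    union V and W being the block U of the other bracketing; the signs agree because [cross] is
    additive in each argument. *)
Fact cmulA : associative cmul.
Proof.
move=> f g h; apply/ffunP => S; rewrite !ffunE.
transitivity (\sum_(V : {set 'I_n} | V \subset S) \sum_(W : {set 'I_n} | W \subset S :\: V)
   sgn (cross V (S :\: V) + cross W (S :\: V :\: W)) *:
     (f V * g W * h (S :\: V :\: W))).
  apply: eq_bigr => V VS; rewrite ffunE mulr_sumr scaler_sumr.
  by apply: eq_bigr => W WS; rewrite -scalerAr scalerA -sgnD mulrA.
transitivity (\sum_(U : {set 'I_n} | U \subset S) \sum_(V : {set 'I_n} | V \subset U)
   sgn (cross U (S :\: U) + cross V (U :\: V)) *:
     (f V * g (U :\: V) * h (S :\: U))); last first.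
  apply: eq_bigr => U US; rewrite ffunE mulr_suml scaler_sumr.
  by apply: eq_bigr => V VS; rewrite -scalerAl scalerA -sgnD.
rewrite [RHS](exchange_big_dep (fun V : {set 'I_n} => V \subset S)) /=; last first.
  by move=> U V US VU; exact: subset_trans US.
apply: eq_bigr => V VS.
rewrite [RHS](reindex_onto (fun W => V :|: W) (fun U => U :\: V)) /=; last first.
  by move=> U /andP[US VU]; rewrite setDE setUIr setUCr setIT; apply/setUidPr.
apply: eq_big => [W|W WS].
  rewrite subUset VS subsetUl andbT /=.
  by rewrite setDUl setDv set0U (sameP eqP setDidPl) subsetD.
move: WS; rewrite subsetD => /andP[WS dWV].
have E : (V :|: W) :\: V = W by rewrite setDUl setDv set0U; apply/setDidPl.
rewrite E -setDDl; congr (sgn _ *: _).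
have -> : cross V (S :\: V) = (cross V W + cross V (S :\: V :\: W))%N.
  rewrite -crossUr ?setDUr; last first.
    by rewrite -setI_eq0; apply/eqP/setP => i; rewrite !inE; case: (i \in W).
  congr cross; apply/setP => i; rewrite !inE.
  have := subsetP WS i; have := disjointFr dWV (x := i).
  by case: (i \in W) => // H1 H2; rewrite H1 // H2.
rewrite crossUl; last by rewrite disjoint_sym.
lia.
Qed.

Fact cmul1f : left_id cone cmul.
Proof.
move=> f; apply/ffunP => S; rewrite ffunE (bigD1 set0) ?sub0set //=.
rewrite !ffunE eqxx cross0s setD0 mul1r scale1r big1 ?addr0 // => U /andP[_ U0].
by rewrite ffunE (negPf U0) mul0r scaler0.
Qed.

Fact cmulf1 : right_id cone cmul.
Proof.
move=> f; apply/ffunP => S; rewrite ffunE (bigD1 S) //=.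
rewrite !ffunE setDv eqxx crosss0 mulr1 scale1r big1 ?addr0 // => U /andP[US UneS].
rewrite ffunE setD_eq0 ifF ?mulr0 ?scaler0 //.
by apply: contraNF UneS => SU; rewrite eqEsubset US.
Qed.

Fact cmulDl : left_distributive cmul +%R.
Proof.
move=> f g h; apply/ffunP => S; rewrite !ffunE -big_split; apply: eq_bigr => U _.
by rewrite ffunE mulrDl scalerDr.
Qed.

Fact cmulDr : right_distributive cmul +%R.
Proof.
move=> f g h; apply/ffunP => S; rewrite !ffunE -big_split; apply: eq_bigr => U _.
by rewrite ffunE mulrDr scalerDr.
Qed.

Fact cone_neq0 : cone != 0.
Proof.
apply/eqP => /ffunP/(_ set0); rewrite !ffunE eqxx => /eqP.
by rewrite oner_eq0.
Qed.

HB.instance Definition _ := GRing.Zmodule_isNzRing.Build (conv R d)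
  cmulA cmul1f cmulf1 cmulDl cmulDr cone_neq0.

Fact cscaleAl (c : K) f g : c *: (f * g) = (c *: f) * g.
Proof.
apply/ffunP => S; rewrite !ffunE scaler_sumr; apply: eq_bigr => U _.
by rewrite ffunE -scalerAl !scalerA mulrC.
Qed.
HB.instance Definition _ := GRing.Lmodule_isLalgebra.Build K (conv R d) cscaleAl.

Fact cscaleAr (c : K) f g : c *: (f * g) = f * (c *: g).
Proof.
apply/ffunP => S; rewrite !ffunE scaler_sumr; apply: eq_bigr => U _.
by rewrite ffunE -scalerAr !scalerA mulrC.
Qed.
HB.instance Definition _ := GRing.Lalgebra_isAlgebra.Build K (conv R d) cscaleAr.

Lemma cmulE f g S : (f * g) S =
  \sum_(U : {set 'I_n} | U \subset S) sgn (cross U (S :\: U)) *: (f U * g (S :\: U)).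
Proof. by rewrite [LHS]ffunE. Qed.

Lemma cone_val S : (1 : conv R d) S = if S == set0 then 1 else 0.
Proof. by rewrite [LHS]ffunE. Qed.

Lemma conv_sumE (I : Type) (r : seq I) (P : pred I) (F : I -> conv R d) S :
  (\sum_(i <- r | P i) F i) S = \sum_(i <- r | P i) F i S.
Proof. by elim/big_rec2: _ => [|i x y _ <-]; rewrite ffunE. Qed.

(** A nonzero term of the k-th power would split S into k nonempty blocks. *)
Lemma cexp_small f k S : f set0 = 0 -> (#|S| < k)%N -> (f ^+ k) S = 0.
Proof.
move=> f0; elim: k S => [//|k IH] S Sk; rewrite exprS cmulE big1 // => U US.
case: (eqVneq U set0) => [->|U0]; first by rewrite f0 mul0r scaler0.
rewrite IH ?mulr0 ?scaler0 // cardsD (setIidPr US).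
have : (0 < #|U|)%N by rewrite card_gt0.
by have := subset_leq_card US; lia.
Qed.

Lemma cexp_nilp f N : f set0 = 0 -> (n < N)%N -> f ^+ N = 0.
Proof.
move=> f0 nN; apply/ffunP => S; rewrite cexp_small ?ffunE //.
by apply: leq_ltn_trans nN; rewrite -[leqRHS](card_ord n) max_card.
Qed.

End SignedConvolution.

(** * Koszul signs of words and of words of blocks *)

Section PairSum.
Variables (I : eqType) (F : I -> I -> nat).

(** For F = [inv_exp d] this is the exponent of the Koszul sign of the word w. Unlike [koszul_exp],
    which refers to positions, it behaves well under concatenation. *)
Fixpoint pairsum (w : seq I) : nat :=
  if w is a :: w' then (\sum_(b <- w') F a b + pairsum w')%N else 0%N.

Lemma pairsum_cat w1 w2 : pairsum (w1 ++ w2) =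
  (pairsum w1 + pairsum w2 + \sum_(a <- w1) \sum_(b <- w2) F a b)%N.
Proof.
elim: w1 => [|a w1 IH] /=; first by rewrite big_nil addn0.
by rewrite IH big_cat big_cons /=; lia.
Qed.

Lemma pairsum_eq0 w : pairwise (fun a b => F a b == 0%N) w -> pairsum w = 0%N.
Proof.
elim: w => //= a w IH /andP[/allP aw /IH ->].
by rewrite addn0 big_seq big1 // => b /aw/eqP.
Qed.

Lemma pairsum_index w : uniq w -> pairsum w =
  (\sum_(i <- w) \sum_(j <- w | (index i w < index j w)%N) F i j)%N.
Proof.
elim: w => [|a w IH]; first by rewrite big_nil.
move=> /= /andP[aw uw]; rewrite big_cons /= eqxx; congr (_ + _)%N.
  rewrite big_cons eqxx /= [LHS]big_seq [RHS]big_seq_cond; apply: eq_bigl => b.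
  by case bw: (b \in w); rewrite //= ifF //; apply: contraNF aw => /eqP ->.
rewrite IH // !big_seq; apply: eq_bigr => i iw.
have ai : (a == i) = false by apply: contraNF aw => /eqP ->.
rewrite big_cons /= ai eqxx ltn0 [LHS]big_seq_cond [RHS]big_seq_cond; apply: eq_bigl => j.
by case jw: (j \in w); rewrite //= ifF //; apply: contraNF aw => /eqP ->.
Qed.

End PairSum.

Lemma pairsumE (I : finType) (F : I -> I -> nat) (w : seq I) :
  uniq w -> w =i I -> pairsum F w =
  (\sum_i \sum_(j | (index i w < index j w)%N) F i j)%N.
Proof.
move=> uw wI; rewrite pairsum_index //.
have pw : perm_eq w (index_enum I).
  by apply: uniq_perm; rewrite ?index_enum_uniq // => i; rewrite wI mem_index_enum.
by rewrite (perm_big _ pw); apply: eq_bigr => i _; rewrite (perm_big _ pw).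
Qed.

Lemma odd_sum (I : Type) (r : seq I) (P : pred I) (F G : I -> nat) :
  (forall i, P i -> odd (F i) = odd (G i)) ->
  odd (\sum_(i <- r | P i) F i) = odd (\sum_(i <- r | P i) G i).
Proof.
by move=> FG; rewrite !(big_morph odd oddD (erefl _)); apply: eq_bigr => i /FG.
Qed.

Lemma odd_absz_sum (I : Type) (r : seq I) (P : pred I) (F : I -> int) :
  odd (absz (\sum_(i <- r | P i) F i)) = odd (\sum_(i <- r | P i) `|F i|%N)%N.
Proof. by elim/big_rec2: _ => // i x y _; lia. Qed.

Section KoszulSigns.
Variables (n : nat) (d : 'I_n -> int).
Implicit Types U V W S : {set 'I_n}.

Lemma koszul_exp_pairsum (w : seq 'I_n) : uniq w -> w =i 'I_n ->
  koszul_exp d w = pairsum (inv_exp d) w.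
Proof.
move=> uw wI; rewrite pairsumE // [RHS](exchange_big_dep predT) //=.
apply: eq_bigr => i _; rewrite [RHS]big_mkcond [LHS]big_mkcond.
apply: eq_bigr => j _; rewrite /inv_exp.
by case: (i < j)%N; case: (index _ _ < _)%N => //=; rewrite mulnC.
Qed.

Lemma cross_enum U V :
  cross d U V = (\sum_(a <- enum U) \sum_(b <- enum V) inv_exp d a b)%N.
Proof.
by rewrite /cross big_enum; apply: eq_bigr => i _; rewrite big_enum.
Qed.

Lemma enum_pairwise U : pairwise (fun a b : 'I_n => (a < b)%N) (enum U).
Proof.
rewrite -sorted_pairwise; last by move=> ? ? ?; exact: ltn_trans.
rewrite /enum_mem sorted_filter //; first by move=> ? ? ?; exact: ltn_trans.
by have := iota_ltn_sorted 0 n; rewrite -val_enum_ord sorted_map enumT.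
Qed.

Lemma pairsum_enum U : pairsum (inv_exp d) (enum U) = 0%N.
Proof.
apply/pairsum_eq0/(sub_pairwise _ (enum_pairwise U)) => a b ab.
by rewrite /inv_exp ltnNge ltnW.
Qed.

(** Each block is listed increasingly and has no inversion of its own; only inversions between
    blocks remain. *)
Lemma pairsum_flatten (l : seq {set 'I_n}) :
  pairsum (inv_exp d) (flatten [seq enum U | U : {set 'I_n} <- l]) = pairsum (cross d) l.
Proof.
elim: l => //= U l IH; rewrite pairsum_cat pairsum_enum IH add0n addnC.
congr (_ + _)%N; elim: l {IH} => [|V l IH] /=.
  by rewrite big_nil big1 // => i _; rewrite big_nil.
by rewrite big_cons -IH cross_enum -big_split; apply: eq_bigr => i _; rewrite big_cat.
Qed.

(** Each pair in U x V is an inversion in exactly one of the two orders. *)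
Lemma crossC U V : [disjoint U & V] ->
  (cross d U V + cross d V U = (\sum_(i in U) `|d i|%N) * (\sum_(i in V) `|d i|%N))%N.
Proof.
move=> dUV; rewrite /cross [X in (_ + X)%N]exchange_big -big_split big_distrl /=.
apply: eq_bigr => i iU; rewrite -big_split big_distrr /=; apply: eq_bigr => j jV.
rewrite /inv_exp; case: (ltngtP j i) => // ji; first by rewrite addn0.
  by rewrite mulnC.
by have := disjointFr dUV iU; rewrite -(val_inj ji) jV.
Qed.

(* The total Koszul sign of a word of disjoint blocks is the one of the blocks
   in their given order, times the one of the permutation of the blocks. *)
Lemma sgn_blocks (K : fieldType) m (U : 'I_m -> {set 'I_n}) (w : seq 'I_m) :
  (forall i j, i != j -> [disjoint U i & U j]) -> uniq w -> w =i 'I_m ->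
  sgn K (pairsum (fun a b => cross d (U a) (U b)) w) =
  sgn K (pairsum (fun a b => cross d (U a) (U b)) (enum 'I_m)) *
  sgn K (koszul_exp (fun i => \sum_(j in U i) d j) w).
Proof.
move=> dU uw wI; rewrite -sgnD /sgn -signr_odd -[RHS]signr_odd; congr (_ ^+ nat_of_bool _).
(* Each pair i < j contributes one of the two crossings of its blocks, according to the order of i
   and j in v. *)
have E v : uniq v -> v =i 'I_m -> pairsum (fun a b => cross d (U a) (U b)) v =
  (\sum_(i < m) \sum_(j < m | (i < j)%N) if (index i v < index j v)%N then
     cross d (U i) (U j) else cross d (U j) (U i))%N.
  move=> uv vI; rewrite pairsumE //.
  have neq_index (i j : 'I_m) : (i < j)%N -> index i v != index j v.
    by move=> ij; apply: contraTneq ij => /(index_inj i); rewrite !vI => ->; rewrite ?ltnn.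
  transitivity (\sum_(i < m) \sum_(j < m | (i < j)%N)
    ((if (index i v < index j v)%N then cross d (U i) (U j) else 0) +
     (if (index j v < index i v)%N then cross d (U j) (U i) else 0)))%N; last first.
    apply: eq_bigr => i _; apply: eq_bigr => j /neq_index.
    by case: ltngtP => //=; rewrite ?addn0.
  under [RHS]eq_bigr do rewrite big_split /=.
  rewrite [RHS]big_split /= [X in (_ + X)%N](exchange_big_dep predT) //= -big_split /=.
  apply: eq_bigr => i _; rewrite -!big_mkcondr /= (bigID (fun j : 'I_m => (i < j)%N)) /=.
  congr (_ + _)%N; first by apply: eq_bigl => j; rewrite andbC.
  apply: eq_bigl => j; rewrite andbC; case: (ltngtP i j) => //= ij.
  by rewrite (val_inj ij) ltnn.
rewrite oddD !E ?enum_uniq // => [|i]; last by rewrite mem_enum.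
rewrite /koszul_exp -oddD -big_split /=.
apply: odd_sum => i _; rewrite big_mkcondr -big_split; apply: odd_sum => j /= ij.
rewrite !index_enum_ord ij.
have ij' : i != j by apply: contraTneq ij => ->; rewrite ltnn.
(* Swapping two blocks changes the exponent, modulo 2, by the product of their total degrees; the
   absolute value of a sum and the sum of the absolute values have the same parity. *)
have := crossC (dU _ _ ij').
have : index i w != index j w.
  by apply: contra_neq ij' => /(index_inj i); rewrite !wI => ->.
move=> /eqP nw /(congr1 odd); rewrite oddD !oddM -!odd_absz_sum.
by case: (ltngtP (index i w) (index j w)) nw => // _ _; rewrite ?addn0 // oddD oddM => <-;
  rewrite addbA addbb.
Qed.

End KoszulSigns.

Section Deltas.
Variables (K : fieldType) (R : algType K) (n : nat) (d : 'I_n -> int).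
Implicit Types U V W S : {set 'I_n}.
Implicit Types f g : conv R d.

(** The monomial y eps_U. *)
Definition dl U (y : R) : conv R d := [ffun S => if S == U then y else 0].

Lemma dlE U y S : dl U y S = if S == U then y else 0.
Proof. by rewrite ffunE. Qed.

Lemma dl0 U : dl U 0 = 0.
Proof. by apply/ffunP => S; rewrite dlE !ffunE if_same. Qed.

Lemma dlZ U c y : dl U (c *: y) = c *: dl U y.
Proof. by apply/ffunP => S; rewrite [RHS]ffunE !dlE; case: eqP; rewrite ?scaler0. Qed.

Lemma conv_dl f : f = \sum_U dl U (f U).
Proof.
apply/ffunP => S; rewrite conv_sumE (bigD1 S) //= dlE eqxx big1 ?addr0 // => U.
by rewrite dlE eq_sym => /negPf ->.
Qed.

Lemma dlM U V y z : dl U y * dl V z =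
  if [disjoint U & V] then sgn K (cross d U V) *: dl (U :|: V) (y * z) else 0.
Proof.
apply/ffunP => S; rewrite cmulE; case: ifP => UV; last first.
  rewrite big1 ?ffunE // => W _; rewrite !dlE.
  case: eqP => [->|_]; last by rewrite mul0r scaler0.
  case: eqP => [E|_]; last by rewrite mulr0 scaler0.
  by rewrite -E -setI_eq0 setIDA setIC -setIDA setDv setI0 eqxx in UV.
rewrite !ffunE; case: (eqVneq S (U :|: V)) => [->|SUV].
  rewrite (bigD1 U) ?subsetUl //= big1 => [|W /andP[_ WU]]; last first.
    by rewrite !dlE (negPf WU) mul0r scaler0.
  have -> : (U :|: V) :\: U = V.
    by rewrite setDUl setDv set0U; apply/setDidPl; rewrite disjoint_sym.
  by rewrite !dlE !eqxx addr0.
rewrite scaler0 big1 // => W WS; rewrite !dlE.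
case: eqP WS => [->|_] WS; last by rewrite mul0r scaler0.
case: eqP => [E|_]; last by rewrite mulr0 scaler0.
by rewrite -E setDE setUIr setUCr setIT (setUidPr WS) eqxx in SUV.
Qed.

Section Products.
Variables (I : eqType) (U : I -> {set 'I_n}) (y : I -> R).

Definition block_disjoint (w : seq I) := pairwise (fun a b => [disjoint U a & U b]) w.

Lemma disjoint_bigcup V (w : seq I) :
  [disjoint V & \bigcup_(j <- w) U j] = all (fun j => [disjoint V & U j]) w.
Proof.
elim: w => [|a w IH] /=; first by rewrite big_nil -setI_eq0 setI0 eqxx.
by rewrite big_cons -setI_eq0 setIUr setU_eq0 !setI_eq0 IH.
Qed.

Lemma cross_bigcup V w : block_disjoint w ->
  cross d V (\bigcup_(j <- w) U j) = (\sum_(j <- w) cross d V (U j))%N.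
Proof.
elim: w => [|a w IH] /=; first by rewrite !big_nil crosss0.
move=> /andP[aw /IH IHw]; rewrite !big_cons crossUr ?IHw //.
by rewrite disjoint_bigcup.
Qed.

Lemma prod_dl w : \prod_(j <- w) dl (U j) (y j) =
  if block_disjoint w then
    sgn K (pairsum (fun a b => cross d (U a) (U b)) w) *:
      dl (\bigcup_(j <- w) U j) (\prod_(j <- w) y j)
  else 0.
Proof.
elim: w => [|a w IH] /=.
  rewrite !big_nil /sgn expr0 scale1r; apply/ffunP => S.
  by rewrite [RHS]dlE; exact: cone_val.
rewrite !big_cons IH; case dw: (block_disjoint w); last by rewrite mulr0 andbF.
rewrite -scalerAr dlM disjoint_bigcup andbT; case: ifP => _; last by rewrite scaler0.
by rewrite scalerA -sgnD cross_bigcup // addnC.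
Qed.

End Products.

End Deltas.

(** * Koszul brackets as coefficients of an exponential conjugation *)

Section Unshuffles.
Variables (n : nat).
Implicit Types (s : 'S_n) (V : {set 'I_n}).

(** An (i, n-i)-unshuffle is determined by this set of i elements, and every such set occurs: sums
    over unshuffles become sums over subsets. *)
Definition first_values i s : {set 'I_n} := [set s p | p : 'I_n & (p < i)%N].

Lemma big_enum_ord_cond (R : Type) (idx : R) (op : R -> R -> R) (P : pred 'I_n)
    (F : 'I_n -> R) :
  \big[op/idx]_(p <- enum 'I_n | P p) F p = \big[op/idx]_(p | P p) F p.
Proof. by rewrite enumT /index_enum; case: index_enum_key. Qed.

Lemma take_enum_ord i : take i (enum 'I_n) = [seq p : 'I_n <- enum 'I_n | (p < i)%N].
Proof.
apply: (inj_map val_inj); rewrite map_take val_enum_ord.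
rewrite (_ : (fun p : 'I_n => (p < i)%N) = preim val (fun p => p < i)%N) //.
rewrite -filter_map val_enum_ord; case: (leqP i n) => [le_in|/ltnW le_ni].
  by rewrite take_iota (minn_idPl le_in) -[in RHS](add0n i) filter_iota_ltn.
rewrite take_oversize ?size_iota //; apply/esym/all_filterP/allP => j.
by rewrite mem_iota => /andP[_ /leq_trans]; apply.
Qed.

Lemma drop_enum_ord i : drop i (enum 'I_n) = [seq p : 'I_n <- enum 'I_n | (i <= p)%N].
Proof.
have : uniq (enum 'I_n) by exact: enum_uniq.
rewrite -{1 3}(cat_take_drop i (enum 'I_n)) filter_cat cat_uniq => /and3P[_ /hasPn dt _].
rewrite [X in _ = X ++ _](_ : _ = [::]) /=; last first.
  apply/eqP; rewrite -[_ == _]negbK -has_filter; apply/hasPn => p.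
  by rewrite take_enum_ord mem_filter -ltnNge => /andP[].
apply/esym/all_filterP/allP => p /dt; rewrite take_enum_ord mem_filter mem_enum andbT.
by rewrite -leqNgt.
Qed.

Lemma sorted_lt_enum V (w : seq 'I_n) :
  pairwise (fun a b : 'I_n => (a < b)%N) w -> w =i V -> w = enum V.
Proof.
rewrite -sorted_pairwise; last by move=> ? ? ?; exact: ltn_trans.
move=> sw wV; apply: (@irr_sorted_eq _ (fun a b : 'I_n => (a < b)%N)) => //.
- by move=> ? ? ?; exact: ltn_trans.
- by move=> ?; exact: ltnn.
- by rewrite sorted_pairwise ?enum_pairwise //; move=> ? ? ?; exact: ltn_trans.
by move=> i; rewrite wV mem_enum.
Qed.

Lemma unshuffle_take i s : unshuffle i s ->
  [seq s p | p <- take i (enum 'I_n)] = enum (first_values i s).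
Proof.
move=> /forallP us; apply: sorted_lt_enum.
  rewrite pairwise_map take_enum_ord.
  apply: (@sub_in_pairwise _ [pred p : 'I_n | (p < i)%N] (fun a b : 'I_n => (a < b)%N)).
  - move=> p q; rewrite !inE => pi qi pq; move/forallP: (us p) => /(_ q).
    by rewrite pq qi.
  - by apply/allP => p; rewrite mem_filter => /andP[].
  apply: pairwise_filter.
  have := iota_ltn_sorted 0 n; rewrite -val_enum_ord sorted_map sorted_pairwise //.
  by move=> ? ? ?; exact: ltn_trans.
move=> j; rewrite take_enum_ord; apply/mapP/imsetP => -[p].
  by rewrite mem_filter => /andP[pi _] ->; exists p; rewrite ?inE.
by rewrite inE => pi ->; exists p; rewrite // mem_filter pi mem_enum.
Qed.

Lemma first_valuesC i s j : (j \in ~: first_values i s) = (i <= (s^-1)%g j)%N.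
Proof.
rewrite inE leqNgt; congr (~~ _); apply/imsetP/idP => [[p]|ij].
  by rewrite inE => pi ->; rewrite permK.
by exists ((s^-1)%g j); rewrite ?inE // permKV.
Qed.

Lemma unshuffle_drop i s : unshuffle i s ->
  [seq s p | p <- drop i (enum 'I_n)] = enum (~: first_values i s).
Proof.
move=> /forallP us; apply: sorted_lt_enum.
  rewrite pairwise_map drop_enum_ord.
  apply: (@sub_in_pairwise _ [pred p : 'I_n | (i <= p)%N] (fun a b : 'I_n => (a < b)%N)).
  - move=> p q; rewrite !inE => pi qi pq; move/forallP: (us p) => /(_ q).
    by rewrite pq pi orbT.
  - by apply/allP => p; rewrite mem_filter => /andP[].
  apply: pairwise_filter.
  have := iota_ltn_sorted 0 n; rewrite -val_enum_ord sorted_map sorted_pairwise //.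
  by move=> ? ? ?; exact: ltn_trans.
move=> j; rewrite drop_enum_ord first_valuesC; apply/mapP/idP => [[p]|ij].
  by rewrite mem_filter => /andP[pi _] ->; rewrite permK.
by exists ((s^-1)%g j); rewrite ?permKV // mem_filter ij mem_enum.
Qed.

Lemma unshuffle_word i s : unshuffle i s ->
  [seq s p | p <- enum 'I_n] = enum (first_values i s) ++ enum (~: first_values i s).
Proof.
by move=> us; rewrite -unshuffle_take // -unshuffle_drop // -map_cat cat_take_drop.
Qed.

Lemma card_first_values i s : (i <= n)%N -> #|first_values i s| = i.
Proof.
move=> le_in; rewrite card_imset; last exact: perm_inj.
rewrite cardE (@eq_enum _ _ (mem [pred p : 'I_n | (p < i)%N])); last by move=> p; rewrite !inE.
rewrite /enum_mem -enumT -[filter _ _]take_enum_ord size_takel // size_enum_ord //.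
Qed.

Lemma uniq_enum_cat V : uniq (enum V ++ enum (~: V)).
Proof.
rewrite cat_uniq !enum_uniq andbT /=; apply/hasPn => i.
by rewrite !mem_enum inE.
Qed.

Lemma mem_enum_cat V : enum V ++ enum (~: V) =i 'I_n.
Proof. by move=> i; rewrite mem_cat !mem_enum inE orbN. Qed.

Lemma size_enum_cat V : size (enum V ++ enum (~: V)) = n.
Proof. by rewrite size_cat -!cardE cardsC card_ord. Qed.

(** The permutation reads the increasing enumeration of V, then that of its complement. *)
Lemma unshuffle_exists V : {s | unshuffle #|V| s & first_values #|V| s = V}.
Proof.
set w := enum V ++ enum (~: V).
have wi : injective (fun p : 'I_n => nth p w p).
  move=> p q; rewrite (set_nth_default q) ?size_enum_cat // => /eqP.
  by rewrite nth_uniq ?size_enum_cat ?uniq_enum_cat // => /eqP/val_inj.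
exists (perm wi).
  apply/forallP => p; apply/forallP => q; apply/implyP => /andP[pq pqV].
  rewrite !permE (set_nth_default p q) ?size_enum_cat // !nth_cat -!cardE.
  have tr : transitive (fun a b : 'I_n => (a < b)%N) by move=> ? ? ?; exact: ltn_trans.
  have lts (W : {set 'I_n}) (a b : nat) : (a < b)%N -> (b < #|W|)%N ->
      (nth p (enum W) a < nth p (enum W) b)%N.
    move=> ab bW; apply: (@sorted_ltn_nth _ (fun a b : 'I_n => (a < b)%N)) => //.
    - by rewrite sorted_pairwise // enum_pairwise.
    - by rewrite inE -cardE; exact: ltn_trans bW.
    - by rewrite inE -cardE.
  case/orP: pqV => [qV|Vp].
    by rewrite qV (ltn_trans pq qV) lts.
  rewrite !ltnNge Vp (leq_trans Vp (ltnW pq)) /= -ltnNge lts //.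
    by rewrite ltn_sub2r //; exact: leq_ltn_trans pq.
  by rewrite ltn_subLR ?cardsC ?card_ord ?ltn_ord // (leq_trans Vp (ltnW pq)).
apply/setP => j; apply/imsetP/idP => [[p]|jV].
  rewrite inE => pV ->; rewrite permE nth_cat -cardE pV -mem_enum mem_nth //.
  by rewrite -cardE.
have jw : (index j w < n)%N.
  by rewrite -[ltnRHS](size_enum_cat V) index_mem mem_enum_cat.
exists (Ordinal jw); rewrite ?permE ?nth_index ?mem_enum_cat //.
by rewrite inE /= index_cat mem_enum jV cardE index_mem mem_enum.
Qed.

Lemma unshuffle_inj i s s' : unshuffle i s -> unshuffle i s' ->
  first_values i s = first_values i s' -> s = s'.
Proof.
move=> us us' E; apply/permP => p.
have := unshuffle_word us; rewrite E -unshuffle_word // => /eq_in_map; apply.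
by rewrite mem_enum.
Qed.

Lemma sum_unshuffles (Z : zmodType) i (H : {set 'I_n} -> Z) : (i <= n)%N ->
  \sum_(s : 'S_n | unshuffle i s) H (first_values i s) =
  \sum_(V : {set 'I_n} | #|V| == i) H V.
Proof.
move=> le_in.
rewrite (partition_big (first_values i) (fun V => #|V| == i)) /=; last first.
  by move=> s _; rewrite card_first_values.
apply: eq_bigr => V /eqP cV; have [s0] := unshuffle_exists V.
rewrite cV => us0 Vs0; rewrite (big_pred1 s0) ?Vs0 // => s.
apply/andP/eqP => [[us /eqP Vs]|->]; last by rewrite us0 Vs0.
by apply: unshuffle_inj us us0 _; rewrite Vs Vs0.
Qed.

End Unshuffles.

Section SubsetBracket.
Variables (K : fieldType) (R : algType K).

(** The coefficients c are left free so that the same expression covers the Koszul bracket with its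
    signs and the bracket of an even element of the convolution algebra, where only (-1)^(m - |V|)
    is left. *)
Definition subset_bracket m (c : {set 'I_m} -> K) (D : R -> R) (z : 'I_m -> R) : R :=
  \sum_(V : {set 'I_m})
    c V *: (D (\prod_(i <- enum V) z i) * \prod_(i <- enum (~: V)) z i).

Lemma koszul_exp_enum n (d : 'I_n -> int) (V : {set 'I_n}) :
  koszul_exp d (enum V ++ enum (~: V)) = cross d V (~: V).
Proof.
rewrite koszul_exp_pairsum ?uniq_enum_cat //; last exact: mem_enum_cat.
have := pairsum_flatten d [:: V; ~: V]; rewrite /= cats0 => ->.
by rewrite big_seq1 big_nil !addn0.
Qed.

(** The sum over unshuffles starts at i = 1; [D 1 = 0] allows the empty subset to be included. *)
Lemma koszul_bracketE n (d : 'I_n -> int) (D : R -> R) (a : 'I_n -> R) : D 1 = 0 ->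
  koszul_bracket d D a =
  subset_bracket (fun V => sgn K (cross d V (~: V) + (n - #|V|))) D a.
Proof.
move=> D1; rewrite /koszul_bracket /subset_bracket.
pose H (V : {set 'I_n}) := sgn K (cross d V (~: V) + (n - #|V|)) *:
  (D (\prod_(i <- enum V) a i) * \prod_(i <- enum (~: V)) a i).
transitivity (\sum_(1 <= i < n.+1) \sum_(V : {set 'I_n} | #|V| == i) H V).
  apply: eq_big_nat => i /andP[i0 le_in].
  rewrite -sum_unshuffles //; apply: eq_bigr => s us.
  rewrite (unshuffle_word us) koszul_exp_enum /H card_first_values // sgnD.
  rewrite -scalerA !signZ -!mulrA -unshuffle_take // -unshuffle_drop //.
  rewrite !big_map take_enum_ord drop_enum_ord !big_filter.
  by rewrite !big_enum_ord_cond.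
rewrite (exchange_big_dep predT) //=; apply: eq_bigr => V _.
rewrite -/(H V); under eq_bigl do rewrite eq_sym.
rewrite big_nat1_eq; case: ifP => // /negbT; rewrite ltnS.
have -> : (#|V| <= n)%N by rewrite -[leqRHS]card_ord max_card.
rewrite andbT -leqNgt leqn0 cards_eq0 => /eqP ->.
by rewrite /H enum_set0 big_nil D1 mul0r scaler0.
Qed.

Lemma prodr_list_const (z : R) (I : Type) (w : seq I) : \prod_(i <- w) z = z ^+ size w.
Proof. by elim: w => [|i w IH]; rewrite ?big_nil // big_cons IH exprS. Qed.

Lemma subset_bracket_const m (D : R -> R) (z : R) :
  subset_bracket (fun V : {set 'I_m} => sgn K (m - #|V|)) D (fun=> z) =
  \sum_(i < m.+1) ('C(m, i)%:R * sgn K (m - i)) *: (D (z ^+ i) * z ^+ (m - i)).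
Proof.
have cVm (V : {set 'I_m}) : (#|V| < m.+1)%N by rewrite ltnS -[leqRHS]card_ord max_card.
rewrite /subset_bracket (partition_big (fun V => Ordinal (cVm V)) predT) //=.
apply: eq_bigr => i _.
transitivity (\sum_(V : {set 'I_m} | #|V| == i)
    sgn K (m - i) *: (D (z ^+ i) * z ^+ (m - i))).
  apply: eq_big => [V|V /eqP/(congr1 val) /= cV]; first by rewrite -val_eqE.
  by rewrite !prodr_list_const -!cardE cV [#|~: V|]cardsCs setCK card_ord cV.
rewrite sumr_const -[#|_|](_ : 'C(m, i) = _) -?scaler_nat ?scalerA //.
have := card_draws 'I_m i; rewrite card_ord => <-; rewrite cardsE.
exact: eq_card.
Qed.

End SubsetBracket.

Section ExpConjugation.
Variables (K : fieldType) (charK : [pchar K] =i pred0) (E : algType K).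

(** Cauchy rearrangement: all (i, j) in the square satisfy i + j < 2 N, and the other points of
    these antidiagonals contribute 0. *)
Lemma sum_square_antidiag (Z : zmodType) N (F : nat -> nat -> Z) :
  (forall i j, (N <= i)%N || (N <= j)%N -> F i j = 0) ->
  \sum_(i < N) \sum_(j < N) F i j = \sum_(m < N.*2) \sum_(i < m.+1) F i (m - i)%N.
Proof.
move=> F0.
transitivity (\sum_(i < N.*2) \sum_(m < N.*2 | (i <= m)%N) F i (m - i)%N); last first.
  rewrite (exchange_big_dep predT) //=; apply: eq_bigr => m _.
  rewrite -(big_mkord (fun i => (i <= m)%N) (fun i => F i (m - i)%N)).
  rewrite -(big_mkord predT (fun i => F i (m - i)%N)).
  rewrite [LHS](big_cat_nat (n := m.+1)) //=.
  rewrite [X in _ + X]big_nat_cond [X in _ + X]big1 ?addr0; last first.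
    by move=> i; rewrite ltnNge => /andP[/andP[/negPf ->]].
  by rewrite big_nat_cond [RHS]big_nat_cond; apply: eq_bigl => i; rewrite ltnS; lia.
have le_N2 : (N <= N.*2)%N by lia.
rewrite (big_ord_widen _ (fun i => \sum_(j < N) F i j) le_N2) big_mkcond /=.
apply: eq_bigr => i _; case: (ltnP i N) => iN; last first.
  by rewrite big1 // => m _; rewrite F0 ?iN.
rewrite -(big_mkord (fun m => (i <= m)%N) (fun m => F i (m - i)%N)).
rewrite (big_cat_nat (n := i)) //=; last exact: ltnW.
rewrite [X in _ = X + _]big_nat_cond [X in _ = X + _]big1 ?add0r; last first.
  by move=> m /andP[/andP[_]]; rewrite ltnNge => /negPf ->.
rewrite (big_cat_nat (n := i + N)%N) //=; [|by lia..].
rewrite [X in _ = _ + X]big_nat_cond [X in _ = _ + X]big1 ?addr0; last first.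
  by move=> m /andP[/andP[im _] _]; rewrite F0 //; lia.
rewrite (_ : index_iota i (i + N) = index_iota (0 + i) (N + i)); last by rewrite add0n addnC.
rewrite big_addn addnK big_mkord.
by apply: eq_big => [j|j _]; rewrite ?leq_addl // addnK.
Qed.

(** Grouping the product by total degree m turns 1 / (i! (m-i)!) into a binomial coefficient over
    m!, that is, into the m-th bracket on the diagonal divided by m!. *)
Lemma exp_conj_brackets N (D : {linear E -> E}) (Y : E) : Y ^+ N = 0 ->
  D (aexp N Y) * aexp N (- Y) =
  \sum_(m < N.*2) exp_coef K m *:
     subset_bracket (fun V : {set 'I_m} => sgn K (m - #|V|)) D (fun=> Y).
Proof.
move=> YN; have Y0 i : (N <= i)%N -> Y ^+ i = 0.
  by move=> /subnK <-; rewrite exprD YN mulr0.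
rewrite linear_sum mulr_suml.
transitivity (\sum_(i < N) \sum_(j < N) (exp_coef K i * exp_coef K j) *:
   (D (Y ^+ i) * (- Y) ^+ j)).
  apply: eq_bigr => i _; rewrite mulr_sumr; apply: eq_bigr => j _ /=.
  by rewrite linearZ -scalerAl -scalerAr scalerA.
rewrite (@sum_square_antidiag _ N (fun i j => (exp_coef K i * exp_coef K j) *:
   (D (Y ^+ i) * (- Y) ^+ j))); last first.
  move=> i j /orP[] /Y0 E0; rewrite ?E0 ?linear0 ?mul0r ?scaler0 //.
  by rewrite exprNn E0 !mulr0 scaler0.
apply: eq_bigr => m _; rewrite subset_bracket_const scaler_sumr.
apply: eq_bigr => i _; rewrite exp_coef_bin //; last by rewrite -ltnS.
rewrite (exprNn Y) -signZ -scalerAr !scalerA; congr (_ *: _).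
by rewrite [RHS]mulrCA mulrA.
Qed.

End ExpConjugation.

(** The convolution algebra is not commutative, but its even elements commute with each other; only
    commutation of the factors is asked for. *)
Lemma prodr_perm_comm (R : nzRingType) (I : eqType) (c : I -> R) (w w' : seq I) :
  (forall i j, i \in w -> j \in w -> c i * c j = c j * c i) ->
  perm_eq w w' -> \prod_(i <- w) c i = \prod_(i <- w') c i.
Proof.
elim: w w' => [|a w IH] w' cc pw; first by move: pw; rewrite perm_sym => /perm_nilP ->.
have aw' : a \in w' by rewrite -(perm_mem pw) mem_head.
case/splitPr: aw' pw => s1 s2 pw.
have pw' : perm_eq w (s1 ++ s2).
  by rewrite -(perm_cons a) (perm_trans pw) // perm_catC /= perm_cons perm_catC.
rewrite big_cons (IH _ _ pw') => [|i j iw jw]; last first.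
  by apply: cc; rewrite inE ?iw ?jw orbT.
rewrite !big_cat /= big_cons !mulrA; congr (_ * _).
have : {subset s1 <= a :: w}.
  by move=> i is1; rewrite (perm_mem pw) mem_cat is1.
elim: s1 {pw pw' IH} => [|b s1 IH] sub; first by rewrite big_nil mulr1 mul1r.
rewrite big_cons mulrA cc ?mem_head ?sub ?mem_head // -!mulrA IH //.
by move=> i is1; apply: sub; rewrite inE is1 orbT.
Qed.

(** * Operators acting on the convolution algebra, and brackets of monomials *)

Section Pointwise.
Variables (K : fieldType) (R R' : algType K) (n : nat) (d : 'I_n -> int).

Definition cmap (D : R -> R') (f : conv R d) : conv R' d := [ffun S => D (f S)].

Lemma cmapE D f S : cmap D f S = D (f S).
Proof. by rewrite ffunE. Qed.

Variable D : {linear R -> R'}.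

Fact cmap_is_linear : linear (cmap D).
Proof. by move=> c f g; apply/ffunP => S; rewrite !ffunE linearP. Qed.
HB.instance Definition _ :=
  GRing.isLinear.Build K (conv R d) (conv R' d) *:%R (cmap D) cmap_is_linear.

Lemma cmap_dl U y : cmap D (dl d U y) = dl d U (D y).
Proof.
by apply/ffunP => S; rewrite cmapE !dlE; case: eqP; rewrite ?linear0.
Qed.

Lemma cmap1 : D 1 = 1 -> cmap D 1 = 1.
Proof.
move=> D1; apply/ffunP => S; rewrite cmapE !cone_val.
by case: eqP; rewrite ?linear0.
Qed.

End Pointwise.

Section BlockBrackets.
Variables (K : fieldType) (R : algType K) (n : nat) (d : 'I_n -> int).
Variables (m : nat) (U : 'I_m -> {set 'I_n}) (y : 'I_m -> R).
Variable D : {linear R -> R}.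

Let block_deg (i : 'I_m) : int := \sum_(j in U i) d j.
Let z i := dl d (U i) (y i).

Lemma disjoint_bigcups (w1 w2 : seq 'I_m) :
  [disjoint \bigcup_(i <- w1) U i & \bigcup_(i <- w2) U i] =
  allrel (fun a b => [disjoint U a & U b]) w1 w2.
Proof.
elim: w1 => [|a w1 IH] /=; first by rewrite big_nil -setI_eq0 set0I eqxx.
by rewrite big_cons -setI_eq0 setIUl setU_eq0 !setI_eq0 IH disjoint_bigcup.
Qed.

Lemma cross_bigcups (w1 w2 : seq 'I_m) :
  block_disjoint U w1 -> block_disjoint U w2 ->
  cross d (\bigcup_(i <- w1) U i) (\bigcup_(i <- w2) U i) =
  (\sum_(a <- w1) \sum_(b <- w2) cross d (U a) (U b))%N.
Proof.
move=> d1 d2; elim: w1 d1 => [|a w1 IH] /=; first by rewrite !big_nil cross0s.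
move=> /andP[aw /IH IHw]; rewrite !big_cons crossUl ?disjoint_bigcup //.
by rewrite IHw cross_bigcup.
Qed.

Lemma prod_dl_map (w1 w2 : seq 'I_m) :
  cmap D (\prod_(i <- w1) z i) * \prod_(i <- w2) z i =
  if block_disjoint U (w1 ++ w2) then
    sgn K (pairsum (fun a b => cross d (U a) (U b)) (w1 ++ w2)) *:
    dl d (\bigcup_(i <- w1 ++ w2) U i) (D (\prod_(i <- w1) y i) * \prod_(i <- w2) y i)
  else 0.
Proof.
rewrite !prod_dl /block_disjoint pairwise_cat -disjoint_bigcups.
case d1: (pairwise _ w1); last by rewrite linear0 mul0r andbF.
case d2: (pairwise _ w2); last by rewrite mulr0 !andbF.
rewrite linearZ /= cmap_dl -scalerAl -scalerAr dlM !andbT.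
case: ifP => _; last by rewrite !scaler0.
rewrite !scalerA -!sgnD cross_bigcups // pairsum_cat big_cat /=.
by [].
Qed.

(** The product of the monomials vanishes at S unless the blocks are disjoint with union S. In that
    case the sign of the word of blocks factors, by [sgn_blocks], into one that is the same for all
    V and the Koszul sign of the y i in their block degrees. *)
Lemma subset_bracket_dl (S : {set 'I_n}) : D 1 = 0 ->
  let B := subset_bracket (fun V : {set 'I_m} => sgn K (m - #|V|)) (cmap D) z S in
  B <> 0 -> [/\ forall i j, i != j -> [disjoint U i & U j], \bigcup_i U i = S &
    exists e, B = sgn K e *: koszul_bracket block_deg D y].
Proof.
move=> D1 B.
have BE : B = \sum_(V : {set 'I_m}) sgn K (m - #|V|) *:
  (if block_disjoint U (enum V ++ enum (~: V)) then
    sgn K (pairsum (fun a b => cross d (U a) (U b)) (enum V ++ enum (~: V))) *: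
    (if S == \bigcup_(i <- enum V ++ enum (~: V)) U i then
     D (\prod_(i <- enum V) y i) * \prod_(i <- enum (~: V)) y i else 0)
   else 0).
  rewrite /B /subset_bracket conv_sumE; apply: eq_bigr => V _.
  rewrite prod_dl_map [LHS]ffunE; congr (_ *: _); case: ifP => _; last by rewrite ffunE.
  by rewrite [LHS]ffunE dlE.
have bigcupE (V : {set 'I_m}) : \bigcup_(i <- enum V ++ enum (~: V)) U i = \bigcup_i U i.
  rewrite -big_enum; apply: perm_big; apply: uniq_perm; rewrite ?enum_uniq ?uniq_enum_cat //.
  by move=> i; rewrite mem_enum_cat mem_enum.
have [/forallP dU'|] := boolP [forall i, forall j, (i != j) ==> [disjoint U i & U j]];
    last first.
  rewrite negb_forall => /existsP[i]; rewrite negb_forall => /existsP[j].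
  rewrite negb_imply => /andP[ij /negP ndU].
  case; rewrite BE big1 // => V _; case: ifP => [bd|]; last by rewrite scaler0.
  case: ndU.
  move: bd => /(pairwiseP i) bd.
  have : index i (enum V ++ enum (~: V)) != index j (enum V ++ enum (~: V)).
    by apply: contra_neq ij => /(index_inj i); rewrite !mem_enum_cat => ->.
  rewrite neq_ltn => /orP[] lt_w.
    have := bd _ _ _ _ lt_w; rewrite !inE !index_mem !mem_enum_cat !nth_index ?mem_enum_cat //.
    by apply.
  have := bd _ _ _ _ lt_w; rewrite !inE !index_mem !mem_enum_cat !nth_index ?mem_enum_cat //.
  by rewrite disjoint_sym; apply.
have dU i j : i != j -> [disjoint U i & U j].
  by move=> ij; move/forallP: (dU' i) => /(_ j); rewrite ij.
have bdV (V : {set 'I_m}) : block_disjoint U (enum V ++ enum (~: V)).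
  apply: (sub_in_pairwise (P := predT) (r := fun a b => a != b)) => [a b _ _ /dU//||].
    exact: all_predT.
  by rewrite -uniq_pairwise uniq_enum_cat.
move=> B0; split=> //.
  apply/eqP; apply: contra_notT B0 => SU; rewrite BE big1 // => V _.
  by rewrite bdV bigcupE eq_sym (negPf SU) !scaler0.
exists (pairsum (fun a b => cross d (U a) (U b)) (enum 'I_m)).
have SU : S = \bigcup_i U i.
  apply/eqP; apply: contra_notT B0 => SU; rewrite BE big1 // => V _.
  by rewrite bdV bigcupE (negPf SU) !scaler0.
rewrite BE koszul_bracketE // /subset_bracket scaler_sumr; apply: eq_bigr => V _.
rewrite bdV bigcupE SU eqxx !scalerA sgn_blocks ?uniq_enum_cat //; last exact: mem_enum_cat.
rewrite koszul_exp_enum sgnD mulrCA; congr (_ *: _).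
by congr (_ * _); rewrite mulrC.
Qed.

End BlockBrackets.

(** * The exponential of a sum of arguments with their eps_i *)

Section SumExponential.
Variables (K : fieldType) (charK : [pchar K] =i pred0).
Variables (R : algType K) (n : nat) (d : 'I_n -> int) (b : 'I_n -> R).
Hypothesis bC : forall i j, i != j -> b i * b j = sgn K (`|d i| * `|d j|) *: (b j * b i).
Implicit Types U V S : {set 'I_n}.

(** This function and the next are e^x and x for x = \sum_i eps_i b_i, by [aexp_single_sum]. *)
Definition ordered_prod : conv R d := [ffun V : {set 'I_n} => \prod_(i <- enum V) b i].
Definition single_sum : conv R d := \sum_i dl d [set i] (b i).

Lemma dl1_mul i (f : conv R d) V :
  (dl d [set i] (b i) * f) V =
  if i \in V then sgn K (cross d [set i] (V :\ i)) *: (b i * f (V :\ i)) else 0.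
Proof.
rewrite cmulE; case: ifP => iV.
  rewrite (bigD1 [set i]) ?sub1set //= dlE eqxx big1 ?addr0 // => U /andP[_ Ui].
  by rewrite dlE (negPf Ui) mul0r scaler0.
rewrite big1 // => U UV; rewrite dlE; case: eqP => [E|_]; last by rewrite mul0r scaler0.
by rewrite E sub1set iV in UV.
Qed.

Lemma sgnK e : sgn K e * sgn K e = 1.
Proof. by rewrite /sgn -exprMn mulrNN mulr1 expr1n. Qed.

(** Since eps_i has degree - d i, the element eps_i b_i is even. *)
Lemma single_comm i j :
  dl d [set i] (b i) * dl d [set j] (b j) = dl d [set j] (b j) * dl d [set i] (b i).
Proof.
have [->//|ij] := eqVneq i j.
have dij : [disjoint [set i] & [set j]] by rewrite disjoints1 inE.
have dji : [disjoint [set j] & [set i]] by rewrite disjoint_sym.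
rewrite !dlM dij dji setUC (bC ij) dlZ scalerA.
have := crossC d dij; rewrite !big_set1 => <-.
by rewrite sgnD mulrA sgnK mul1r.
Qed.

Lemma prod_singles V : \prod_(i <- enum V) dl d [set i] (b i) = dl d V (ordered_prod V).
Proof.
rewrite prod_dl ffunE ifT; last first.
  apply: (sub_in_pairwise (P := predT) (r := fun a b => a != b)) => [i j _ _ ij||].
  - by rewrite disjoints1 inE.
  - exact: all_predT.
  by rewrite -uniq_pairwise enum_uniq.
rewrite (_ : \bigcup_(j <- enum V) [set j] = V); last first.
  by rewrite big_enum; apply/setP => i; apply/bigcupP/idP => [[j jV /set1P->//]|iV];
    exists i; rewrite ?set11.
rewrite (_ : pairsum _ _ = pairsum (inv_exp d) (enum V)).
  by rewrite pairsum_enum /sgn expr0 scale1r.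
elim: (enum V) => //= i w ->; congr (_ + _)%N; apply: eq_bigr => j _.
by rewrite /cross !big_set1.
Qed.

Lemma single_ordered_prod i V : i \in V ->
  sgn K (cross d [set i] (V :\ i)) *: (b i * ordered_prod (V :\ i)) = ordered_prod V.
Proof.
move=> iV.
have : (dl d [set i] (b i) * dl d (V :\ i) (ordered_prod (V :\ i))) V = ordered_prod V.
  transitivity ((\prod_(j <- i :: enum (V :\ i)) dl d [set j] (b j)) V).
    by rewrite big_cons prod_singles.
  rewrite (@prodr_perm_comm _ _ _ _ (enum V)) => [|j l _ _|].
  - by rewrite prod_singles dlE eqxx.
  - exact: single_comm.
  apply: uniq_perm; rewrite ?enum_uniq //=.
    by rewrite enum_uniq mem_enum !inE eqxx.
  move=> j; rewrite inE !mem_enum !inE.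
  by case: eqP => [->|].
by rewrite dl1_mul iV dlE eqxx.
Qed.

(** Each of the m! orderings of V contributes the same product, as the eps_i b_i commute and have
    square zero; the induction removes the first factor. *)
Lemma single_sum_exp m V :
  (single_sum ^+ m) V = if #|V| == m then m`!%:R *: ordered_prod V else 0.
Proof.
elim: m V => [|m IH] V.
  rewrite expr0 cone_val cards_eq0 scale1r; case: eqP => [->|//].
  by rewrite ffunE enum_set0 big_nil.
rewrite exprS mulr_suml conv_sumE.
transitivity (\sum_(i in V) if #|V| == m.+1 then m`!%:R *: ordered_prod V else 0).
  rewrite [RHS]big_mkcond; apply: eq_bigr => i _; rewrite dl1_mul; case: ifP => // iV.
  have := cardsD1 i V; rewrite iV IH add1n => ->; rewrite eqSS.
  case: ifP => _; last by rewrite mulr0 scaler0.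
  by rewrite -scalerAr scalerA mulrC -scalerA single_ordered_prod.
rewrite sumr_const; case: eqP => [->|_]; last by rewrite mul0rn.
by rewrite -scaler_nat scalerA -natrM factS.
Qed.

Lemma aexp_single_sum N : (n < N)%N -> aexp N single_sum = ordered_prod.
Proof.
move=> nN; apply/ffunP => V; rewrite conv_sumE.
have VN : (#|V| < N)%N by apply: leq_ltn_trans nN; rewrite -[leqRHS]card_ord max_card.
rewrite (bigD1 (Ordinal VN)) //= [X in X + _]ffunE single_sum_exp eqxx scalerA.
rewrite mulVf ?fact_natr_neq0 // scale1r big1 ?addr0 // => i iV.
rewrite [LHS]ffunE single_sum_exp ifF ?scaler0 //.
by apply: contraNF iV => /eqP E; apply/eqP/val_inj.
Qed.

End SumExponential.

(** * Cumulants as logarithms *)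

Section CumulantLog.
Variables (K : fieldType) (charK : [pchar K] =i pred0).
Variables (R' : nzRingType) (R : algType K) (n : nat) (d : 'I_n -> int).
Variables (f : R' -> R) (a : 'I_n -> R').
Implicit Types (J : {set 'I_n}) (P : {set {set 'I_n}}).

Let g J := f (\prod_(i <- enum J) a i).
Hypothesis gC : forall J J', [disjoint J & J'] ->
  g J * g J' = sgn K ((\sum_(i in J) `|d i|) * (\sum_(i in J') `|d i|))%N *: (g J' * g J).

(** The value 0 on the empty set makes u nilpotent, so that log (1 + u) is a polynomial in u. *)
Definition block_values : conv R d := [ffun J : {set 'I_n} => if J == set0 then 0 else g J].
Let u := block_values.
Let c J := dl d J (u J).

Lemma block_values_comm J J' : c J * c J' = c J' * c J.
Proof.
rewrite /c /u !ffunE; case: eqP => [_|/eqP J0]; first by rewrite dl0 mul0r mulr0.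
case: eqP => [_|/eqP J'0]; first by rewrite dl0 mul0r mulr0.
rewrite !dlM [in RHS]disjoint_sym; case: ifP => // dJJ.
by rewrite setUC (gC dJJ) dlZ scalerA -(crossC d dJJ) sgnD mulrA sgnK mul1r.
Qed.

Definition block_product P : R := (\prod_(J <- enum P) c J) setT.

Lemma uniq_blocks P : partition P setT ->
  uniq (flatten [seq enum J | J : {set 'I_n} <- enum P]) /\
  flatten [seq enum J | J : {set 'I_n} <- enum P] =i 'I_n.
Proof.
move=> /and3P[/eqP coverP trivP P0]; set w := flatten _.
have wI : w =i 'I_n.
  move=> i; rewrite inE; have : i \in cover P by rewrite coverP inE.
  case/bigcupP => J JP iJ; apply/flattenP; exists (enum J); rewrite ?mem_enum //.
  by apply: map_f; rewrite mem_enum.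
split=> //; apply: (@leq_size_uniq _ (enum 'I_n)); first exact: enum_uniq.
  by move=> i _; rewrite wI.
rewrite -cardE card_ord size_flatten /shape -map_comp sumnE big_map big_enum /=.
under eq_bigr do rewrite -cardE.
rewrite -[leqRHS](card_ord n) -cardsT -coverP.
by move/eqP: trivP => <-.
Qed.

Lemma block_product_partition P : partition P setT ->
  block_product P =
  sgn K (koszul_exp d (flatten [seq enum J | J : {set 'I_n} <- enum P])) *:
  \prod_(J <- enum P) g J.
Proof.
move=> partP; have [uw wI] := uniq_blocks partP.
have /and3P[/eqP coverP trivP P0] := partP.
rewrite koszul_exp_pairsum // pairsum_flatten /block_product /c.
rewrite (prod_dl d id (fun J => u J)) ifT; last first.
  apply: (sub_in_pairwise (P := mem P) (r := fun a b => a != b)) => [J J' JP JP' JJ'||].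
  - by move/trivIsetP: trivP => /(_ _ _ JP JP' JJ').
  - by apply/allP => J; rewrite mem_enum.
  by rewrite -uniq_pairwise enum_uniq.
rewrite [LHS]ffunE big_enum dlE -/(cover P) coverP eqxx; congr (_ *: _).
rewrite !big_seq; apply: eq_bigr => J; rewrite mem_enum ffunE => JP.
by rewrite ifF //; apply: contraNF P0 => /eqP <-.
Qed.

Lemma prodr_eq0_mem (S : nzRingType) (I : eqType) (F : I -> S) (w : seq I) i :
  i \in w -> F i = 0 -> \prod_(j <- w) F j = 0.
Proof.
by case/splitPr => w1 w2 Fi; rewrite big_cat /= big_cons Fi mul0r mulr0.
Qed.

Lemma block_value0 : c set0 = 0.
Proof. by rewrite /c /u ffunE eqxx dl0. Qed.

Lemma block_product_eq0 P : ~~ partition P setT -> block_product P = 0.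
Proof.
rewrite /partition => npart; rewrite /block_product.
case P0: (set0 \in P).
  by rewrite (prodr_eq0_mem (i := set0)) ?mem_enum ?block_value0 ?ffunE.
rewrite /c (prod_dl d id (fun J => u J)); case: ifP => dP; last by rewrite ffunE.
rewrite [LHS]ffunE big_enum dlE -/(cover P).
case: eqP => [coverP|_]; last by rewrite scaler0.
move: npart; rewrite -coverP eqxx P0 andbT /= => /negP[].
apply/trivIsetP => J J' JP J'P JJ'.
move: dP => /(pairwiseP set0) dP.
have [Jw J'w] : J \in enum P /\ J' \in enum P by rewrite !mem_enum.
have : index J (enum P) != index J' (enum P).
  by apply: contra_neq JJ' => /(index_inj set0) -> //.
rewrite neq_ltn => /orP[] lt_w.
  by have := dP _ _ _ _ lt_w; rewrite !inE !index_mem !nth_index //; apply.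
have := dP _ _ _ _ lt_w; rewrite !inE !index_mem !nth_index // disjoint_sym.
by apply.
Qed.

(** A repeated block kills the product: it meets itself if it is nonempty, and its value is 0 if it
    is empty. *)
Lemma prod_blocks_ffun k (phi : {ffun 'I_k -> {set 'I_n}}) :
  (\prod_i c (phi i)) setT =
  if injectiveb phi then block_product [set phi i | i in 'I_k] else 0.
Proof.
rewrite -(big_map phi predT c) /=; case: ifP => [/injectiveP inj|ninj].
  congr ((_ : conv R d) _); apply: prodr_perm_comm => [J J' _ _|].
    exact: block_values_comm.
  apply: uniq_perm; rewrite ?enum_uniq ?map_inj_uniq ?index_enum_uniq //.
  move=> J; rewrite mem_enum; apply/mapP/imsetP => -[i _ ->]; exists i => //.
  exact: mem_index_enum.
have [/existsP[i /eqP phi0]|] := boolP [exists i, phi i == set0].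
  rewrite (prodr_eq0_mem (i := set0)) ?block_value0 ?ffunE // -phi0.
  by apply: map_f; rewrite mem_index_enum.
move=> /existsPn phi0; rewrite /c (prod_dl d id (fun J => u J)).
case: ifP => dphi; last by rewrite ffunE.
move: ninj => /negP[]; apply/injectiveP => i j ij; apply/eqP/negPn/negP => neq_ij.
move: dphi; rewrite /block_disjoint pairwise_map => /(pairwiseP i) dphi.
have iw l : l \in index_enum 'I_k by rewrite mem_index_enum.
have : index i (index_enum 'I_k) != index j (index_enum 'I_k).
  by apply: contra_neq neq_ij => /(index_inj i) -> //.
have nd l : ~~ [disjoint phi l & phi l] by rewrite -setI_eq0 setIid phi0.
rewrite neq_ltn => /orP[] lt_w.
  have := dphi _ _ _ _ lt_w; rewrite !inE !index_mem !nth_index // /= -ij (negPf (nd i)).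
  by move=> /(_ (iw _) (iw _)).
have := dphi _ _ _ _ lt_w; rewrite !inE !index_mem !nth_index // /= -ij (negPf (nd i)).
by move=> /(_ (iw _) (iw _)).
Qed.

(** Expanding the power gives a sum over k-tuples of blocks; a partition into k blocks comes from k!
    tuples, all with the same product. *)
Lemma block_values_exp k : (u ^+ k) setT =
  \sum_(P : {set {set 'I_n}} | partition P setT && (#|P| == k)) k`!%:R *: block_product P.
Proof.
transitivity (\sum_(phi : {ffun 'I_k -> {set 'I_n}}) (\prod_i c (phi i)) setT).
  rewrite -conv_sumE -(bigA_distr_bigA (fun (_ : 'I_k) J => c J)) /=.
  rewrite prodr_const card_ord -(conv_dl u); by [].
rewrite (partition_big (fun phi : {ffun 'I_k -> {set 'I_n}} => [set phi i | i in 'I_k]) predT) //=.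
rewrite [RHS]big_mkcond; apply: eq_bigr => P _.
transitivity (\sum_(phi : {ffun 'I_k -> {set 'I_n}} |
    ([set phi i | i in 'I_k] == P) && injectiveb phi) block_product P).
  rewrite big_mkcondr; apply: eq_bigr => phi /eqP <-; exact: prod_blocks_ffun.
case: (boolP (partition P setT)) => [partP|npart]; last first.
  by rewrite big1 // => phi _; exact: block_product_eq0.
case: eqP => [Pk|Pk] /=; last first.
  rewrite big_pred0 // => phi; apply/negP => /andP[/eqP PE /injectiveP inj].
  by apply: Pk; rewrite -PE card_imset ?card_ord.
rewrite sumr_const -scaler_nat; congr (_%:R *: _).
have := card_inj_ffuns_on 'I_k (mem P); rewrite Pk card_ord ffactnn => <-.
apply: eq_card => phi; rewrite !inE; rewrite [LHS]/in_mem /=; apply/andP/andP => -[].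
  move=> /eqP <- ->; split=> //; apply/ffun_onP => i; exact: imset_f.
move=> /ffun_onP phiP /injectiveP inj; split; last exact/injectiveP.
rewrite eqEcard card_imset // card_ord Pk leqnn andbT.
by apply/subsetP => J /imsetP[i _ ->].
Qed.

(** Origin of the cumulant coefficient: (-1)^(k-1) / k from the logarithm, times the k! orderings of
    the blocks. *)
Lemma log_coef_fact k : (0 < k)%N ->
  log_coef K k * k`!%:R = (-1) ^+ k.-1 * (k.-1)`!%:R.
Proof.
case: k => // k _; rewrite /= factS natrM mulrA divfK //.
exact: natrK_neq0.
Qed.

Lemma cumulant_log N : (0 < n)%N -> (n < N)%N ->
  cumulant d f a = (alog N block_values) setT.
Proof.
move=> n0 nN; rewrite conv_sumE.
transitivity (\sum_(k < N) \sum_(P : {set {set 'I_n}} | partition P setT && (#|P| == k))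
   (log_coef K #|P| * #|P|`!%:R) *: block_product P); last first.
  apply: eq_bigr => k _; rewrite [RHS]ffunE block_values_exp scaler_sumr.
  by apply: eq_bigr => P /andP[_ /eqP ->]; rewrite scalerA.
rewrite (exchange_big_dep (fun P => partition P setT)) /=; last by move=> ? ? _ /andP[].
apply: eq_bigr => P partP.
(* The blocks are nonempty, so there are at most n < N of them and the truncation loses nothing. *)
have PN : (#|P| < N)%N.
  apply: leq_ltn_trans nN; rewrite -[leqRHS](card_ord n) -cardsT (card_partition partP).
  rewrite -sum1_card; apply: leq_sum => J JP; rewrite card_gt0.
  by apply: contraTneq JP => ->; case/and3P: partP.
rewrite (eq_bigl (fun k : 'I_N => k == Ordinal PN)) ?big_pred1_eq; last first.
  by move=> k; rewrite partP -val_eqE eq_sym.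
(* This is where n > 0 matters: the empty partition has coefficient 1 in the cumulant but
   [log_coef K 0 = 0]. *)
have P0 : (0 < #|P|)%N.
  rewrite card_gt0; apply: contraTneq partP => ->; rewrite /partition /cover big_set0.
  by rewrite eq_sym -cards_eq0 cardsT card_ord eqn0Ngt n0.
rewrite log_coef_fact // block_product_partition // -[RHS]scalerA /sgn !signZ.
by rewrite scaler_nat -!mulrA mulr_natl.
Qed.

End CumulantLog.

Lemma sum_enum_setC m (Z : zmodType) (V : {set 'I_m}) (F : 'I_m -> Z) :
  \sum_(i <- enum V) F i + \sum_(i <- enum (~: V)) F i = \sum_i F i.
Proof.
by rewrite !big_enum [RHS](bigID (mem V)); congr (_ + _); apply: eq_bigl => i; rewrite inE.
Qed.

Lemma card_disjoint_blocks n m (U : 'I_m -> {set 'I_n}) :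
  (forall i j, i != j -> [disjoint U i & U j]) ->
  #|\bigcup_i U i| = (\sum_i #|U i|)%N.
Proof.
move=> dU; rewrite -sum1_card (eq_bigr (fun i => \sum_(j in U i) 1)%N); last first.
  by move=> i _; rewrite sum1_card.
rewrite [RHS](exchange_big_dep predT) //=.
rewrite [LHS]big_mkcond /=; apply: eq_bigr => j _.
case: ifP => [/bigcupP[i _ jU]|jU].
  rewrite (big_pred1 i) // => l; apply/idP/eqP => [jl|-> //].
  by apply/eqP/negPn/negP => /dU/disjointFl/(_ jU); rewrite jl.
by rewrite big_pred0 // => i; apply: contraFF jU => jU; apply/bigcupP; exists i.
Qed.

(** In a bracket of order at least 2 every argument is supported on a proper subset, which allows
    induction on the cardinal. *)
Lemma proper_block n m (U : 'I_m -> {set 'I_n}) i : (2 <= m)%N ->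
  (forall i j, i != j -> [disjoint U i & U j]) -> (forall i, U i != set0) ->
  U i \proper \bigcup_i U i.
Proof.
move=> m2 dU U0.
have [j ij] : exists j, j != i.
  case: (eqVneq (i : nat) 0%N) => [i0|i0].
    by exists (Ordinal m2); rewrite -val_eqE /= i0.
  by exists (Ordinal (ltnW m2)); rewrite -val_eqE /= eq_sym.
rewrite properEneq bigcup_sup // andbT; apply/eqP => E.
have /set0Pn[p pj] := U0 j.
have := disjointFr (dU _ _ ij) pj; rewrite E => /negP; apply.
by apply/bigcupP; exists j.
Qed.

(** * Properties inherited by power series in the convolution algebra *)

Section GradedSeries.
Variables (K : fieldType) (R : algType K) (n : nat) (d : 'I_n -> int).
Variable P : {set 'I_n} -> R -> Prop.
Hypotheses (P0 : forall S, P S 0) (PD : forall S x y, P S x -> P S y -> P S (x + y)).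
Hypotheses (PZ : forall S c x, P S x -> P S (c *: x)) (P1 : P set0 1).
Hypothesis PM : forall (U V : {set 'I_n}) x y, [disjoint U & V] ->
  P U x -> P V y -> P (U :|: V) (x * y).

(** P may depend on the subset: it serves for membership in ker h, the same for all S, and for
    homogeneity of degree \sum_(i in S) d i. *)
Lemma conv_graded_mul (f g : conv R d) :
  (forall S, P S (f S)) -> (forall S, P S (g S)) -> forall S, P S ((f * g) S).
Proof.
move=> Pf Pg S; rewrite cmulE; elim/big_rec: _ => // U x US; apply: PD; apply: PZ.
have {1}-> : S = U :|: (S :\: U).
  by rewrite setDE setUIr setUCr setIT; apply/esym/setUidPr.
by apply: PM => //; rewrite -setI_eq0 setIDA setIC -setIDA setDv setI0.
Qed.

Lemma conv_graded_series (c : nat -> K) (f : conv R d) N :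
  (forall S, P S (f S)) -> forall S, P S ((\sum_(i < N) c i *: f ^+ i) S).
Proof.
move=> Pf S; rewrite conv_sumE; elim/big_rec: _ => // i x _; apply: PD.
rewrite ffunE; apply: PZ; elim: (i : nat) S => [|j IH] S.
  rewrite expr0 cone_val; case: eqP => [->|_]; [exact: P1|exact: P0].
by rewrite exprS; apply: conv_graded_mul.
Qed.

End GradedSeries.

Lemma sum_setU_disjoint n (Z : zmodType) (U V : {set 'I_n}) (F : 'I_n -> Z) :
  [disjoint U & V] -> \sum_(i in U :|: V) F i = \sum_(i in U) F i + \sum_(i in V) F i.
Proof. by move=> dUV; rewrite -bigU //; apply: eq_bigl => i; rewrite !inE. Qed.

Section MultiplicativeOnSubset.
Variables (K : fieldType) (R R' : algType K) (n : nat) (d : 'I_n -> int).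
Variables (s : {linear R -> R'}) (P : R -> Prop).
Hypotheses (P0 : P 0) (PD : forall x y, P x -> P y -> P (x + y)).
Hypotheses (PZ : forall c x, P x -> P (c *: x)) (P1 : P 1).
Hypothesis PM : forall x y, P x -> P y -> P (x * y).
Hypotheses (s1 : s 1 = 1) (sM : forall x y, P x -> P y -> s (x * y) = s x * s y).

Lemma cmap_mul (f g : conv R d) : (forall S, P (f S)) -> (forall S, P (g S)) ->
  cmap s (f * g) = cmap s f * cmap s g.
Proof.
move=> Pf Pg; apply/ffunP => S; rewrite cmapE !cmulE linear_sum.
by apply: eq_bigr => U _; rewrite linearZ /= sM // !cmapE.
Qed.

Lemma cmap_series (c : nat -> K) (f : conv R d) N : (forall S, P (f S)) ->
  cmap s (\sum_(i < N) c i *: f ^+ i) = \sum_(i < N) c i *: (cmap s f) ^+ i.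
Proof.
move=> Pf; rewrite linear_sum; apply: eq_bigr => i _; rewrite linearZ /=; congr (_ *: _).
elim: (i : nat) => [|j IH]; first by rewrite !expr0 cmap1.
rewrite !exprS cmap_mul ?IH // => S.
elim: (j) S => [|l IHl] S.
  by rewrite expr0 cone_val; case: eqP.
by rewrite exprS; apply: (conv_graded_mul (P := fun=> P)) => // *; exact: PM.
Qed.

End MultiplicativeOnSubset.

Section BracketsAsConvolution.
Variables (K : fieldType) (charK : [pchar K] =i pred0).
Variables (R : algType K) (n : nat) (d : 'I_n -> int) (b : 'I_n -> R).
Hypothesis bC : forall i j, i != j -> b i * b j = sgn K (`|d i| * `|d j|) *: (b j * b i).

Lemma single_sumN : single_sum d (fun i => - b i) = - single_sum d b.
Proof.
rewrite -sumrN; apply: eq_bigr => i _; apply/ffunP => S; rewrite [RHS]ffunE !dlE.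
by case: eqP; rewrite ?oppr0.
Qed.

Lemma aexp_single_sumN N V : (n < N)%N ->
  (aexp N (- single_sum d b)) V = sgn K #|V| *: ordered_prod d b V.
Proof.
move=> nN; rewrite -single_sumN aexp_single_sum //; last first.
  by move=> i j ij; rewrite !mulrNN bC.
rewrite !ffunE cardE; elim: (enum V) => [|i w IH].
  by rewrite !big_nil /sgn expr0 scale1r.
by rewrite !big_cons IH /sgn /= exprS -scalerA scaleN1r scalerAr mulNr.
Qed.

(** The bracket is the coefficient of the full set in D (e^x) e^(-x): the factor (-1)^(n-i) comes
    from e^(-x) and the Koszul sign from the convolution. *)
Lemma koszul_bracket_conv N (D : R -> R) : (n < N)%N -> D 1 = 0 ->
  koszul_bracket d D b =
  (cmap D (ordered_prod d b) * aexp N (- single_sum d b)) setT.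
Proof.
move=> nN D1; rewrite koszul_bracketE // cmulE; apply: eq_big => [V|V _].
  by rewrite subsetT.
rewrite setTD aexp_single_sumN // cmapE !ffunE -scalerAr scalerA -sgnD.
by rewrite [#|~: V|]cardsCs setCK card_ord.
Qed.

End BracketsAsConvolution.

(** * Equal arguments of degree 0: from subsets to polynomials *)

Section Divided.
Variables (K : fieldType) (charK : [pchar K] =i pred0) (R : algType K) (n : nat).
Let d0 : 'I_n -> int := fun=> 0.

(* Turns the Cauchy product into the convolution of functions of the cardinal. *)
Definition divided (P : {poly R}) : conv R d0 :=
  [ffun S : {set 'I_n} => (#|S|`!%:R : K) *: P`_#|S|].

Lemma cross_deg0 (U V : {set 'I_n}) : cross d0 U V = 0%N.
Proof. by rewrite /cross big1 // => i _; rewrite big1 // => j _; rewrite /inv_exp if_same. Qed.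

Lemma dividedM P Q : divided (P * Q) = divided P * divided Q.
Proof.
apply/ffunP => S; rewrite ffunE cmulE coefM scaler_sumr.
have cUS (U : {set 'I_n}) : (#|U :&: S| < #|S|.+1)%N.
  by rewrite ltnS subset_leq_card // subsetIr.
rewrite (partition_big (fun U : {set 'I_n} => Ordinal (cUS U)) predT) //=.
apply: eq_bigr => i _; have iS : (i <= #|S|)%N by rewrite -ltnS.
transitivity (\sum_(U : {set 'I_n} | (U \subset S) && (#|U| == i))
    ((i`!%:R * (#|S| - i)`!%:R : K) *: (P`_i * Q`_(#|S| - i)))); last first.
  apply: eq_big => [U|U /andP[US /eqP cU]].
    case US: (U \subset S) => //=; rewrite -val_eqE /=.
    by rewrite (setIidPl US).
  rewrite cross_deg0 /sgn expr0 scale1r !ffunE cU cardsD (setIidPr US) cU.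
  by rewrite -scalerAl -scalerAr scalerA.
rewrite sumr_const -scaler_nat scalerA; congr (_ *: _).
rewrite -[#|_|](_ : 'C(#|S|, i) = _); last by rewrite -cards_draws cardsE; apply: eq_card.
by rewrite -!natrM bin_fact.
Qed.

Lemma divided1 : divided 1 = 1.
Proof.
apply/ffunP => S; rewrite ffunE cone_val coef1 cards_eq0.
case: eqP => [->|_]; last exact: scaler0.
by rewrite cards0 fact0 scale1r.
Qed.

Lemma divided_sum (I : Type) (r : seq I) (p : I -> {poly R}) :
  divided (\sum_(i <- r) p i) = \sum_(i <- r) divided (p i).
Proof.
apply/ffunP => S; rewrite conv_sumE ffunE coef_sum scaler_sumr.
by apply: eq_bigr => i _; rewrite ffunE.
Qed.

Lemma dividedZ (c : K) P : divided (c%:A *: P) = c *: divided P.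
Proof.
apply/ffunP => S; rewrite [RHS]ffunE !ffunE coefZ mulr_algl !scalerA.
by rewrite mulrC.
Qed.

Lemma dividedX P m : divided (P ^+ m) = divided P ^+ m.
Proof. by elim: m => [|m IH]; rewrite ?expr0 ?divided1 // !exprS dividedM IH. Qed.

Lemma divided_log N P :
  divided (\sum_(i < N) (log_coef K i)%:A *: P ^+ i) = alog N (divided P).
Proof.
by rewrite divided_sum; apply: eq_bigr => i _; rewrite dividedZ dividedX.
Qed.

End Divided.

Lemma single_sum_setT (K : fieldType) (R : algType K) n (d : 'I_n -> int) (b : R) :
  (0 < n)%N -> single_sum d (fun=> b) setT = if n == 1%N then b else 0.
Proof.
case: n d => // -[|n] d _; rewrite conv_sumE /=.
  rewrite big_ord1 dlE ifT //; apply/eqP/setP => i; rewrite !inE.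
  by rewrite (ord1 i).
rewrite big1 // => i _; rewrite dlE ifF //; apply/negP => /eqP/(congr1 (fun S => #|pred_of_set S|)).
by rewrite cardsT card_ord cards1.
Qed.

(** With X counting the arguments, the generating polynomial of the block values is f (e^(X b)) - 1,
    truncated at degree N. *)
Lemma divided_block_values (K : fieldType) (charK : [pchar K] =i pred0) (R' R : algType K)
    n N (f : R' -> R) (b : R') : (n < N)%N -> f 1 = 1 ->
  divided n (\poly_(i < N) (exp_coef K i *: f (b ^+ i)) - 1) =
  block_values (fun=> 0) f (fun=> b).
Proof.
move=> nN f1; apply/ffunP => S; rewrite !ffunE coefB coef_poly coef1 cards_eq0.
have -> : (#|S| < N)%N by apply: leq_ltn_trans nN; rewrite -[leqRHS]card_ord max_card.
case: eqP => [->|_].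
  by rewrite cards0 expr0 f1 /exp_coef fact0 invr1 !scale1r subrr.
by rewrite mulr0n subr0 scalerA divff ?fact_natr_neq0 // scale1r prodr_list_const cardE.
Qed.

From mathcomp Require Import boolp classical_sets functions cardinality fsbigop.
Import Order.TTheory GRing.Theory Num.Theory.
Local Open Scope classical_set_scope.
Local Open Scope ring_scope.

(** * Laurent series *)

Section LaurentAlgebra.
Variables (K : fieldType) (A : algType K).
Implicit Types x y : laurent A.

Lemma lmulE x y m p n (N : nat) :
  (forall i, i < m -> x i = 0) -> (forall i, i < p -> y i = 0) ->
  n - m - p < N%:Z ->
  (x * y) n = \sum_(j < N) x (m + j%:Z) * y (n - m - j%:Z).
Proof. exact: lmul_coefE. Qed.

Lemma common_bound x y : exists m : int,
  (forall i, i < m -> x i = 0) /\ (forall i, i < m -> y i = 0).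
Proof.
have [m xm] := laurent_bound x; have [p yp] := laurent_bound y.
by exists (Order.min m p); split=> i; rewrite lt_min => /andP[im ip]; [exact: xm|exact: yp].
Qed.

Lemma lcoefZ c x i : (c *: x) i = c *: x i.
Proof. by []. Qed.

Fact lscaleAl (c : K) x y : c *: (x * y) = (c *: x) * y.
Proof.
apply: laurentP => n; rewrite lcoefZ; have [m [xm ym]] := common_bound x y.
have nN : n - m - m < (absz (n - m - m)%R).+1%:Z by lia.
rewrite (lmulE xm ym nN) (lmulE _ ym nN) => [|i im]; last first.
  by rewrite lcoefZ xm ?scaler0.
by rewrite scaler_sumr; apply: eq_bigr => j _; rewrite lcoefZ scalerAl.
Qed.
HB.instance Definition _ := GRing.Lmodule_isLalgebra.Build K (laurent A) lscaleAl.

Fact lscaleAr (c : K) x y : c *: (x * y) = x * (c *: y).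
Proof.
apply: laurentP => n; rewrite lcoefZ; have [m [xm ym]] := common_bound x y.
have nN : n - m - m < (absz (n - m - m)%R).+1%:Z by lia.
rewrite (lmulE xm ym nN) (lmulE xm _ nN) => [|i im]; last first.
  by rewrite lcoefZ ym ?scaler0.
by rewrite scaler_sumr; apply: eq_bigr => j _; rewrite lcoefZ scalerAr.
Qed.
HB.instance Definition _ := GRing.Lalgebra_isAlgebra.Build K (laurent A) lscaleAr.

(** Coefficients of products and of extended operators are finite sums, so vanishing, homogeneity,
    membership in F^p and in ker h are all verified through this closure. *)
Definition add_closed (V : zmodType) (Z : set V) := Z 0 /\ forall u v, Z u -> Z v -> Z (u + v).

Lemma add_closed_sum (V : zmodType) (Z : set V) (I : eqType) (r : seq I) (P : pred I) (F : I -> V) :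
  add_closed Z -> (forall i, i \in r -> P i -> Z (F i)) -> Z (\sum_(i <- r | P i) F i).
Proof.
move=> [Z0 ZD] ZF; rewrite big_seq_cond; elim/big_rec: _ => // i x /andP[ir Pi].
by apply: ZD; exact: ZF.
Qed.

Lemma lmul_closed (Z : set A) x y n : add_closed Z ->
  (forall i j, i + j = n -> Z (x i * y j)) -> Z ((x * y) n).
Proof.
move=> Zadd Zxy; have [m [xm ym]] := common_bound x y.
have nN : n - m - m < (absz (n - m - m)%R).+1%:Z by lia.
rewrite (lmulE xm ym nN); apply: add_closed_sum => // j _ _; apply: Zxy; lia.
Qed.

Lemma lconst1 : lconst (1 : A) = 1.
Proof. by []. Qed.

Lemma lcoef1 i : (1 : laurent A) i = if i == 0 then 1 else 0.
Proof. by []. Qed.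

Lemma lconstE (a : A) i : lconst a i = if i == 0 then a else 0.
Proof. by []. Qed.

Lemma lcoefB x y i : (x - y) i = x i - y i.
Proof. by []. Qed.

Lemma lcoefN x i : (- x) i = - x i.
Proof. by []. Qed.

Lemma lcoef_sum (I : Type) (r : seq I) (P : pred I) (F : I -> laurent A) i :
  (\sum_(j <- r | P j) F j) i = \sum_(j <- r | P j) F j i.
Proof. by elim/big_rec2: _ => // j u v _ <-. Qed.

Fact lshift_subproof (q : int) x : bounded_below (fun i => x (i - q)).
Proof.
by have [m xm] := laurent_bound x; apply/asboolP; exists (m + q) => i im; apply: xm; lia.
Qed.
(** Multiplication by t^q. *)
Definition lshift (q : int) x : laurent A := Laurent (lshift_subproof q x).

Lemma lshiftE q x i : lshift q x i = x (i - q).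
Proof. by []. Qed.

Lemma lshift_mul q r x y : lshift q x * lshift r y = lshift (q + r) (x * y).
Proof.
apply: laurentP => n; rewrite lshiftE; have [m [xm ym]] := common_bound x y.
pose N := (absz (n - (q + r) - m - m)%R).+1.
rewrite (@lmulE x y m m (n - (q + r)) N) //; last by lia.
rewrite (@lmulE _ _ (m + q) (m + r) n N); last by lia.
- by apply: eq_bigr => j _; rewrite !lshiftE; congr (x _ * y _); lia.
- by move=> i im; apply: xm; lia.
by move=> i im; apply: ym; lia.
Qed.

Lemma lshift_is_linear q : linear (lshift q).
Proof. by move=> c x y; apply: laurentP. Qed.
HB.instance Definition _ q :=
  GRing.isLinear.Build K (laurent A) (laurent A) *:%R (lshift q) (lshift_is_linear q).

Lemma lshift1 : lshift 0 1 = 1.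
Proof. by apply: laurentP => i; rewrite lshiftE subr0. Qed.

Lemma lshift_prod (I : Type) (w : seq I) (q : I -> int) (x : I -> laurent A) :
  \prod_(j <- w) lshift (q j) (x j) = lshift (\sum_(j <- w) q j) (\prod_(j <- w) x j).
Proof.
elim: w => [|j w IH]; first by rewrite !big_nil lshift1.
by rewrite !big_cons IH lshift_mul.
Qed.

Lemma in_tpow_closed m : add_closed [set x : laurent A | in_tpow m x].
Proof.
split=> [i //|x y xm ym i im].
by rewrite lcoefD xm // ym // addr0.
Qed.

Lemma in_tpowD m x y : in_tpow m x -> in_tpow m y -> in_tpow m (x + y).
Proof. by case: (in_tpow_closed m) => _; apply. Qed.

Lemma in_tpowZ m c x : in_tpow m x -> in_tpow m (c *: x).
Proof. by move=> xm i im; rewrite lcoefZ xm // scaler0. Qed.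

Lemma in_tpowM m p x y : in_tpow m x -> in_tpow p y -> in_tpow (m + p) (x * y).
Proof.
move=> xm yp i imp; apply: (@lmul_closed [set 0]).
  by split=> // u v -> ->; rewrite addr0.
move=> j l jl /=; case: (ltP j m) => jm; first by rewrite xm // mul0r.
by rewrite yp ?mulr0 //; lia.
Qed.

Lemma in_tpow_le m p x : m <= p -> in_tpow p x -> in_tpow m x.
Proof. by move=> mp xp i im; apply: xp; exact: lt_le_trans mp. Qed.

Lemma in_tpow0 m : in_tpow m (0 : laurent A).
Proof. by []. Qed.

Lemma in_tpow1 : in_tpow 0 (1 : laurent A).
Proof. by move=> i i0; rewrite -lconst1 lconstE lt_eqF. Qed.

Lemma in_tpow_prod (I : Type) (w : seq I) (e : I -> int) (x : I -> laurent A) :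
  (forall j, in_tpow (e j) (x j)) ->
  in_tpow (\sum_(j <- w) e j) (\prod_(j <- w) x j).
Proof.
move=> xe; elim: w => [|j w IH]; first by rewrite !big_nil; exact: in_tpow1.
by rewrite !big_cons; exact: in_tpowM.
Qed.

Lemma in_tpow_shift q m x : in_tpow m x -> in_tpow (q + m) (lshift q x).
Proof. by move=> xm i im; rewrite lshiftE xm //; lia. Qed.

End LaurentAlgebra.

(** * Operators extended to Laurent series *)

Section TextCalculus.
Variables (K : fieldType).

Section One.
Variables (A B : algType K) (f : tops A B).
Implicit Types x y : laurent A.

Lemma textE x m n (N : nat) : (forall i, i < m -> x i = 0) -> n - m < N%:Z ->
  text f x n = \sum_(j < N) f j (x (n - j%:Z)).
Proof.
move=> xm nN; rewrite /= /text_coef (@fsbigE _ _ _ _ _ (iota 0 N)) ?iota_uniq //.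
  rewrite -{1}(subn0 N) -/(index_iota 0 N).
  by under eq_bigl do rewrite in_setT; rewrite big_mkord.
move=> j _; rewrite mem_iota /= -leqNgt => Nj; rewrite xm ?linear0 //; lia.
Qed.

Lemma text_closed (Z : set B) x n : add_closed Z ->
  (forall j : nat, Z (f j (x (n - j%:Z)))) -> Z (text f x n).
Proof.
move=> Zadd Zf; have [m xm] := laurent_bound x.
rewrite (@textE x m n (absz (n - m)%R).+1) //; last by lia.
by apply: add_closed_sum => // j _ _; exact: Zf.
Qed.

Lemma text_is_linear : linear (text f).
Proof.
move=> c x y; apply: laurentP => n; have [m [xm ym]] := common_bound x y.
pose N := (absz (n - m)%R).+1; have nN : n - m < N%:Z by lia.
rewrite lcoefD lcoefZ (textE xm nN) (textE ym nN) (@textE _ m n N) //; last first.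
  by move=> i im; rewrite lcoefD lcoefZ xm // ym // scaler0 addr0.
rewrite scaler_sumr -big_split; apply: eq_bigr => j _.
by rewrite lcoefD lcoefZ linearP.
Qed.
HB.instance Definition _ :=
  GRing.isLinear.Build K (laurent A) (laurent B) *:%R (text f) text_is_linear.

Lemma textD x y : text f (x + y) = text f x + text f y. Proof. exact: linearD. Qed.
Lemma textB x y : text f (x - y) = text f x - text f y. Proof. exact: linearB. Qed.
Lemma textN x : text f (- x) = - text f x. Proof. exact: linearN. Qed.
Lemma textZ c x : text f (c *: x) = c *: text f x. Proof. exact: linearZ. Qed.

Lemma text_shift q x : text f (lshift q x) = lshift q (text f x).
Proof.
apply: laurentP => n; rewrite lshiftE; have [m xm] := laurent_bound x.
pose N := (absz (n - q - m)%R).+1.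
rewrite (@textE x m _ N) //; last by lia.
rewrite (@textE _ (m + q) n N); last by lia.
  by apply: eq_bigr => j _; rewrite lshiftE; congr (f _ (x _)); lia.
by move=> i im; rewrite lshiftE xm //; lia.
Qed.

Lemma text_lconst a (n : nat) : text f (lconst a) n%:Z = f n a.
Proof.
rewrite (@textE _ 0 _ n.+1); last by lia.
  rewrite big_ord_recr /= subrr /lconst_coef eqxx big1 ?add0r // => j _.
  by rewrite ifF ?linear0 //; have := ltn_ord j; lia.
by move=> i i0; rewrite lconstE lt_eqF.
Qed.

Lemma in_tpow_text m x : in_tpow m x -> in_tpow m (text f x).
Proof.
move=> xm i im; apply: (@text_closed [set 0]).
  by split=> // u v -> ->; rewrite addr0.
by move=> j /=; rewrite xm ?linear0 //; lia.
Qed.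

End One.

Lemma eq_text (A B : algType K) (f g : tops A B) :
  (forall n x, f n x = g n x) -> text f =1 text g.
Proof.
move=> fg x; apply: laurentP => n; have [m xm] := laurent_bound x.
have nN : n - m < (absz (n - m)%R).+1%:Z by lia.
by rewrite (textE _ xm nN) (textE _ xm nN); apply: eq_bigr => j _.
Qed.

Lemma text_tcomp (A B C : algType K) (g : tops B C) (f : tops A B) x :
  text (g \ot f) x = text g (text f x).
Proof.
apply: laurentP => n; have [m xm] := laurent_bound x.
pose N := (absz (n - m)%R).+1; have nN : n - m < N%:Z by lia.
rewrite (textE _ xm nN) (@textE _ _ g _ m n N) //; last exact: in_tpow_text.
transitivity (\sum_(i < N) \sum_(j < N) g i (f j (x (n - i%:Z - j%:Z)))); last first.
  apply: eq_bigr => i _; rewrite (@textE _ _ f x m _ N) //; last by lia.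
  by rewrite linear_sum.
rewrite (@sum_square_antidiag _ N (fun i j => g i (f j (x (n - i%:Z - j%:Z))))); last first.
  by move=> i j ij; rewrite xm ?linear0 //; lia.
have N2 : (N <= N.*2)%N by lia.
rewrite (big_ord_widen N.*2 (fun l => (g \ot f) l (x (n - l%:Z))) N2) big_mkcond /=.
apply: eq_bigr => l _.
transitivity ((g \ot f) l (x (n - l%:Z))).
  by case: ifP => // lN; rewrite xm ?linear0 //; lia.
rewrite /tcomp /= /lin_sum; apply: eq_bigr => i _ /=; have := ltn_ord i => il.
by congr (g _ (f _ (x _))); lia.
Qed.

Lemma text_tconst (A B : algType K) (f : {linear A -> B}) x i :
  text (tconst f) x i = f (x i).
Proof.
have [m xm] := laurent_bound x.
rewrite (@textE _ _ _ x m i (absz (i - m)%R).+1) //; last by lia.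
by rewrite big_ord_recl /= subr0 big1 ?addr0.
Qed.

Lemma text_tadd (A B : algType K) (f g : tops A B) x :
  text (tadd f g) x = text f x + text g x.
Proof.
apply: laurentP => n; have [m xm] := laurent_bound x.
have nN : n - m < (absz (n - m)%R).+1%:Z by lia.
rewrite lcoefD !(textE _ xm nN) -big_split; exact: eq_bigr.
Qed.

Lemma text_tpos (A B : algType K) (f : tops A B) x :
  text f x = text (tconst (f 0%N)) x + text (tpos f) x.
Proof.
rewrite -text_tadd; apply: eq_text => -[|n] y /=; first by rewrite addr0.
by rewrite add0r.
Qed.

End TextCalculus.

(** * Multilinearity of the Koszul brackets *)

Section MultiAdditive.
Variables (I : finType) (X : zmodType).

Definition upd (z : I -> X) (i : I) (x : X) : I -> X :=
  fun j => if j == i then x else z j.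

Lemma upd_id z i : upd z i (z i) = z.
Proof. by apply/funext => j; rewrite /upd; case: eqP => [->|]. Qed.

(** The arguments are expanded into sums one index at a time; the list l holds the indices still to
    be treated. *)
Lemma multiadditive_ind (Y : Type) (Good : Y -> Prop) (G : (I -> X) -> Y)
    (B : I -> X -> Prop) :
  (forall z i, Good (G (upd z i 0))) ->
  (forall z i x y, Good (G (upd z i x)) -> Good (G (upd z i y)) ->
     Good (G (upd z i (x + y)))) ->
  (forall z, (forall i, B i (z i)) -> Good (G z)) ->
  forall z, (forall i, exists2 s : seq X, (forall x, x \in s -> B i x) &
     z i = \sum_(x <- s) x) -> Good (G z).
Proof.
move=> G0 GD GB z zs; suff: forall (l : seq I) z,
    (forall i, exists2 s : seq X, (forall x, x \in s -> B i x) & z i = \sum_(x <- s) x) ->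
    (forall i, i \notin l -> B i (z i)) -> Good (G z).
  move=> /(_ (enum I) z zs); apply=> i; by rewrite mem_enum.
elim=> [|i l IH] {zs}z zs zl; first by apply: GB => i; exact: zl.
have [s sB zi] := zs i; rewrite -(upd_id z i) zi.
have {zi} : {subset s <= s} by [].
elim: {1 3}s => [|x w IHw] ws; first by rewrite big_nil.
rewrite big_cons; apply: GD; last by apply: IHw => y yw; apply: ws; rewrite inE yw orbT.
have Bx : B i x by apply: sB; apply: ws; exact: mem_head.
apply: IH => j; rewrite /upd; case: eqP => [->|ji].
- by exists [:: x]; [move=> y; rewrite inE => /eqP ->|rewrite big_seq1].
- exact: zs.
- by [].
by move=> jl; apply: zl; rewrite inE negb_or jl andbT; apply/eqP.
Qed.

End MultiAdditive.

Section BracketAdditivity.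
Variables (K : fieldType) (R : algType K) (m : nat).
Variables (c : {set 'I_m} -> K) (D : {linear R -> R}).

Lemma prod_upd (w : seq 'I_m) z i (x : R) : i \notin w ->
  \prod_(j <- w) upd z i x j = \prod_(j <- w) z j.
Proof.
move=> iw; rewrite !big_seq; apply: eq_bigr => j jw; rewrite /upd ifF //.
by apply: contraNF iw => /eqP <-.
Qed.

Lemma prod_updD (w : seq 'I_m) z i (x y : R) : uniq w -> i \in w ->
  \prod_(j <- w) upd z i (x + y) j =
  \prod_(j <- w) upd z i x j + \prod_(j <- w) upd z i y j.
Proof.
move=> uw iw; case/splitPr: iw uw => w1 w2.
rewrite cat_uniq /= => /and4P[_ iw1 iw2 _].
have {iw1 iw2} [iw1 iw2] : i \notin w1 /\ i \notin w2.
  by move: iw1; rewrite negb_or => /andP[].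
rewrite !big_cat /= !big_cons !prod_upd // /upd eqxx.
by rewrite mulrDl mulrDr.
Qed.

Lemma subset_bracketD z i (x y : R) :
  subset_bracket c D (upd z i (x + y)) =
  subset_bracket c D (upd z i x) + subset_bracket c D (upd z i y).
Proof.
rewrite -big_split; apply: eq_bigr => V _ /=; rewrite -scalerDr; congr (_ *: _).
have uV W : uniq (enum (W : {set 'I_m})) by exact: enum_uniq.
have [iV|iV] := boolP (i \in V).
  rewrite prod_updD // ?mem_enum // linearD mulrDl.
  by congr (_ * _ + _ * _); rewrite !prod_upd // mem_enum inE iV.
rewrite [in X in _ * X = _]prod_updD // ?mem_enum ?inE ?iV // mulrDr.
by congr (D _ * _ + D _ * _); rewrite !prod_upd // mem_enum.
Qed.

Lemma subset_bracket0 z i : subset_bracket c D (upd z i 0) = 0.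
Proof.
have := subset_bracketD z i 0 0; rewrite addr0 => /eqP.
by rewrite -subr_eq0 opprD addNKr oppr_eq0 => /eqP.
Qed.

End BracketAdditivity.

(** As k is odd, t is even: the coefficients of a homogeneous Laurent series all have degrees of the
    same parity and carry the same Koszul signs. *)
Lemma koszul_bracket_parity n (d d' : 'I_n -> int) (R : nzRingType) (D : R -> R) a :
  (forall i, odd `|d i| = odd `|d' i|) ->
  koszul_bracket d D a = koszul_bracket d' D a.
Proof.
move=> dd; apply: eq_bigr => i _; apply: eq_bigr => s _; congr (_ * _ * _).
rewrite -signr_odd -[RHS]signr_odd; congr (_ ^+ nat_of_bool _).
by apply: odd_sum => p _; apply: odd_sum => q _; rewrite !oddM !dd.
Qed.

(* t has degree 1 - k, so the coefficient of t^i in a series of degree e has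
   degree e + i (k - 1). *)
Definition lhom (K : fieldType) (A : algType K) (k : int) (gr : int -> set A) (e : int)
  (x : laurent A) : Prop := forall i, gr (e + i * (k - 1)) (x i).

Section LaurentBrackets.
Variables (K : fieldType) (k : int) (k_odd : odd `|k|%N) (A : algType K).
Variables (gr : int -> set A) (Delta : tops A A) (dbv : derived_BV k gr Delta).
Let D := text Delta.

Lemma text_unit : D 1 = 0.
Proof.
apply: laurentP => n; apply: (@text_closed _ _ _ Delta [set 0]).
  by split=> // u v -> ->; rewrite addr0.
move=> j; rewrite lcoef1; case: eqP => _; last exact: linear0.
exact: (dbv_unit dbv).
Qed.

Lemma koszul_bracket_shift m (d : 'I_m -> int) (q : 'I_m -> int) (x : 'I_m -> laurent A) :
  koszul_bracket d D (fun i => lshift (q i) (x i)) =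
  lshift (\sum_i q i) (koszul_bracket d D x).
Proof.
rewrite !koszul_bracketE; [|exact: text_unit..].
rewrite linear_sum; apply: eq_bigr => V _; rewrite linearZ /=; congr (_ *: _).
rewrite !lshift_prod [D _]text_shift lshift_mul; congr (lshift _ _).
exact: sum_enum_setC.
Qed.

(** Each y i is split into m - 1 monomials t^q a with q >= e i and a remainder divisible by t^(e i +
    m - 1). If some argument is a remainder, multiplicativity of the order already gives the bound,
    because D does not lower it. If all are monomials, the powers of t come out of the bracket and
    the derived BV axiom supplies the factor t^(m-1). *)
Lemma koszul_bracket_laurent m (d e : 'I_m -> int) (y : 'I_m -> laurent A) :
  (2 <= m)%N -> (forall i, lhom k gr (d i) (y i)) -> (forall i, in_tpow (e i) (y i)) ->
  in_tpow (\sum_i e i + m%:Z - 1) (koszul_bracket d D y).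
Proof.
move=> m2 yh ye; rewrite koszul_bracketE; last exact: text_unit.
set c := fun V : {set 'I_m} => _.
pose B (i : 'I_m) (x : laurent A) :=
  (exists q a, [/\ e i <= q, gr (d i + q * (k - 1)) a & x = lshift q (lconst a)]) \/
  in_tpow (e i + m%:Z - 1) x.
apply: (@multiadditive_ind _ _ _ (in_tpow (\sum_i e i + m%:Z - 1)) (subset_bracket c D) B).
- by move=> z i; rewrite subset_bracket0; exact: in_tpow0.
- by move=> z i u v; rewrite subset_bracketD; exact: in_tpowD.
- move=> z zB.
  have ze i : in_tpow (e i) (z i).
    case: (zB i) => [[q [a [eq _ ->]]]|]; last by apply: in_tpow_le; lia.
    by move=> j je; rewrite lshiftE lconstE ifF //; lia.
  have [/existsP[i /asboolP zi]|] := boolP [exists i, `[< in_tpow (e i + m%:Z - 1) (z i) >]].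
    pose e' j := if j == i then e i + m%:Z - 1 else e j.
    have ze' j : in_tpow (e' j) (z j) by rewrite /e'; case: eqP => [->|_].
    have se' : \sum_i e i + m%:Z - 1 = \sum_j e' j.
      rewrite (bigD1 i) //= [RHS](bigD1 i) //= /e' eqxx.
      rewrite [X in _ = _ + X](eq_bigr e) => [|j /negPf -> //]; lia.
    rewrite se'; apply: (add_closed_sum (in_tpow_closed A _)) => V _ _ /=.
    apply: in_tpowZ.
    rewrite (_ : \sum_j e' j = \sum_(j <- enum V) e' j + \sum_(j <- enum (~: V)) e' j).
      by apply: in_tpowM; [apply: in_tpow_text|]; exact: in_tpow_prod.
    by rewrite sum_enum_setC.
  move=> /existsPn nz.
  have /choice[qa zqa] : forall i, exists qa : int * A,
      [/\ e i <= qa.1, gr (d i + qa.1 * (k - 1)) qa.2 & z i = lshift qa.1 (lconst qa.2)].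
    by move=> i; case: (zB i) => [[q [a qa]]|/asboolP]; [exists (q, a)|rewrite (negPf (nz i))].
  have -> : z = fun i => lshift (qa i).1 (lconst (qa i).2).
    by apply/funext => i; case: (zqa i).
  rewrite -koszul_bracketE ?koszul_bracket_shift; last exact: text_unit.
  rewrite (@koszul_bracket_parity _ _ (fun i => d i + (qa i).1 * (k - 1))); last first.
    by move=> i; move: k_odd; lia.
  have H : in_tpow (m%:Z - 1) (koszul_bracket (fun i => d i + (qa i).1 * (k - 1)) D
      (fun i => lconst (qa i).2)).
    by apply: (dbv_koszul dbv) => // i; case: (zqa i).
  apply: in_tpow_le (in_tpow_shift (q := \sum_i (qa i).1) H).
  have : \sum_i e i <= \sum_i (qa i).1 by apply: ler_sum => i _; case: (zqa i).
  lia.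
move=> i; pose M l := lshift (e i + l%:Z) (lconst (y i (e i + l%:Z))).
exists (y i - \sum_(l <- iota 0 m.-1) M l :: [seq M l | l <- iota 0 m.-1]); last first.
  by rewrite big_cons big_map subrK.
move=> x; rewrite inE => /orP[/eqP ->|/mapP[l _ ->]]; last first.
  by left; exists (e i + l%:Z), (y i (e i + l%:Z)); split; [lia|exact: yh|by []].
right=> j ji; rewrite lcoefB lcoef_sum; apply/eqP; rewrite subr_eq0; apply/eqP.
have ME l : M l j = if j == e i + l%:Z then y i j else 0.
  rewrite /M lshiftE lconstE subr_eq0; case: eqP => // -> //.
case: (ltP j (e i)) => je.
  rewrite (ye i) // big1 // => l _; rewrite ME ifF //; lia.
pose l := absz (j - e i)%R.
have lm : l \in iota 0 m.-1 by rewrite mem_iota /=; lia.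
have jl : j = e i + l%:Z by lia.
rewrite (bigD1_seq l) ?iota_uniq // ME -jl eqxx big1 => [|l' /eqP l'l]; first exact/esym/addr0.
rewrite ME ifF //; apply/eqP => E; apply: l'l; lia.
Qed.

Section ConvBrackets.
Variables (n : nat) (d : 'I_n -> int).
Implicit Types T S : {set 'I_n}.

Definition conv_hom (f : conv (laurent A) d) : Prop :=
  forall T, lhom k gr (\sum_(i in T) d i) (f T).

(** Y is decomposed into its monomials. A nonzero bracket of monomials has disjoint nonempty blocks
    with union S, all proper since m >= 2, and the orders e |U_i| - 1 add up with m - 1 to e |S| -
    1. *)
Lemma bracket_regular (e : int) (Y : conv (laurent A) d) S m :
  (2 <= m)%N -> Y finset.set0 = 0 -> conv_hom Y ->
  (forall T, T \proper S -> in_tpow (e * #|T|%:Z - 1) (Y T)) ->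
  in_tpow (e * #|S|%:Z - 1)
    (subset_bracket (fun V : {set 'I_m} => sgn K (m - #|V|)) (cmap D) (fun=> Y) S).
Proof.
move=> m2 Y0 Yh Yr.
pose B (i : 'I_m) (f : conv (laurent A) d) := exists T y, [/\ T != finset.set0,
  lhom k gr (\sum_(i in T) d i) y, T \proper S -> in_tpow (e * #|T|%:Z - 1) y & f = dl d T y].
apply: (@multiadditive_ind _ _ _ (fun f : conv (laurent A) d => in_tpow (e * #|S|%:Z - 1) (f S))
  (subset_bracket (fun V : {set 'I_m} => sgn K (m - #|V|)) (cmap D)) B).
- by move=> z i; rewrite subset_bracket0 ffunE.
- move=> z i u v; rewrite subset_bracketD => Hu Hv.
  by rewrite [X in in_tpow _ X]ffunE; exact: in_tpowD.
- move=> z zB; apply: contrapT => nS.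
  have /choice[Uy zUy] : forall i, exists Uy : {set 'I_n} * laurent A,
     [/\ Uy.1 != finset.set0, lhom k gr (\sum_(i in Uy.1) d i) Uy.2,
         Uy.1 \proper S -> in_tpow (e * #|Uy.1|%:Z - 1) Uy.2 & z i = dl d Uy.1 Uy.2].
    by move=> i; have [T [y ?]] := zB i; exists (T, y).
  have zE : z = fun i => dl d (Uy i).1 (Uy i).2.
    by apply/funext => i; case: (zUy i).
  move: nS; rewrite zE => nS.
  have := @subset_bracket_dl K _ n d m (fun i => (Uy i).1) (fun i => (Uy i).2) D S text_unit.
  case=> [E|dU US [f E]]; first by apply: nS; rewrite E; exact: in_tpow0.
  apply: nS; rewrite E; apply: in_tpowZ.
  have -> : e * #|S|%:Z - 1 = \sum_i (e * #|(Uy i).1|%:Z - 1) + m%:Z - 1.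
    rewrite -US card_disjoint_blocks // big_split /= -mulr_sumr sumr_const card_ord.
    rewrite -(big_morph Posz PoszD (erefl _)); lia.
  apply: koszul_bracket_laurent => // i; case: (zUy i) => // U0 _ Ur _; apply: Ur.
  have Uy0 j : (Uy j).1 != finset.set0 by case: (zUy j).
  by have := proper_block i m2 dU Uy0; rewrite US.
move=> i0; exists [seq dl d T (Y T) | T <- enum [pred T | T != finset.set0]].
  move=> f /mapP[T]; rewrite mem_enum inE => T0 ->.
  by exists T, (Y T); split=> // /Yr.
rewrite big_map big_enum /= {1}(conv_dl Y) (bigID (fun T => T == finset.set0)) /=.
rewrite big1 ?add0r // => T /eqP ->; rewrite Y0; exact: dl0.
Qed.

End ConvBrackets.
End LaurentBrackets.

(** * Series of operators in t: geometric series and fixed points *)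

Section TopsIdentities.
Variables (K : fieldType).

Lemma tops_eq (A B : algType K) (f g : tops A B) :
  text f =1 text g -> forall n x, f n x = g n x.
Proof. by move=> fg n x; rewrite -!text_lconst fg. Qed.

Lemma tcompA (A B C E : algType K) (f : tops C E) (g : tops B C) (l : tops A B) n x :
  ((f \ot g) \ot l) n x = (f \ot (g \ot l)) n x.
Proof. by apply: tops_eq => y; rewrite !text_tcomp. Qed.

Lemma tconst_tcomp (A B C : algType K) (g : {linear B -> C}) (f : tops A B) n x :
  (tconst g \ot f) n x = g (f n x).
Proof.
rewrite /tcomp /= /lin_sum big_ord_recl /= subn0 big1 ?addr0 //.
Qed.

Lemma tcomp_tsum (A B C : algType K) (g : tops B C) (u : nat -> tops A B) :
  (forall m n x, (n < m)%N -> u m n x = 0) ->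
  forall n x, (g \ot tsum u) n x = tsum (fun m => g \ot u m) n x.
Proof.
move=> u0 n x; rewrite /tcomp /tsum /= /lin_sum /=.
transitivity (\sum_(i < n.+1) \sum_(m < n.+1) g i (u m (n - i)%N x)).
  apply: eq_bigr => i _ /=; rewrite linear_sum /=; have il := ltn_ord i.
  have le_n : ((n - i).+1 <= n.+1)%N by lia.
  rewrite (big_ord_widen _ (fun m => g i (u m (n - i)%N x)) le_n) [LHS]big_mkcond.
  by apply: eq_bigr => m _; case: ifP => // mi; rewrite u0 ?linear0 //; lia.
by rewrite exchange_big.
Qed.

Lemma tsum_recl (A B : algType K) (u : nat -> tops A B) :
  (forall m n x, (n < m)%N -> u m n x = 0) ->
  forall n x, tsum u n x = u 0%N n x + tsum (fun m => u m.+1) n x.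
Proof.
move=> u0 n x; rewrite /tsum /= /lin_sum big_ord_recl; congr (_ + _).
by rewrite [RHS]big_ord_recr /= u0 // addr0.
Qed.

Lemma texp_lt (A : algType K) (w : tops A A) m n x :
  (forall x, w 0%N x = 0) -> (n < m)%N -> texp w m n x = 0.
Proof.
move=> w0; elim: m n => // m IH n nm; rewrite /texp iterS -/(texp w m).
rewrite /tcomp /= /lin_sum big1 // => -[[|i] ilt] _ /=; first exact: w0.
by rewrite IH ?linear0 //; lia.
Qed.

Lemma tcomp_lt (A B C : algType K) (g : tops B C) (f : tops A B) m n x :
  (forall n x, (n < m)%N -> g n x = 0) -> (n < m)%N -> (g \ot f) n x = 0.
Proof.
move=> g0 nm; rewrite /tcomp /= /lin_sum big1 // => i _ /=; rewrite g0 //.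
by have := ltn_ord i; lia.
Qed.

(** The recursion P = f + w P, through which [pert_tau] and [pert_h] are handled. *)
Lemma geometric_series (A C : algType K) (w : tops A A) (f : tops C A) x :
  (forall x, w 0%N x = 0) ->
  text (tsum (fun m => texp w m \ot f)) x =
  text f x + text w (text (tsum (fun m => texp w m \ot f)) x).
Proof.
move=> w0; set P := tsum _; rewrite -text_tcomp -text_tadd; apply: eq_text => n y.
have P0 m l z : (l < m)%N -> (texp w m \ot f) l z = 0.
  by apply: tcomp_lt => ? ?; exact: texp_lt.
rewrite [LHS]tsum_recl // [RHS]/=; congr (_ + _).
  by rewrite tconst_tcomp.
rewrite tcomp_tsum // /tsum /= /lin_sum; apply: eq_bigr => m _.
exact: tcompA.
Qed.

(* As w is divisible by t, u = x + w u can be solved coefficient by coefficient. *)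
Lemma text_fixpoint (A : algType K) (w : tops A A) (Z : int -> set A) (u : laurent A) :
  (forall i, add_closed (Z i)) -> (forall x, w 0%N x = 0) ->
  (forall i (j : nat) a, Z i a -> Z (i + j%:Z) (w j a)) ->
  (forall i, Z i (u i - text w u i)) -> forall i, Z i (u i).
Proof.
move=> Zadd w0 wZ uZ; have [m um] := laurent_bound u.
suff: forall (N : nat) i, i < m + N%:Z -> Z i (u i).
  by move=> H i; apply: (H (absz (i - m)%R).+1); lia.
elim=> [|N IH] i iN; first by rewrite um; [case: (Zadd i)|lia].
rewrite -(subrK (text w u i) (u i)).
have [_ ZD] := Zadd i; apply: ZD; first exact: uZ.
apply: text_closed; first exact: Zadd.
move=> [|j]; first by rewrite w0; case: (Zadd i).
rewrite -[in Z i](subrK j.+1%:Z i); apply: wZ; apply: IH; lia.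
Qed.

End TopsIdentities.

Notation lm f := (text (tconst f)).

Section LinearOnLaurent.
Variables (K : fieldType) (A B : algType K).
Lemma lmE (f : {linear A -> B}) x i : lm f x i = f (x i).
Proof. exact: text_tconst. Qed.
End LinearOnLaurent.

(** * Filtrations and the Maurer-Cartan equation *)

Section Filtration.
Variables (K : fieldType) (charK : [pchar K] =i pred0) (A : algType K).
Variable F : nat -> set A.
Hypotheses (FS : forall p, subspace (F p)) (F0 : F 0%N = [set: A]).
Hypotheses (Fdecr : forall p, F p.+1 `<=` F p).
Hypothesis (Fmul : forall p q x y, F p x -> F q y -> F (p + q)%N (x * y)).

Definition lfil (p : nat) (x : laurent A) : Prop := forall i, F p (x i).

Lemma F_add_closed p : add_closed (F p).
Proof.
have [f0 fL] := FS p; split=> // u v fu fv.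
by rewrite -[u]scale1r; exact: fL.
Qed.

Lemma lfil0 p : lfil p 0.
Proof. by move=> i; case: (FS p). Qed.

Lemma lfilD p x y : lfil p x -> lfil p y -> lfil p (x + y).
Proof. by move=> fx fy i; rewrite lcoefD; case: (F_add_closed p) => _; apply. Qed.

Lemma lfilZ p c x : lfil p x -> lfil p (c *: x).
Proof. by move=> fx i; rewrite lcoefZ -[_ *: _]addr0; case: (FS p) => f0; apply. Qed.

Lemma lfilN p x : lfil p x -> lfil p (- x).
Proof. by move=> fx; rewrite -scaleN1r; exact: lfilZ. Qed.

Lemma lfilB p x y : lfil p x -> lfil p y -> lfil p (x - y).
Proof. by move=> fx fy; apply: lfilD => //; exact: lfilN. Qed.

Lemma lfil_sum p (I : Type) (r : seq I) (P : pred I) (f : I -> laurent A) :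
  (forall i, P i -> lfil p (f i)) -> lfil p (\sum_(i <- r | P i) f i).
Proof.
by move=> Ff; elim/big_rec: _ => [|i x Pi]; [exact: lfil0|apply: lfilD; exact: Ff].
Qed.

Lemma lfil_all x : lfil 0 x.
Proof. by move=> i; rewrite F0. Qed.

Lemma F_le p q : (p <= q)%N -> F q `<=` F p.
Proof.
move=> /subnK <-; elim: (q - p)%N => [//|m IH] x.
by rewrite addSn => /Fdecr; exact: IH.
Qed.

Lemma lfil_le p q x : (p <= q)%N -> lfil q x -> lfil p x.
Proof. by move=> pq fx i; exact: (F_le pq). Qed.

Lemma lfilM p q x y : lfil p x -> lfil q y -> lfil (p + q) (x * y).
Proof.
move=> fx fy i; apply: lmul_closed; first exact: F_add_closed.
by move=> j l _; exact: Fmul.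
Qed.

Lemma lfilX x n : lfil 1 x -> lfil n (x ^+ n).
Proof.
move=> fx; elim: n => [|n IH]; first exact: lfil_all.
by rewrite exprS -add1n; exact: lfilM.
Qed.

Lemma lfil_trans p x y z : lfil p (x - y) -> lfil p (y - z) -> lfil p (x - z).
Proof. by move=> xy yz; rewrite -(subrK y x) -addrA; exact: lfilD. Qed.

Lemma lfil_sym p x y : lfil p (x - y) -> lfil p (y - x).
Proof. by move=> xy; rewrite -opprB; exact: lfilN. Qed.

Lemma lfil_cong p x y : lfil p (x - y) -> lfil p y -> lfil p x.
Proof. by move=> xy fy; rewrite -(subrK y x); exact: lfilD. Qed.

Lemma aexp_invr_mod p a : lfil 1 a -> lfil p (aexp p a * aexp p (- a) - 1).
Proof.
move=> fa; have [Q ->] := exp_oppr_alg charK p a.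
by rewrite addrC addKr -[p]add0n; apply: lfilM; [exact: lfil_all|exact: lfilX].
Qed.

Lemma aexp_invl_mod p a : lfil 1 a -> lfil p (aexp p (- a) * aexp p a - 1).
Proof. by move=> fa; rewrite -{2}(opprK a); apply: aexp_invr_mod; exact: lfilN. Qed.

Lemma powB_mod p i a b : lfil 1 a -> lfil 1 b -> lfil p (a - b) ->
  lfil (p + i) (a ^+ i.+1 - b ^+ i.+1).
Proof.
move=> fa fb fab; elim: i => [|i IH]; first by rewrite !expr1 addn0.
rewrite exprS [b ^+ _]exprS -(subrK (a * b ^+ i.+1) (a * _)) -mulrBr -addrA -mulrBl.
apply: lfilD; last by apply: lfilM => //; exact: lfilX.
by rewrite addnS -add1n; exact: lfilM.
Qed.

Lemma aexp_mod p N a b : lfil 1 a -> lfil 1 b -> lfil p (a - b) ->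
  lfil p (aexp N a - aexp N b).
Proof.
move=> fa fb fab; rewrite -sumrB; apply: lfil_sum => -[[|i] iN] _ /=.
  by rewrite !expr0 subrr; exact: lfil0.
rewrite -scalerBr; apply: lfilZ; apply: (@lfil_le _ (p + i)%N); first exact: leq_addr.
exact: powB_mod.
Qed.

(** If a - b lies in F^q with q >= 1, the differences of higher powers lie in F^(q+1), so e^a - e^b
    agrees with a - b modulo F^(q+1); the congruence improves step by step up to F^p. *)
Lemma aexp_inj_mod p a b : lfil 1 a -> lfil 1 b ->
  lfil p (aexp p a - aexp p b) -> lfil p (a - b).
Proof.
move=> fa fb; case: p => [|p] eab; first exact: lfil_all.
suff: forall q, (q <= p)%N -> lfil q.+1 (a - b) by apply.
elim=> [|q IH] qp; first exact: lfilB.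
have {IH} fab := IH (ltnW qp).
case: p qp eab => // p qp eab.
have E : aexp p.+2 a - aexp p.+2 b =
    (a - b) + \sum_(i < p) exp_coef K i.+2 *: (a ^+ i.+2 - b ^+ i.+2).
  rewrite /aexp !big_ord_recl /= /bump /= !add1n !expr0 !expr1.
  rewrite opprD addrACA subrr add0r opprD addrACA -sumrB.
  rewrite /exp_coef factS fact0 invr1 !scale1r; congr (_ + _).
  by apply: eq_bigr => i _; rewrite scalerBr.
apply: (@lfil_cong _ _ (aexp p.+2 a - aexp p.+2 b)); last first.
  by apply: lfil_le eab; lia.
rewrite E opprD addrA subrr add0r; apply: lfilN; apply: lfil_sum => i _; apply: lfilZ.
apply: (@lfil_le _ (q.+1 + i.+1)%N); first by lia.
exact: powB_mod.
Qed.

Lemma sum_tail_mod p M (x : nat -> laurent A) : (p <= M)%N ->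
  (forall m, (p <= m)%N -> lfil p (x m)) ->
  lfil p (\sum_(m < M) x m - \sum_(m < p) x m).
Proof.
move=> pM fx; rewrite -(big_mkord predT x) -(big_mkord predT x).
rewrite (big_cat_nat (n := p)) //= addrAC subrr add0r big_nat_cond.
by apply: lfil_sum => m; rewrite andbT => /andP[pm _]; exact: fx.
Qed.

Section MaurerCartan.
Variables (D : {linear laurent A -> laurent A}).
Hypotheses (D1 : D 1 = 0) (DF : forall p x, lfil p x -> lfil p (D x)).

Lemma koszul_bracket_diag n a :
  (n`!%:R : K)^-1 *: koszul_bracket (fun _ : 'I_n => 0) D (fun=> a) =
  \sum_(i < n.+1) (exp_coef K i *: D (a ^+ i)) *
     (exp_coef K (n - i) *: (- a) ^+ (n - i)).
Proof.
rewrite koszul_bracketE //.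
have -> : (fun V : {set 'I_n} => sgn K (cross (fun=> 0) V (~: V) + (n - #|V|))) =
    (fun V => sgn K (n - #|V|)).
  apply/funext => V; rewrite /cross big1 ?add0n // => i _.
  by rewrite big1 // => j _; rewrite /inv_exp if_same.
rewrite subset_bracket_const scaler_sumr; apply: eq_bigr => i _.
rewrite -scalerAl -scalerAr !scalerA exp_coef_bin //; last by rewrite -ltnS.
by rewrite (exprNn a) -signZ -scalerAr scalerA -/(exp_coef K n) mulrCA mulrA.
Qed.

(** The term of total degree n in a lies in F^n, so modulo F^p both expressions reduce to their
    terms of degree less than p, where they coincide. *)
Lemma MC_sum_mod p M a : lfil 1 a -> (p <= M)%N ->
  lfil p (\sum_(1 <= n < M.+1)
            (n`!%:R : K)^-1 *: koszul_bracket (fun _ : 'I_n => 0) D (fun=> a) -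
          D (aexp p a) * aexp p (- a)).
Proof.
move=> fa pM.
pose U i := exp_coef K i *: D (a ^+ i); pose V j := exp_coef K j *: (- a) ^+ j.
have fUV i j : lfil (i + j) (U i * V j).
  apply: lfilM; apply: lfilZ; first by apply: DF; exact: lfilX.
  by apply: lfilX; exact: lfilN.
pose x n := \sum_(i < n.+1) U i * V (n - i)%N.
have fx n : lfil n (x n).
  apply: lfil_sum => i _; have := fUV i (n - i)%N; rewrite subnKC //.
  by rewrite -ltnS.
have -> : \sum_(1 <= n < M.+1)
            (n`!%:R : K)^-1 *: koszul_bracket (fun _ : 'I_n => 0) D (fun=> a) =
          \sum_(n < M.+1) x n.
  rewrite big_ord_recl {1}/x big_ord1 /U expr0 D1 scaler0 mul0r add0r.
  by rewrite big_add1 big_mkord; apply: eq_bigr => i _; rewrite koszul_bracket_diag.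
pose F' i j := if (i < p)%N && (j < p)%N then U i * V j else 0.
have -> : D (aexp p a) * aexp p (- a) = \sum_(m < p.*2) \sum_(i < m.+1) F' i (m - i)%N.
  rewrite -(@sum_square_antidiag _ p F'); last first.
    by move=> i j; rewrite /F' !(leqNgt p) => /orP[] /negPf ->; rewrite ?andbF.
  rewrite linear_sum mulr_suml; apply: eq_bigr => i _; rewrite mulr_sumr.
  by apply: eq_bigr => j _; rewrite /F' !ltn_ord linearZ.
have fF m : (p <= m)%N -> lfil p (\sum_(i < m.+1) F' i (m - i)%N).
  move=> pm; apply: lfil_sum => i _; rewrite /F'; case: ifP => _; last exact: lfil0.
  apply: lfil_le pm _; have := fUV i (m - i)%N; rewrite subnKC //.
  by rewrite -ltnS.
apply: (@lfil_trans _ _ (\sum_(n < p) x n)).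
  by apply: sum_tail_mod => [|m pm]; [exact: leqW|exact: lfil_le pm _].
apply: lfil_sym; rewrite (eq_bigr (fun m : 'I_p => \sum_(i < m.+1) F' i (m - i)%N)).
  by apply: (@sum_tail_mod p p.*2 (fun m => \sum_(i < m.+1) F' i (m - i)%N)) => //; lia.
move=> m _; apply: eq_bigr => i _; rewrite /F' ifT //.
by have := ltn_ord m; have := ltn_ord i; lia.
Qed.

(* The Maurer-Cartan equation is D (e^a) = 0; as e^a involves unboundedly negative
   powers of t, it only makes sense modulo each F^p. *)
Lemma MC_series_exp a : lfil 1 a ->
  F_series F (fun n => koszul_bracket (fun _ : 'I_n => 0) D (fun=> a)) 0 <->
  forall p, lfil p (D (aexp p a)).
Proof.
move=> fa; split=> [MC p|De p]; last first.
  exists p => m pm i; rewrite subr0; move: i.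
  apply: (lfil_cong (MC_sum_mod fa pm)).
  by have := lfilM (De p) (lfil_all (aexp p (- a))); rewrite addn0.
have [M HM] := MC p; set N := maxn p M.
have SN := MC_sum_mod fa (leq_maxl p M); rewrite -/N in SN.
have fS : lfil p (\sum_(1 <= n < N.+1)
    (n`!%:R : K)^-1 *: koszul_bracket (fun _ : 'I_n => 0) D (fun=> a)).
  by move=> i; have := HM N (leq_maxr p M) i; rewrite subr0.
have fDe : lfil p (D (aexp p a) * aexp p (- a)).
  by apply: lfil_cong fS; exact: lfil_sym.
(* The factor e^(-a) is removed by multiplying with e^a, its inverse modulo F^p. *)
rewrite -[D _]mulr1; apply: (@lfil_cong _ _ (D (aexp p a) * aexp p (- a) * aexp p a)).
  apply: lfil_sym; rewrite -mulrA -mulrBr.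
  by have := lfilM (lfil_all (D (aexp p a))) (aexp_invl_mod p fa); rewrite add0n.
by have := lfilM fDe (lfil_all (aexp p a)); rewrite addn0.
Qed.

End MaurerCartan.

End Filtration.

Lemma MC_BV_exp (K : fieldType) (charK : [pchar K] =i pred0) (k : int) (A : algType K)
    (gr : int -> set A) (Delta : tops A A) (F : nat -> set A) (a : laurent A) :
  (forall p, subspace (F p)) -> F 0%N = [set: A] -> (forall p, F p.+1 `<=` F p) ->
  (forall p q x y, F p x -> F q y -> F (p + q)%N (x * y)) ->
  (forall i, gr i 0) -> text Delta 1 = 0 ->
  (forall p x, lfil F p x -> lfil F p (text Delta x)) ->
  MC_BV k gr Delta F a <->
  [/\ in_tpow (-1) a, lhom k gr 0 a, lfil F 1 a &
      forall p, lfil F p (text Delta (aexp p a))].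
Proof.
move=> FS F0 Fd Fm gr0 D1 DF; split=> [[am1 aFgr MC]|[am1 ah aF De]].
  have aF : lfil F 1 a.
    move=> i; case: (ltP i (-1)) => [im|/aFgr[]//].
    by rewrite am1 //; case: (FS 1%N).
  split=> //; last by apply/(MC_series_exp charK FS F0 Fd Fm D1 DF aF).
  by move=> i; case: (ltP i (-1)) => [im|/aFgr[_]]; [rewrite am1|rewrite add0r].
split=> //; last by apply/(MC_series_exp charK FS F0 Fd Fm D1 DF aF).
by move=> i _; split; [exact: aF|have := ah i; rewrite add0r].
Qed.

Section PolyEval.
Variable R : nzRingType.

(** Over a noncommutative ring evaluation is multiplicative only at commuting points; 1 is one. *)
Lemma horner1M (P Q : {poly R}) : (P * Q).[1] = P.[1] * Q.[1].
Proof. by rewrite hornerM_comm // /comm_poly mulr1 mul1r. Qed.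

Lemma horner1X (P : {poly R}) n : (P ^+ n).[1] = P.[1] ^+ n.
Proof. by elim: n => [|n IH]; rewrite ?expr0 ?hornerC // !exprS horner1M IH. Qed.

Lemma coef0X (P : {poly R}) n : (P ^+ n)`_0 = P`_0 ^+ n.
Proof. by elim: n => [|n IH]; rewrite ?expr0 ?coef1 // !exprS coef0M IH. Qed.

End PolyEval.

(** * Transfer along a semifull contraction *)

Section Transfer.
Variables (K : fieldType) (k : int) (A B : algType K).
Variables (grA : int -> set A) (grB : int -> set B).
Variables (dA : {linear A -> A}) (dB : {linear B -> B}).
Hypothesis (dgA : dg_comm_alg grA dA) (dgB : dg_comm_alg grB dB).
Variables (sigma : {linear A -> B}) (tau : {linear B -> A}) (h : {linear A -> A}).
Hypothesis (ctr : semifull_contraction grA grB dA dB sigma tau h).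

Let ct := sf_contraction ctr.

Lemma homogeneous_ind (E : algType K) (gr : int -> set E) (Z : set E) :
  graded_comm_alg gr -> add_closed Z -> (forall i x, gr i x -> Z x) -> forall x, Z x.
Proof.
move=> ga Zadd Zh x; have [_ span] := grading_span (gca_grading ga).
have [s [c [cgr ->]]] := span x I.
by apply: add_closed_sum => // i _ _; apply: (Zh i); case: (cgr i).
Qed.

Lemma ker_add_closed (U V : lmodType K) (f : {linear U -> V}) : add_closed [set x | f x = 0].
Proof. by split=> [|u v /= fu fv]; rewrite /= ?linear0 // linearD fu fv addr0. Qed.

Lemma d1_eq0 : dA 1 = 0.
Proof.
have := dga_der dgA 1 (gca_one (dga_alg dgA)).
rewrite !mulr1 expr0 !mul1r => /eqP.
by rewrite -subr_eq0 opprD addNKr oppr_eq0 => /eqP.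
Qed.

Lemma homotopy_eq a : a = tau (sigma a) - h (dA a) - dA (h a).
Proof. by rewrite -addrA -opprD (ctr_homotopy ct) opprB addrC subrK. Qed.

(* Write tau x tau y by means of the homotopy: all correction terms have the form
   h (tau _ * tau _) = 0. *)
Lemma tau_mul (x y : B) : tau (x * y) = tau x * tau y.
Proof.
pose f (x : B) : A := tau (x * y) - tau x * tau y.
suff: f x = 0 by move/eqP; rewrite subr_eq0 => /eqP.
apply: (homogeneous_ind (dga_alg dgB) (Z := [set x | f x = 0])).
  have fD u v : f (u + v) = f u + f v.
    by rewrite /f mulrDl !linearD mulrDl opprD addrACA.
  split=> [|u v /= fu fv]; last by rewrite fD fu fv addr0.
  by rewrite /= /f mul0r linear0 mul0r subrr.
move=> i {}x xi; apply/eqP; rewrite /f subr_eq0 eq_sym.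
have txi : grA (i + 0) (tau x) by exact: (ctr_tau_deg ct).
rewrite [tau x * tau y]homotopy_eq (sf_stt ctr) (sf_htt ctr) linear0 subr0.
rewrite (dga_der dgA _ txi) -!(ctr_tau_d ct) linearD (sf_htt ctr) add0r.
rewrite -(signr_odd A) mulr_sign; case: ifP => _; rewrite ?linearN /= (sf_htt ctr).
  by rewrite oppr0 subr0.
by rewrite subr0.
Qed.

Lemma tau1 : tau 1 = 1.
Proof.
have := homotopy_eq 1; rewrite (sf_s1 ctr) d1_eq0 (sf_h1 ctr).
by rewrite (linear0 h) (linear0 dA) !subr0.
Qed.

(** The contraction axioms treat the order h a, tau x only; graded commutativity on homogeneous
    elements gives the other order. *)
Lemma swap_tau_h (V : lmodType K) (f : {linear A -> V}) :
  (forall a x, f (h a * tau x) = 0) -> forall a x, f (tau x * h a) = 0.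
Proof.
move=> fht a x; have [gA gB] := (dga_alg dgA, dga_alg dgB).
apply: (homogeneous_ind gB (Z := [set x | f (tau x * h a) = 0])).
  split=> [|u v]; rewrite /= ?linear0 ?mul0r ?linear0 // => fu fv.
  by rewrite linearD mulrDl linearD fu fv addr0.
move=> i {}x xi.
apply: (homogeneous_ind gA (Z := [set a | f (tau x * h a) = 0])).
  split=> [|u v]; rewrite /= ?linear0 ?mulr0 ?linear0 // => fu fv.
  by rewrite linearD mulrDr linearD fu fv addr0.
move=> j {}a aj /=.
rewrite (gca_comm gA (ctr_tau_deg ct xi) (ctr_h_deg ct aj)).
rewrite -(signr_odd A) mulr_sign; case: ifP => _; rewrite ?linearN /= fht //.
by rewrite oppr0.
Qed.

(** On ker h the homotopy formula leaves only an element of the image of tau and one of the image of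
    h; the semifull axioms prescribe h and sigma exactly on products of such elements. *)
Lemma ker_h_decomp a : h a = 0 -> a = tau (sigma a) + h (- dA a).
Proof. by move=> ha; rewrite {1}(homotopy_eq a) ha linear0 subr0 linearN. Qed.

Lemma ker_h_mul a b : h a = 0 -> h b = 0 -> h (a * b) = 0.
Proof.
move=> /ker_h_decomp -> /ker_h_decomp ->.
rewrite mulrDl !mulrDr !linearD /= (sf_htt ctr) (sf_hht ctr) (sf_hhh ctr).
by rewrite (swap_tau_h (f := h) (sf_hht ctr)) !addr0.
Qed.

Lemma sigma_mul a b : h a = 0 -> h b = 0 -> sigma (a * b) = sigma a * sigma b.
Proof.
move=> /ker_h_decomp {1}-> /ker_h_decomp {1}->.
rewrite mulrDl !mulrDr !linearD /= (sf_stt ctr) (sf_sht ctr) (sf_shh ctr).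
by rewrite (swap_tau_h (f := sigma) (sf_sht ctr)) !addr0.
Qed.

Definition lker_h (x : laurent A) : Prop := lm h x = 0.

Lemma lker_hP x : lker_h x <-> forall i, h (x i) = 0.
Proof.
split=> [hx i|hx]; first by rewrite -lmE hx.
by apply: laurentP => i; rewrite lmE hx.
Qed.

Lemma lker_h1 : lker_h 1.
Proof.
apply/lker_hP => i; rewrite lcoef1; case: eqP => _; last exact: linear0.
exact: (sf_h1 ctr).
Qed.

Lemma lker_hM x y : lker_h x -> lker_h y -> lker_h (x * y).
Proof.
move=> /lker_hP hx /lker_hP hy; apply/lker_hP => i.
apply: (lmul_closed (ker_add_closed h)) => j l _; exact: ker_h_mul.
Qed.

Lemma lsigmaM x y : lker_h x -> lker_h y -> lm sigma (x * y) = lm sigma x * lm sigma y.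
Proof.
move=> /lker_hP hx /lker_hP hy; apply: laurentP => n; have [m [xm ym]] := common_bound x y.
have nN : n - m - m < (absz (n - m - m)%R).+1%:Z by lia.
rewrite lmE (lmulE xm ym nN) (lmulE _ _ nN) => [|i im|i im]; last 2 first.
- by rewrite lmE xm ?linear0.
- by rewrite lmE ym ?linear0.
by rewrite linear_sum; apply: eq_bigr => j _; rewrite !lmE sigma_mul.
Qed.

Lemma lsigma1 : lm sigma 1 = 1.
Proof.
apply: laurentP => i; rewrite lmE !lcoef1; case: eqP => _; last exact: linear0.
exact: (sf_s1 ctr).
Qed.

(** * The contraction perturbed by Delta *)

Variables (Delta : tops A A).
Hypothesis (dbvA : derived_BV k grA Delta) (Delta0 : Delta 0%N =1 dA).

Local Notation D := (text Delta).
Local Notation Dp := (text (tpos Delta)).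
Local Notation W := (tconst h \ot tpos Delta).

Lemma textD_split x : D x = lm dA x + Dp x.
Proof.
rewrite [LHS]text_tpos; congr (_ + _); apply: laurentP => i.
by rewrite !lmE.
Qed.

Lemma W0 x : W 0%N x = 0.
Proof. by rewrite tconst_tcomp /= linear0. Qed.

Lemma WE n x : W n.+1 x = h (Delta n.+1 x).
Proof. by rewrite tconst_tcomp. Qed.

Lemma textW x : text W x = lm h (Dp x).
Proof. exact: text_tcomp. Qed.

Lemma text_pert_tau x : text (pert_tau tau h Delta) x =
  lm tau x + lm h (Dp (text (pert_tau tau h Delta) x)).
Proof. by rewrite -textW; apply: geometric_series; exact: W0. Qed.

Lemma text_pert_BV x : text (pert_BV dB sigma tau h Delta) x =
  lm dB x + lm sigma (Dp (text (pert_tau tau h Delta) x)).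
Proof.
have E n y : tsum (fun m => tconst sigma \ot tpos Delta \ot texp W m \ot tconst tau) n y =
    (tconst sigma \ot tpos Delta \ot pert_tau tau h Delta) n y.
  rewrite tcomp_tsum; last first.
    by move=> m l z lm; apply: (@tcomp_lt _ _ _ _ _ _ m) => // l' z'; exact: texp_lt W0.
  by rewrite /tsum /= /lin_sum; apply: eq_bigr => m _; exact: tcompA.
by rewrite text_tadd (eq_text E) !text_tcomp.
Qed.

(** The perturbed homotopy h' satisfies h' = h + h Dp h'. If h' x = 0 this reads h x = 0; if h x =
    0, then h' x is a fixed point of h Dp, which is divisible by t, hence 0. So ker h' may be
    replaced by ker h. *)
Lemma text_pert_h x : text (pert_h h Delta) x = 0 <-> lm h x = 0.
Proof.
have := geometric_series (tconst h) x W0; rewrite -/(pert_h h Delta) => E.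
split=> hx; first by move: E; rewrite hx linear0 addr0.
apply: laurentP => i; apply: (@text_fixpoint _ _ W (fun=> [set 0])) => [_|||].
- by split=> // u v -> ->; rewrite addr0.
- exact: W0.
- by move=> _ j a ->; rewrite /= linear0.
move=> j; have := congr1 (fun y : laurent A => y j) E.
by rewrite hx add0r => Ej; apply/eqP; rewrite subr_eq0; apply/eqP.
Qed.

(** In every term of the series but the initial one, h is the first operator applied to x. *)
Lemma text_pert_sigma x : lm h x = 0 -> text (pert_sigma sigma h Delta) x = lm sigma x.
Proof.
move=> /lker_hP hx; apply: laurentP => i; rewrite lmE.
have [m xm] := laurent_bound x.
rewrite (@textE _ _ _ _ x m i (absz (i - m)%R).+1) //; last by lia.
have E j a : h a = 0 -> pert_sigma sigma h Delta j a = if j == 0%N then sigma a else 0.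
  move=> ha; have E l : text (texp (tpos Delta \ot tconst h) l.+1) (lconst a) = 0.
    elim: l => [|l IH]; rewrite [LHS]text_tcomp; last by rewrite IH linear0.
    rewrite text_tcomp (_ : text (tconst h) _ = 0) ?linear0 //.
    apply: laurentP => p; rewrite !lmE lconstE.
    by case: eqP => //= _; rewrite linear0.
  rewrite /pert_sigma /tsum /= /lin_sum big_ord_recl big1 => [|l _].
    by rewrite addr0 tconst_tcomp /texp /=; case: j => //= j; rewrite linear0.
  rewrite /= tconst_tcomp -text_lconst.
  by have -> : text (texp (tpos Delta \ot tconst h) (lift ord0 l)) (lconst a) = 0 := E l;
    rewrite linear0.
rewrite big_ord_recl E // subr0 big1 ?addr0 // => j _.
by rewrite E.
Qed.

(* The perturbed maps are used only through these two equations. *)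
Variables (tau' : tops B A) (Delta' : tops B B).
Local Notation T := (text tau').
Local Notation D' := (text Delta').
Hypothesis T_rec : forall x, T x = lm tau x + lm h (Dp (T x)).
Hypothesis D'_rec : forall x, D' x = lm dB x + lm sigma (Dp (T x)).

Lemma hT x : lm h (T x) = 0.
Proof.
apply: laurentP => i; rewrite lmE T_rec lcoefD !lmE linearD.
by rewrite (ctr_h_tau ct) (ctr_h_h ct) addr0.
Qed.

Lemma sigmaT x : lm sigma (T x) = x.
Proof.
apply: laurentP => i; rewrite lmE T_rec lcoefD !lmE linearD.
by rewrite (ctr_sigma_tau ct) (ctr_sigma_h ct) addr0.
Qed.

(** As h T = 0 and sigma T = id, the homotopy formula reads T x = tau x - h dA T x; comparison with
    the recursion T x = tau x + h Dp T x gives h (dA + Dp) T x = 0. *)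
Lemma hDT x : lm h (D (T x)) = 0.
Proof.
apply: laurentP => i; rewrite lmE.
have hy : h (T x i) = 0 by rewrite -lmE hT.
have sy : sigma (T x i) = x i by rewrite -lmE sigmaT.
have E : T x i = tau (x i) + h (Dp (T x) i) by rewrite -!lmE -lcoefD -T_rec.
have E' : T x i = tau (x i) - h (dA (T x i)).
  by rewrite [LHS]homotopy_eq hy sy linear0 subr0.
have /addrI H := etrans (esym E') E.
by rewrite textD_split lcoefD linearD lmE -H subrr.
Qed.

Lemma Delta_Delta x : D (D x) = 0.
Proof.
rewrite -text_tcomp; apply: laurentP => n.
apply: (@text_closed _ _ _ _ [set 0]) => [|j /=]; last exact: (dbv_sq dbvA).
by split=> // u v -> ->; rewrite addr0.
Qed.

(* An element killed by h together with its image under Delta is determined by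
   its projection to B; the version modulo a stable subspace Z is used with
   Z = F^p A. *)
Lemma transfer_unique (Z : set A) (v : laurent A) : subspace Z ->
  (forall a, Z a -> Z (h a)) -> (forall n a, Z a -> Z (Delta n a)) ->
  (forall i, Z (h (v i))) -> (forall i, Z (h (D v i))) ->
  forall i, Z ((v - T (lm sigma v)) i).
Proof.
move=> [Z0 ZL] hZ DZ hv hDv.
have ZD u w : Z u -> Z w -> Z (u + w) by move=> zu zw; rewrite -[u]scale1r; exact: ZL.
have ZN u : Z u -> Z (- u) by move=> zu; rewrite -[- u]addr0 -scaleN1r; exact: ZL.
apply: (@text_fixpoint _ _ W (fun=> Z)) => [//|||].
- exact: W0.
- by move=> _ [|j] a Za; rewrite ?W0 // WE; apply: hZ; exact: DZ.
(* With W = h Dp, the homotopy formula and the recursion for t give (v - t) - W (v - t) = - h D v -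
   dA h v, and both terms lie in Z. *)
move=> i; set t := T _.
have -> : text W (v - t) = text W v - text W t by exact: linearB.
rewrite !lcoefB opprB [X in _ + X]addrC addrACA [- t i + _]addrC -(opprB (t i)).
rewrite (textW v) lmE.
have -> : t i - text W t i = tau (sigma (v i)).
  by rewrite /t {1}T_rec -textW lcoefD addrK !lmE.
have -> : h (Dp v i) = h (D v i) - h (dA (v i)).
  by rewrite textD_split lcoefD linearD lmE addrC addKr.
rewrite {1}(homotopy_eq (v i)) opprB addrACA subrK addrC addKr.
by apply: ZD; apply: ZN => //; rewrite -Delta0; apply: DZ.
Qed.

(** Since sigma T = id, the term dB x equals sigma (dA (T x)) and completes Dp to Delta. *)
Lemma D'E x : D' x = lm sigma (D (T x)).
Proof.
rewrite D'_rec textD_split linearD; congr (_ + _); apply: laurentP => i.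
by rewrite !lmE (ctr_sigma_d ct) -(lmE sigma) sigmaT.
Qed.

Lemma subspace_zero : subspace [set 0 : A].
Proof. by split=> // c u v -> ->; rewrite scaler0 addr0. Qed.

Lemma transfer_eq v : lm h v = 0 -> lm h (D v) = 0 -> v = T (lm sigma v).
Proof.
move=> hv hDv; apply/eqP; rewrite -subr_eq0; apply/eqP/laurentP => i.
have hv0 j : h (v j) = 0 by rewrite -lmE hv.
have hDv0 j : h (D v j) = 0 by rewrite -lmE hDv.
by apply: (transfer_unique subspace_zero) => // [a ->|m a ->]; exact: linear0.
Qed.

(** D T x is killed by h, and so is its image under D because D D = 0; hence it is T of its
    projection, which is D' x. *)
Lemma Delta_T x : D (T x) = T (D' x).
Proof.
rewrite D'E; apply: transfer_eq; first exact: hDT.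
by rewrite Delta_Delta linear0.
Qed.

Lemma Delta'_Delta' x : D' (D' x) = 0.
Proof. by rewrite D'E -Delta_T Delta_Delta linear0. Qed.

Lemma T1 : T 1 = 1.
Proof.
have := transfer_eq lker_h1; rewrite lsigma1 (text_unit dbvA) linear0.
by move=> /(_ erefl).
Qed.

Lemma D'1 : D' 1 = 0.
Proof. by rewrite D'E T1 (text_unit dbvA) linear0. Qed.

Lemma D_hom e x : lhom k grA e x -> lhom k grA (e + 1) (D x).
Proof.
move=> xh i; apply: text_closed => [|j].
  have [g0 gL] := grading_subspace (gca_grading (dbv_alg dbvA)) (e + 1 + i * (k - 1)).
  by split=> // u v gu gv; rewrite -[u]scale1r; exact: gL.
have := dbv_deg dbvA j (xh (i - j%:Z)); congr (grA _ _); lia.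
Qed.

Lemma gr_add_closed (E : algType K) (gr : int -> set E) i : graded_comm_alg gr -> add_closed (gr i).
Proof.
move=> ga; have [g0 gL] := grading_subspace (gca_grading ga) i.
by split=> // u v gu gv; rewrite -[u]scale1r; exact: gL.
Qed.

Lemma T_hom e x : lhom k grB e x -> lhom k grA e (T x).
Proof.
move=> xh; apply: (@text_fixpoint _ _ W (fun i => grA (e + i * (k - 1)))).
- by move=> i; apply: gr_add_closed; exact: (dga_alg dgA).
- exact: W0.
- move=> i [|j] a ga.
    rewrite W0.
    by case: (gr_add_closed (e + (i + 0%N%:Z) * (k - 1)) (dga_alg dgA)).
  rewrite WE; have := ctr_h_deg ct (@dbv_deg _ _ _ _ _ dbvA j.+1 _ _ ga); congr (grA _ _); lia.
move=> i; have -> : T x i - text W (T x) i = tau (x i).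
  by rewrite {1}T_rec -textW lcoefD addrK lmE.
by have := ctr_tau_deg ct (xh i); rewrite addr0.
Qed.

Lemma sigma_hom e x : lhom k grA e x -> lhom k grB e (lm sigma x).
Proof. by move=> xh i; rewrite lmE; have := ctr_sigma_deg ct (xh i); rewrite addr0. Qed.

Lemma T_filtered (Z : set A) (x : laurent B) : subspace Z ->
  (forall a, Z a -> Z (h a)) -> (forall n a, Z a -> Z (Delta n a)) ->
  (forall i, Z (tau (x i))) -> forall i, Z (T x i).
Proof.
move=> [Z0 ZL] hZ DZ xZ.
apply: (@text_fixpoint _ _ W (fun=> Z)) => [_|||i].
- by split=> // u v gu gv; rewrite -[u]scale1r; exact: ZL.
- exact: W0.
- by move=> _ [|j] a Za; rewrite ?W0 // WE; apply: hZ; exact: DZ.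
by rewrite {1}T_rec -textW lcoefD addrK lmE.
Qed.

(** * Divisibility by t of the logarithm of the transferred exponential *)

Section RegularLogarithm.
Hypotheses (charK : [pchar K] =i pred0) (k_odd : odd `|k|%N).
Variables (n : nat) (d : 'I_n -> int) (b : 'I_n -> laurent B) (e : int).
Hypotheses (bh : forall i, lhom k grB (d i) (b i)) (be : forall i, in_tpow (e - 1) (b i)).
(* In the convolution algebra x = \sum_i eps_i b_i, E = e^x and Y = log (T e^x);
   the values of Y are the cumulants of T. *)
Let N := n.+1.
Let x := single_sum d b.
Let E := ordered_prod d b.
Let u := block_values d T b.
Let Y := alog N u.

(** As t is even, the sign is the same for all coefficients; reversing the summation index exchanges
    the two factors. *)
Lemma lhom_comm (C : algType K) (gr : int -> set C) (p q : int) (y z : laurent C) :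
  graded_comm_alg gr -> lhom k gr p y -> lhom k gr q z ->
  y * z = sgn K (`|p| * `|q|)%N *: (z * y).
Proof.
move=> ga yp zq; apply: laurentP => i; rewrite lcoefZ.
have [m [ym zm]] := common_bound y z.
case: (ltP i (m + m)) => im.
  have H (v w : laurent C) : in_tpow m v -> in_tpow m w -> (v * w) i = 0.
    by move=> vm wm; exact: (in_tpowM vm wm).
  by rewrite !H // scaler0.
pose M := (absz (i - m - m)%R).+1.
rewrite (@lmulE _ _ y z m m i M) //; last by lia.
rewrite (@lmulE _ _ z y m m i M) //; last by lia.
rewrite (reindex_inj rev_ord_inj) scaler_sumr; apply: eq_bigr => j _ /=.
have jM := ltn_ord j.
have -> : m + (M - j.+1)%N%:Z = i - m - j%:Z by lia.
have -> : i - m - (M - j.+1)%N%:Z = m + j%:Z by lia.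
rewrite (gca_comm ga (yp _) (zq _)) signZ; congr (_ * _).
rewrite -signr_odd -[RHS]signr_odd; congr (_ ^+ nat_of_bool _).
by rewrite !oddM; move: k_odd; lia.
Qed.

Lemma b_comm i j : i != j -> b i * b j = sgn K (`|d i| * `|d j|)%N *: (b j * b i).
Proof. by move=> _; apply: (lhom_comm (dga_alg dgB)); exact: bh. Qed.

Lemma lhom1 (C : algType K) (gr : int -> set C) : graded_comm_alg gr -> lhom k gr 0 (1 : laurent C).
Proof.
move=> ga i; rewrite lcoef1; case: eqP => [->|_]; first by rewrite mul0r addr0; exact: gca_one ga.
by case: (gr_add_closed (0 + i * (k - 1)) ga).
Qed.

Lemma lhomM (C : algType K) (gr : int -> set C) p q (y z : laurent C) : graded_comm_alg gr ->
  lhom k gr p y -> lhom k gr q z -> lhom k gr (p + q) (y * z).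
Proof.
move=> ga yp zq i; apply: lmul_closed; first exact: gr_add_closed.
move=> j l jl; have := gca_mul ga (yp j) (zq l); congr (gr _ _); rewrite -jl; lia.
Qed.

Lemma lhom_prod (C : algType K) (gr : int -> set C) (w : seq 'I_n) (y : 'I_n -> laurent C) :
  graded_comm_alg gr -> (forall i, lhom k gr (d i) (y i)) ->
  lhom k gr (\sum_(i <- w) d i) (\prod_(i <- w) y i).
Proof.
move=> ga yd; elim: w => [|i w IH]; first by rewrite !big_nil; exact: lhom1.
by rewrite !big_cons; exact: lhomM.
Qed.

Lemma u_comm (J J' : {set 'I_n}) : [disjoint J & J']%B ->
  T (\prod_(i <- enum J) b i) * T (\prod_(i <- enum J') b i) =
  sgn K ((\sum_(i in J) `|d i|) * (\sum_(i in J') `|d i|))%N *: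
  (T (\prod_(i <- enum J') b i) * T (\prod_(i <- enum J) b i)).
Proof.
move=> _; rewrite (@lhom_comm _ grA (\sum_(i <- enum J) d i) (\sum_(i <- enum J') d i));
  last 3 first.
- exact: (dga_alg dgA).
- by apply: T_hom; apply: lhom_prod => //; exact: (dga_alg dgB).
- by apply: T_hom; apply: lhom_prod => //; exact: (dga_alg dgB).
congr (_ *: _); rewrite !big_enum /sgn -signr_odd -[RHS]signr_odd.
by congr (_ ^+ nat_of_bool _); rewrite !oddM !odd_absz_sum.
Qed.

Lemma u0 : u finset.set0 = 0.
Proof. by rewrite ffunE eqxx. Qed.

Lemma uN : u ^+ N = 0.
Proof. by apply: cexp_nilp => //; exact: u0. Qed.

Lemma cmapTE : cmap T E = 1 + u.
Proof.
apply/ffunP => S; rewrite cmapE [RHS]ffunE cone_val !ffunE.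
case: eqP => [->|_]; last by rewrite add0r.
by rewrite addr0 finset.enum_set0 big_nil T1.
Qed.

Lemma aexpY : aexp N Y = cmap T E.
Proof. by rewrite aexp_logK ?uN // cmapTE. Qed.

Lemma Y0 : Y finset.set0 = 0.
Proof.
rewrite conv_sumE big1 // => -[[|i] iN] _; rewrite ffunE /=.
  by rewrite scale0r.
by rewrite cexp_small ?scaler0 ?u0 // finset.cards0.
Qed.

Lemma YN : Y ^+ N = 0.
Proof. by apply: cexp_nilp => //; exact: Y0. Qed.

Lemma xN : x ^+ N = 0.
Proof.
apply: cexp_nilp => //; rewrite conv_sumE big1 // => i _; rewrite dlE ifF //.
by apply/negP => /eqP/setP/(_ i); rewrite !finset.inE eqxx.
Qed.

Lemma Ex : aexp N x = E.
Proof. by apply: aexp_single_sum => //; exact: b_comm. Qed.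

Lemma lker_hD y z : lker_h y -> lker_h z -> lker_h (y + z).
Proof. by rewrite /lker_h => hy hz; rewrite textD hy hz addr0. Qed.

Lemma lker_hZ c y : lker_h y -> lker_h (c *: y).
Proof. by rewrite /lker_h => hy; rewrite textZ hy scaler0. Qed.

Lemma lker_h0 : lker_h 0.
Proof. exact: linear0. Qed.

Lemma u_ker S : lker_h (u S).
Proof.
rewrite ffunE; case: eqP => _; first exact: lker_h0.
exact: hT.
Qed.

Lemma series_ker (c : nat -> K) (f : conv (laurent A) d) M :
  (forall S, lker_h (f S)) -> forall S, lker_h ((\sum_(i < M) c i *: f ^+ i) S).
Proof.
apply: (conv_graded_series (P := fun=> lker_h)) => *.
- exact: lker_h0.
- exact: lker_hD.
- exact: lker_hZ.
- exact: lker_h1.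
- exact: lker_hM.
Qed.

Lemma Y_ker S : lker_h (Y S).
Proof. by apply: series_ker; exact: u_ker. Qed.

Lemma expNY_ker S : lker_h (aexp N (- Y) S).
Proof.
by apply: series_ker => {}S; rewrite ffunE /lker_h textN Y_ker oppr0.
Qed.

Lemma expY_ker S : lker_h (aexp N Y S).
Proof. by apply: series_ker; exact: Y_ker. Qed.

Lemma cmap_sigma_series (c : nat -> K) (f : conv (laurent A) d) M :
  (forall S, lker_h (f S)) ->
  cmap (lm sigma) (\sum_(i < M) c i *: f ^+ i) =
  \sum_(i < M) c i *: (cmap (lm sigma) f) ^+ i.
Proof.
apply: (cmap_series lker_h0 lker_hD lker_hZ lker_h1 lker_hM lsigma1); exact: lsigmaM.
Qed.

(** T e^x lies in ker h, where sigma is multiplicative, so sigma commutes with the logarithm: sigma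
    Y = log (sigma T e^x) = log (e^x). *)
Lemma sigmaY : cmap (lm sigma) Y = x.
Proof.
rewrite cmap_sigma_series; last exact: u_ker.
rewrite -[RHS](alog_expK charK xN) Ex; congr (alog N _).
apply/ffunP => S; rewrite cmapE [RHS]ffunE [X in _ + X]ffunE cone_val !ffunE.
case: eqP => [->|_]; last by rewrite sigmaT subr0.
by rewrite finset.enum_set0 big_nil subrr linear0.
Qed.

Lemma series_hom (c : nat -> K) (f : conv (laurent A) d) M :
  conv_hom k grA f -> conv_hom k grA (\sum_(i < M) c i *: f ^+ i).
Proof.
have gA := dga_alg dgA.
apply: (conv_graded_series (P := fun S => lhom k grA (\sum_(i in S) d i))).
- by move=> S i; case: (gr_add_closed (\sum_(i in S) d i + i * (k - 1)) gA).
- move=> S y z yh zh i; rewrite lcoefD.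
  by case: (gr_add_closed (\sum_(i in S) d i + i * (k - 1)) gA) => _; apply.
- move=> S a y yh i; rewrite lcoefZ -[_ *: _]addr0.
  by case: (grading_subspace (gca_grading gA) (\sum_(i in S) d i + i * (k - 1))) => g0; apply.
- by rewrite finset.big_set0; exact: lhom1.
by move=> U V y z dUV yU zV; rewrite sum_setU_disjoint //; exact: lhomM.
Qed.

Lemma Y_hom : conv_hom k grA Y.
Proof.
apply: series_hom => S; rewrite ffunE; case: eqP => [_|_].
  by move=> i; case: (gr_add_closed (\sum_(i in S) d i + i * (k - 1)) (dga_alg dgA)).
by apply: T_hom; rewrite -big_enum; apply: lhom_prod => //; exact: (dga_alg dgB).
Qed.

Let SY := cmap D (aexp N Y) * aexp N (- Y).

(** As e^Y = T e^x, [hDT] applies to the left factor; e^(-Y) is a series in Y, and ker h is closed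
    under products. *)
Lemma SY_ker S : lker_h (SY S).
Proof.
apply: (conv_graded_mul (P := fun=> lker_h)) => [*|*|*|*|{}S|].
- exact: lker_h0.
- exact: lker_hD.
- exact: lker_hZ.
- exact: lker_hM.
- by rewrite cmapE aexpY cmapE /lker_h; exact: hDT.
exact: expNY_ker.
Qed.

(** In the expansion into brackets the term of order 0 vanishes since D 1 = 0, and that of order 1
    is D Y; the others involve Y on proper subsets of S only. *)
Lemma SY_regular (S : {set 'I_n}) :
  (forall V : {set 'I_n}, V \proper S -> in_tpow (e * #|V|%:Z - 1) (Y V)) ->
  in_tpow (e * #|S|%:Z - 1) (SY S - D (Y S)).
Proof.
move=> Yr; rewrite /SY (exp_conj_brackets charK (cmap (text Delta)) YN) conv_sumE.
rewrite [N.*2](_ : _ = (n.*2).+2) // !big_ord_recl /=.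
rewrite !subset_bracket_const !big_ord_recl !big_ord0 !expr0 /=.
have cD1 : cmap (text Delta) (1 : conv (laurent A) d) = 0.
  apply/ffunP => V; rewrite cmapE cone_val ffunE; case: eqP => _; last exact: linear0.
  exact: (text_unit dbvA).
rewrite !cD1 !mul0r !scaler0 !addr0 !add0r.
rewrite [X in in_tpow _ (X + _ - _)](_ : _ = 0) ?add0r; last by rewrite scaler0 ffunE.
rewrite [X in in_tpow _ (X + _ - _)](_ : _ = D (Y S)); last first.
  rewrite /exp_coef /bump /= !addn0 factS fact0 invr1 !scale1r.
  by rewrite binn mul1r subnn /sgn expr0 scale1r expr1 mulr1 cmapE.
rewrite addrAC subrr add0r; apply: (add_closed_sum (in_tpow_closed A _)) => i _ _ /=.
rewrite ffunE; apply: in_tpowZ.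
apply: (bracket_regular k_odd dbvA) => //.
- exact: Y0.
- exact: Y_hom.
Qed.

Lemma tau_x_regular (S : {set 'I_n}) : in_tpow (e * #|S|%:Z - 1) (lm tau (x S)).
Proof.
apply: in_tpow_text; rewrite conv_sumE; apply: (add_closed_sum (in_tpow_closed B _)) => i _ _ /=.
by rewrite dlE; case: eqP => [->|_]; rewrite ?finset.cards1 ?mulr1.
Qed.

(* With z = e^(-Y) D e^Y - D Y, a sum of brackets of order at least 2, Y solves
   Y = tau x + h Dp Y + h z; by induction on #|S| the last term is as divisible
   by t as required. *)
Lemma Y_regular (S : {set 'I_n}) : in_tpow (e * #|S|%:Z - 1) (Y S).
Proof.
have [m] := ubnP #|S|; elim: m S => // m IH S Sm.
have {IH} Yr (V : {set 'I_n}) : V \proper S -> in_tpow (e * #|V|%:Z - 1) (Y V).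
  by move=> /proper_card VS; apply: IH; exact: leq_trans VS _.
have Sr := SY_regular Yr; set M := e * _ - 1 in Sr *; set z := SY S - D (Y S) in Sr.
suff H : forall i, (i < M -> Y S i = 0) by move=> i; exact: H.
apply: (@text_fixpoint _ _ W (fun i => [set a : A | i < M -> a = 0]))
  => [i||i j a /= Ha ij|i /= iM].
- by split=> // a c /= Ha Hc iM; rewrite Ha // Hc // addr0.
- exact: W0.
- by rewrite Ha ?linear0 //; lia.
suff -> : Y S i - text W (Y S) i = lm tau (x S) i + lm h z i.
  have hz : in_tpow M (lm h z) by exact: in_tpow_text.
  by rewrite (tau_x_regular iM) hz // addr0.
have hSY := SY_ker S; have hY := Y_ker S.
have -> : lm h z = - lm h (D (Y S)) by rewrite /z linearB /= hSY sub0r.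
rewrite {1}(homotopy_eq (Y S i)) -[h (Y S i)]lmE hY linear0 subr0.
rewrite textW textD_split linearD lcoefN lcoefD !lmE opprD addrA; congr (_ - _ - _).
by rewrite -(lmE sigma) -(cmapE (lm sigma)) sigmaY.
Qed.

(** From SY e^Y = D T e^x, applying sigma on ker h gives (sigma SY) e^x = D' e^x. This identifies
    the bracket of D' with the projection of [SY]. *)
Lemma sigma_SY : cmap (lm sigma) SY = cmap D' E * aexp N (- x).
Proof.
have H : cmap D' E = cmap (lm sigma) SY * E.
  transitivity (cmap (lm sigma) (SY * aexp N Y)).
    rewrite /SY -mulrA aexpVl ?YN // mulr1 aexpY; apply/ffunP => S.
    by rewrite !cmapE D'E.
  apply: etrans (@cmap_mul K _ _ n d (lm sigma) lker_h lsigmaM SY (aexp N Y) SY_ker expY_ker) _.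
  congr (_ * _); rewrite aexpY; apply/ffunP => S; rewrite !cmapE; exact: sigmaT.
by rewrite H -Ex -mulrA aexpVr ?xN // mulr1.
Qed.

Lemma log_transfer_cumulant : (0 < n)%N ->
  Y (finset.setTfor 'I_n) = cumulant d T b.
Proof. by move=> n0; rewrite (cumulant_log charK u_comm n0 (ltnSn n)). Qed.

Lemma cumulant_regular : (0 < n)%N -> in_tpow (e * n%:Z - 1) (cumulant d T b).
Proof.
move=> n0; rewrite -log_transfer_cumulant //.
by have := @Y_regular (finset.setTfor 'I_n); rewrite finset.cardsT card_ord.
Qed.

(** The bracket is sigma of [SY] on the full set; both [SY] minus D Y and D Y have the required
    order. *)
Lemma koszul_bracket_regular : in_tpow (e * n%:Z - 1) (koszul_bracket d D' b).
Proof.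
rewrite (koszul_bracket_conv charK b_comm (ltnSn n) D'1) -sigma_SY cmapE.
apply: in_tpow_text.
have := @Y_regular (finset.setTfor 'I_n).
have /= := @SY_regular (finset.setTfor 'I_n) (fun V _ => @Y_regular V).
rewrite finset.cardsT card_ord => H1 H2; rewrite -(subrK (D (Y (finset.setTfor 'I_n))) (SY _)).
by apply: in_tpowD => //; exact: in_tpow_text.
Qed.

End RegularLogarithm.

Lemma lker_hX a n : lker_h a -> lker_h (a ^+ n).
Proof. by move=> ha; elim: n => [|n IH]; [exact: lker_h1|rewrite exprS; exact: lker_hM]. Qed.

Lemma lker_h_exp a N : lker_h a -> lker_h (aexp N a).
Proof.
move=> ha; rewrite /aexp; elim/big_rec: _ => [|i x _ hx]; first exact: lker_h0.
by apply: lker_hD => //; apply: lker_hZ; exact: lker_hX.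
Qed.

Lemma lsigma_exp a N : lker_h a -> lm sigma (aexp N a) = aexp N (lm sigma a).
Proof.
move=> ha; rewrite linear_sum; apply: eq_bigr => i _ /=; rewrite textZ; congr (_ *: _).
elim: (i : nat) => [|j IH]; first exact: lsigma1.
by rewrite !exprS lsigmaM ?IH //; exact: lker_hX.
Qed.

Lemma D'_hom e x : lhom k grB e x -> lhom k grB (e + 1) (D' x).
Proof. by move=> xe; rewrite D'E; apply: sigma_hom; apply: D_hom; exact: T_hom. Qed.

Lemma lhom_lconst (E : algType K) (gr : int -> set E) e a : graded_comm_alg gr ->
  gr e a -> lhom k gr e (lconst a).
Proof.
move=> ga ea i; rewrite lconstE; case: eqP => [->|_]; first by rewrite mul0r addr0.
by case: (gr_add_closed (e + i * (k - 1)) ga).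
Qed.

Lemma in_tpow_lconst (E : algType K) (a : E) : in_tpow 0 (lconst a).
Proof. by move=> i i0; rewrite lconstE lt_eqF. Qed.

Hypotheses (charK : [pchar K] =i pred0) (k_odd : odd `|k|%N).

Lemma transfer_derived_BV : derived_BV k grB Delta'.
Proof.
split.
- exact: (dga_alg dgB).
- by move=> n; rewrite -text_lconst lconst1 D'1.
- move=> n e a ea; rewrite -text_lconst.
  have := D'_hom (lhom_lconst (dga_alg dgB) ea) n%:Z; congr (grB _ _); lia.
- by move=> n x; rewrite -text_lconst text_tcomp Delta'_Delta'.
(* Constant arguments: the case e = 1. *)
move=> n d a n2 da; rewrite -[n%:Z]mul1r.
apply: (koszul_bracket_regular charK k_odd) => i; first exact: lhom_lconst (dga_alg dgB) _.
exact: in_tpow_lconst.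
Qed.

Lemma transfer_morphism : derived_BV_morphism k grB Delta' grA Delta tau'.
Proof.
split.
- move=> n e a ea; rewrite -text_lconst.
  by have := T_hom (lhom_lconst (dga_alg dgB) ea) n%:Z.
- by move=> n; rewrite -text_lconst lconst1 T1 lcoef1; case: n.
- by move=> n x; rewrite -!text_lconst !text_tcomp Delta_T.
move=> n d a n2 da; rewrite -[n%:Z]mul1r.
apply: (cumulant_regular charK k_odd) => [i|i|]; last exact: ltnW.
  exact: lhom_lconst (dga_alg dgB) _.
exact: in_tpow_lconst.
Qed.

(** * Filtrations and the Maurer-Cartan correspondence *)

Section Complete.
Variables (eps : A -> K) (F : nat -> set A).
Hypothesis cdbvA : complete_derived_BV k grA Delta eps F.
Hypotheses (h_cont : filtered_map F F h) (tau_sigma_cont : filtered_map F F (tau \o sigma)).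
Local Notation G := (induced_filtration sigma F).

Let filtF := cdbv_filt cdbvA.
Let FS p : subspace (F p). Proof. by case: (filt_subspace filtF p). Qed.
Let F0 := filt_zero filtF.
Let Fdecr := filt_decr filtF.
Let Fmul := cdbv_mul cdbvA.

(** Continuity of tau sigma makes the image filtration also a preimage under tau, so that properties
    of B can be tested in A. *)
Lemma induced_filtrationP p x : G p x <-> F p (tau x).
Proof.
split=> [[a Fa <-]|Fx]; first exact: tau_sigma_cont.
by exists (tau x) => //; exact: (ctr_sigma_tau ct).
Qed.

Lemma tau_cont : filtered_map G F tau.
Proof. by move=> p x /induced_filtrationP. Qed.

Lemma sigma_cont : filtered_map F G sigma.
Proof. by move=> p x Fx; exists x. Qed.

Let GS p : subspace (G p).
Proof.
have [F0p FL] := FS p; split; first by apply/induced_filtrationP; rewrite linear0.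
move=> c u v /induced_filtrationP Fu /induced_filtrationP Fv.
by apply/induced_filtrationP; rewrite linearP; exact: FL.
Qed.

Let G0 : G 0%N = [set: B].
Proof.
by apply/seteqP; split=> x // _; apply/induced_filtrationP; rewrite F0.
Qed.

Let Gdecr p : G p.+1 `<=` G p.
Proof. by move=> x /induced_filtrationP/Fdecr Fx; apply/induced_filtrationP. Qed.

Let Gmul p q x y : G p x -> G q y -> G (p + q)%N (x * y).
Proof.
move=> /induced_filtrationP Fx /induced_filtrationP Fy.
by apply/induced_filtrationP; rewrite tau_mul; exact: Fmul.
Qed.

Lemma D_lfil p x : lfil F p x -> lfil F p (D x).
Proof.
move=> Fx i; apply: text_closed; first exact: F_add_closed.
by move=> j; apply: (cdbv_BV cdbvA).
Qed.

Lemma T_lfil p x : lfil G p x -> lfil F p (T x).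
Proof.
move=> Gx; apply: T_filtered => [//|a Fa|n a Fa|i].
- exact: h_cont.
- exact: (cdbv_BV cdbvA).
by apply/induced_filtrationP.
Qed.

Lemma sigma_lfil p x : lfil F p x -> lfil G p (lm sigma x).
Proof. by move=> Fx i; rewrite lmE; exact: sigma_cont. Qed.

Lemma D'_lfil p x : lfil G p x -> lfil G p (D' x).
Proof. by move=> Gx; rewrite D'E; apply: sigma_lfil; apply: D_lfil; exact: T_lfil. Qed.

Lemma lconst_lfil (E : algType K) (H : nat -> set E) p a :
  (forall p, subspace (H p)) -> H p a -> lfil H p (lconst a).
Proof. by move=> HS Ha i; rewrite lconstE; case: eqP => // _; case: (HS p). Qed.

(** [eps \o tau] is an augmentation because tau is a morphism of unitary algebras of degree 0. *)
Lemma transfer_complete : complete_derived_BV k grB Delta' (eps \o tau) G.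
Proof.
have augA := cdbv_aug cdbvA; have [gA gB] := (dga_alg dgA, dga_alg dgB).
split.
- exact: transfer_derived_BV.
- split=> [c x y|||i x i0 xi] /=.
  + by rewrite linearP; exact: (aug_linear augA).
  + by rewrite tau1; exact: (aug_one augA).
  + by move=> x y; rewrite tau_mul; exact: (aug_mul augA).
  by apply: (aug_deg augA i0); have := ctr_tau_deg ct xi; rewrite addr0.
- split=> [p||//|x Gx|i x xi Gx].
  + split=> // x /induced_filtrationP Fx.
    have [_ /(_ _ Fx)[s [c [cP xE]]]] := filt_subspace filtF p.
    exists s, (sigma \o c); split=> [j|].
      have [cj Fcj] := cP j; split; last exact: sigma_cont.
      by have := ctr_sigma_deg ct cj; rewrite addr0.
    by rewrite -[LHS](ctr_sigma_tau ct) xE linear_sum.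
  + exact: G0.
  + rewrite -[x](ctr_sigma_tau ct) [tau x](filt_separated filtF) ?linear0 // => p.
    exact/induced_filtrationP.
  (* The limit is taken in A, along tau, and projected back by sigma. *)
  have [||l li lP] := filt_complete filtF (i := i) (x := tau \o x).
  + by move=> p /=; have := ctr_tau_deg ct (xi p); rewrite addr0.
  + by move=> p /=; rewrite -linearB; apply/induced_filtrationP.
  exists (sigma l); first by have := ctr_sigma_deg ct li; rewrite addr0.
  move=> p; exists (l - tau (x p)); first exact: lP.
  by rewrite linearB; congr (_ - _); exact: (ctr_sigma_tau ct).
- apply/seteqP; split=> x.
    by move=> /induced_filtrationP; rewrite (cdbv_ker cdbvA).
  by move=> /= ex; apply/induced_filtrationP; rewrite (cdbv_ker cdbvA).
- exact: Gmul.
move=> n p x Gx; rewrite -text_lconst; apply: D'_lfil.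
exact: lconst_lfil.
Qed.

Lemma tau'_cont n : filtered_map G F (tau' n).
Proof. by move=> p x Gx; rewrite -text_lconst; apply: T_lfil; exact: lconst_lfil. Qed.

Lemma lfil_eq x y : (forall p, lfil F p (x - y)) -> x = y.
Proof.
move=> Fxy; apply/eqP; rewrite -subr_eq0; apply/eqP/laurentP => i.
by apply: (filt_separated filtF) => p; exact: Fxy.
Qed.

Lemma lfilG_eq (x y : laurent B) : (forall p, lfil G p (x - y)) -> x = y.
Proof.
move=> Gxy; apply/eqP; rewrite -subr_eq0; apply/eqP/laurentP => i.
rewrite -[LHS](ctr_sigma_tau ct) [tau _](filt_separated filtF) ?linear0 // => p.
by apply/induced_filtrationP; exact: Gxy.
Qed.

Lemma MC_A_exp a : MC_BV k grA Delta F a <->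
  [/\ in_tpow (-1) a, lhom k grA 0 a, lfil F 1 a & forall p, lfil F p (D (aexp p a))].
Proof.
apply: MC_BV_exp => //; last exact: D_lfil; last exact: (text_unit dbvA).
by move=> i; case: (gr_add_closed i (dga_alg dgA)).
Qed.

Lemma MC_B_exp b : MC_BV k grB Delta' G b <->
  [/\ in_tpow (-1) b, lhom k grB 0 b, lfil G 1 b & forall p, lfil G p (D' (aexp p b))].
Proof.
apply: MC_BV_exp => //; last exact: D'_lfil; last exact: D'1.
by move=> i; case: (gr_add_closed i (dga_alg dgB)).
Qed.

(** * Convergence of the push-forward *)

Section Push.
Variable b : laurent B.
Hypotheses (bm1 : in_tpow (-1) b) (bh : lhom k grB 0 b) (bG : lfil G 1 b).

Let kappa n := cumulant (fun _ : 'I_n => 0) T (fun=> b).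
(** The variable X counts arguments: [expT] and [logT] are T (e^(X b)) and its logarithm, in which
    the coefficient of X^n, for 0 < n < N, is [kappa n] divided by n!. *)
Let expT N : {poly laurent A} := \poly_(i < N) (exp_coef K i *: T (b ^+ i)).
Let logT N : {poly laurent A} :=
  \sum_(i < N) ((log_coef K i)%:A : laurent A) *: (expT N - 1) ^+ i.

Lemma kappa_log n : (0 < n)%N ->
  kappa n = alog n.+1 (block_values (fun _ : 'I_n => 0) T (fun=> b)) (finset.setTfor 'I_n).
Proof. by move=> n0; rewrite log_transfer_cumulant. Qed.

Lemma logT_coef N n : (0 < n)%N -> (n < N)%N -> (logT N)`_n = exp_coef K n *: kappa n.
Proof.
move=> n0 nN; rewrite /kappa (@cumulant_log _ charK _ _ _ _ _ _ _ N) //; last first.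
  by move=> J J' dJ; apply: u_comm.
rewrite -(divided_block_values charK (n := n) (N := N)) ?T1 // -divided_log.
rewrite ffunE finset.cardsT card_ord scalerA mulVf ?scale1r //.
exact: fact_natr_neq0.
Qed.

Lemma expT0 N : (0 < N)%N -> (expT N - 1)`_0 = 0.
Proof.
by move=> N0; rewrite coefB coef_poly coef1 N0 expr0 T1 /exp_coef fact0 invr1 scale1r subrr.
Qed.

Lemma logT0 N : (0 < N)%N -> (logT N)`_0 = 0.
Proof.
move=> N0; rewrite coef_sum big1 // => -[[|i] iN] _; rewrite coefZ /=.
  by rewrite scale0r mul0r.
by rewrite coef0X expT0 // exprS mul0r mulr0.
Qed.

Lemma lfil_poly_mul (P Q : {poly laurent A}) :
  (forall i, lfil F i P`_i) -> (forall i, lfil F i Q`_i) -> forall i, lfil F i (P * Q)`_i.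
Proof.
move=> FP FQ i; rewrite coefM; apply: lfil_sum => // j _.
have := lfilM FS Fmul (FP j) (FQ (i - j)%N).
by rewrite subnKC // -ltnS.
Qed.

Lemma lfil_one i : lfil F i (1 : {poly laurent A})`_i.
Proof. by rewrite coef1; case: i => [|i]; [exact: lfil_all|exact: lfil0]. Qed.

(** Polynomials whose coefficient of X^i lies in F^i for every i are closed under products, and
    [expT N - 1] is one of them. Hence the n-th cumulant lies in F^n and the series converges. *)
Lemma logT_lfil N i : lfil F i (logT N)`_i.
Proof.
rewrite coef_sum; apply: lfil_sum => // j _; rewrite coefZ mulr_algl; apply: lfilZ => //.
have FE l : lfil F l (expT N - 1)`_l.
  rewrite coefB; apply: lfilB => //; last exact: lfil_one.
  rewrite coef_poly; case: ifP => _; last exact: lfil0.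
  by apply: lfilZ => //; apply: T_lfil; exact: lfilX.
elim: (j : nat) i => [|m IH] i; first exact: lfil_one.
by rewrite exprS; apply: lfil_poly_mul.
Qed.

Lemma kappa_lfil n : (0 < n)%N -> lfil F n (kappa n).
Proof.
move=> n0; have := logT_lfil n.+1 n; rewrite logT_coef // => Fk.
rewrite -[kappa n]scale1r -(divff (fact_natr_neq0 charK n)) -scalerA.
exact: lfilZ.
Qed.

Lemma kappa_tpow n : (0 < n)%N -> in_tpow (-1) (kappa n).
Proof.
(* The arguments start at t^(-1): the case e = 0, whose bound does not depend on n. *)
move=> n0; have := @cumulant_regular charK k_odd n (fun=> 0) (fun=> b) 0.
by rewrite mul0r sub0r; apply.
Qed.

Lemma kappa_hom n : (0 < n)%N -> lhom k grA 0 (kappa n).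
Proof.
move=> n0; rewrite kappa_log //.
have := @Y_hom k_odd n (fun=> 0) (fun=> b) (fun=> bh) (finset.setTfor 'I_n).
by rewrite big1.
Qed.

Lemma kappa_ker n : (0 < n)%N -> lker_h (kappa n).
Proof. by move=> n0; rewrite kappa_log //; exact: Y_ker. Qed.

(** By [sigmaY] this is the value on the full set of x, which is supported on singletons. *)
Lemma sigma_kappa n : (0 < n)%N -> lm sigma (kappa n) = if n == 1%N then b else 0.
Proof.
move=> n0; rewrite kappa_log // -(cmapE (lm sigma)) sigmaY //.
exact: single_sum_setT.
Qed.

Let partial N : laurent A := \sum_(1 <= n < N) exp_coef K n *: kappa n.

Lemma partial_fil1 N : lfil F 1 (partial N).
Proof.
rewrite /partial big_nat_cond; apply: lfil_sum => // n /andP[/andP[n0 _] _].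
by apply: lfilZ => //; apply: (lfil_le Fdecr n0); exact: kappa_lfil.
Qed.

(** At X = 1 the polynomial [logT N] becomes log (T e^b). It differs from the partial sum by
    coefficients of index at least N, which lie in F^N; then e^(log (1 + u)) = 1 + u modulo F^N. *)
Lemma exp_partial_mod p : lfil F p (aexp p (partial p) - T (aexp p b)).
Proof.
case: p => [|p]; first exact: lfil_all.
set N := p.+1; set u := T (aexp N b) - 1.
have expT1 : (expT N).[1] = T (aexp N b).
  rewrite horner_poly [RHS](linear_sum (text tau')); apply: eq_bigr => i _.
  by rewrite expr1n mulr1 /= textZ.
have logT1 : (logT N).[1] = alog N u.
  rewrite horner_sum; apply: eq_bigr => i _.
  by rewrite hornerZ horner1X hornerD hornerN hornerC expT1 mulr_algl.
have partialE : partial N = \sum_(i < N) (logT N)`_i.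
  rewrite big_ord_recl logT0 // add0r /partial big_add1 big_mkord.
  by apply: eq_bigr => i _; rewrite logT_coef // lift0 // ltnS.
have Fu : lfil F 1 u.
  rewrite /u -T1 -textB; apply: T_lfil; rewrite /aexp big_ord_recl /=.
  rewrite expr0 /exp_coef fact0 invr1 scale1r addrC addKr.
  apply: lfil_sum => // i _; apply: lfilZ => //.
  by apply: (lfil_le Gdecr (isT : (1 <= bump 0 i)%N)); exact: lfilX.
have Fl : lfil F 1 (alog N u).
  rewrite /alog big_ord_recl scale0r add0r.
  apply: lfil_sum => // i _; apply: lfilZ => //.
  by apply: (lfil_le Fdecr (isT : (1 <= bump 0 i)%N)); exact: lfilX.
apply: (@lfil_trans _ _ _ FS _ _ (aexp N (alog N u))).
  apply: aexp_mod => //; first exact: partial_fil1.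
  rewrite -logT1 partialE (horner_coef_wide _ (leq_maxl (size (logT N)) N)).
  under [X in _ - X]eq_bigr do rewrite expr1n mulr1.
  apply: lfil_sym => //; apply: (@sum_tail_mod _ _ _ FS N _ (fun i => (logT N)`_i)).
    exact: leq_maxr.
  by move=> m Nm; apply: (lfil_le Fdecr Nm); exact: logT_lfil.
have [Q ->] := exp_log_alg charK N u.
rewrite /u [1 + _]addrC subrK addrC addKr -[N]add0n.
by apply: lfilM => //; [exact: lfil_all|exact: lfilX].
Qed.

Lemma push_exists : exists a, [/\ in_tpow (-1) a, lhom k grA 0 a, lfil F 1 a, lker_h a &
  [/\ lm sigma a = b, is_pushforward F tau' b a &
      forall p, lfil F p (aexp p a - T (aexp p b))]].
Proof.
have gA := dga_alg dgA.
have part_hom p i : grA (i * (k - 1)) (partial p i).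
  rewrite lcoef_sum big_nat_cond.
  apply: (add_closed_sum (gr_add_closed _ gA)) => n _ /andP[/andP[n0 _] _].
  rewrite lcoefZ -[_ *: _]addr0.
  have [g0 gL] := grading_subspace (gca_grading gA) (i * (k - 1)); apply: gL => //.
  by have := kappa_hom n0 i; rewrite add0r.
have part_step p i : F p (partial p.+1 i - partial p i).
  case: p => [|p]; first by rewrite F0.
  have -> : partial p.+2 = partial p.+1 + exp_coef K p.+1 *: kappa p.+1.
    by rewrite /partial big_nat_recr.
  rewrite lcoefD addrC addKr.
  by apply: lfilZ => //; exact: kappa_lfil.
have /choice[l lP] : forall i, exists l, grA (i * (k - 1)) l /\
    forall p, F p (l - partial p i).
  move=> i; have [||l l1 l2] := filt_complete filtF (i := i * (k - 1))
    (x := fun p => partial p i).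
  - by move=> p; exact: part_hom.
  - by move=> p; exact: part_step.
  by exists l.
(* The limits are chosen for each power of t separately; below t^(-1) the coefficient is set to 0,
   in accordance with [kappa_tpow], to obtain a Laurent series. *)
have lsub : bounded_below (fun i : int => if i < -1 then 0 else l i).
  by apply/asboolP; exists (-1) => i ->.
pose a := Laurent lsub.
have aE i : a i = if i < -1 then 0 else l i by [].
have part_tpow p : in_tpow (-1) (partial p).
  rewrite /partial big_nat_cond.
  apply: (add_closed_sum (in_tpow_closed A _)) => n _ /= /andP[/andP[n0 _] _].
  by apply: in_tpowZ; exact: kappa_tpow.
have aP p : lfil F p (a - partial p).
  move=> i; rewrite lcoefB aE; case: ifP => im; last by case: (lP i).
  by rewrite part_tpow // subr0; case: (FS p).
have am1 : in_tpow (-1) a by move=> i im; rewrite aE im.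
have ah : lhom k grA 0 a.
  move=> i; rewrite add0r aE; case: ifP => _; last by case: (lP i).
  by case: (gr_add_closed (i * (k - 1)) gA).
have aF : lfil F 1 a.
  by apply: (lfil_cong FS (aP 1%N)); exact: partial_fil1.
have a_ker : lker_h a.
  apply: lfil_eq => p; rewrite subr0.
  have -> : lm h a = lm h (a - partial p).
    rewrite textB (_ : lm h (partial p) = 0) ?subr0 //.
    rewrite /partial big_nat_cond (linear_sum (text (tconst h))) big1 // => n.
    by move=> /andP[/andP[n0 _] _]; rewrite /= textZ kappa_ker // scaler0.
  by move=> i; rewrite lmE; apply: h_cont; exact: aP.
exists a; split=> //; split.
- apply: lfilG_eq => p.
  (* The index p + 2 ensures that the term n = 1, the only one with nonzero projection, occurs in
     the partial sum. *)
  apply: (@lfil_le _ _ _ Gdecr p p.+2); first by rewrite ltnW.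
  have -> : b = lm sigma (partial p.+2).
    rewrite /partial big_nat_recl // linearD /= textZ sigma_kappa //.
    rewrite /exp_coef factS fact0 invr1 scale1r big_nat_cond.
    rewrite (linear_sum (text (tconst sigma))) big1 ?addr0 // => n.
    move=> /andP[/andP[n0 _] _] /=; rewrite textZ sigma_kappa //.
    by rewrite eqSS (gtn_eqF n0) scaler0.
  by rewrite -textB; apply: sigma_lfil; exact: aP.
- move=> p; exists p => m pm i; move: i.
  suff : lfil F p (partial m.+1 - a) by [].
  apply: lfil_sym => //; apply: (lfil_le Fdecr (leqW pm)); exact: aP.
move=> p; apply: (@lfil_trans _ _ _ FS _ _ (aexp p (partial p))).
  by apply: aexp_mod => //; exact: partial_fil1.
exact: exp_partial_mod.
Qed.

End Push.

(** [transfer_unique] is applied with Z = F^p, since D e^a vanishes only modulo F^p. Then D'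
    e^(sigma a) = sigma D T e^(sigma a) is congruent to sigma D e^a. *)
Lemma sigma_MC a : MC_BV k grA Delta F a -> lker_h a -> MC_BV k grB Delta' G (lm sigma a) /\
  forall p, lfil F p (aexp p a - T (aexp p (lm sigma a))).
Proof.
move=> /MC_A_exp[am1 ah aF De] ha.
have eT p : lfil F p (aexp p a - T (aexp p (lm sigma a))).
  rewrite -lsigma_exp //; apply: transfer_unique => [//|x Fx|n x Fx|i|i].
  - exact: h_cont.
  - exact: (cdbv_BV cdbvA).
  - by rewrite -(lmE h) lker_h_exp //; case: (FS p).
  by apply: h_cont; exact: De.
split=> //; apply/MC_B_exp; split.
- exact: in_tpow_text.
- exact: sigma_hom.
- exact: sigma_lfil.
move=> p; rewrite D'E; apply: sigma_lfil.
apply: (@lfil_cong _ _ _ FS _ _ (D (aexp p a))); last exact: De.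
by rewrite -textB; apply: D_lfil; apply: lfil_sym.
Qed.

(** Modulo F^p, D e^a is D T e^b = T D' e^b, and T respects the filtrations. *)
Lemma push_MC b : MC_BV k grB Delta' G b -> exists a,
  [/\ MC_BV k grA Delta F a, lker_h a, lm sigma a = b & is_pushforward F tau' b a].
Proof.
move=> /MC_B_exp[bm1 bh bG De].
have [a [am1 ah aF a_ker [sa pa ea]]] := push_exists bm1 bh bG.
exists a; split=> //; apply/MC_A_exp; split=> // p.
apply: (@lfil_cong _ _ _ FS _ _ (D (T (aexp p b)))).
  by rewrite -textB; apply: D_lfil.
by rewrite Delta_T; apply: T_lfil.
Qed.

(** Modulo each F^p both exponentials equal T (e^(sigma a)), and the exponential is injective modulo
    F^p. With [push_MC] this shows that push-forward and projection are mutually inverse. *)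
Lemma sigma_MC_inj a c : MC_BV k grA Delta F a -> lker_h a ->
  MC_BV k grA Delta F c -> lker_h c -> lm sigma a = lm sigma c -> a = c.
Proof.
move=> MCa ha MCc hc sac; apply: lfil_eq => p.
have [_ ea] := sigma_MC MCa ha; have [_ ec] := sigma_MC MCc hc.
have [_ _ aF _] := (MC_A_exp a).1 MCa; have [_ _ cF _] := (MC_A_exp c).1 MCc.
apply: (aexp_inj_mod FS F0 Fdecr Fmul) => //.
apply: (@lfil_trans _ _ _ FS _ _ (T (aexp p (lm sigma a)))) => //.
by rewrite sac; apply: lfil_sym.
Qed.

End Complete.

End Transfer.

(** * The correspondence of Maurer-Cartan sets *)

Theorem theorem2p15 (K : fieldType) (charK : [pchar K] =i pred0)
    (k : int) (k_odd : odd `|k|%N) (A B : algType K)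
    (grA : int -> set A) (grB : int -> set B)
    (dA : {linear A -> A}) (dB : {linear B -> B})
    (dgA : dg_comm_alg grA dA) (dgB : dg_comm_alg grB dB)
    (sigma : {linear A -> B}) (tau : {linear B -> A}) (h : {linear A -> A})
    (ctr : semifull_contraction grA grB dA dB sigma tau h)
    (Delta : tops A A) (dbvA : derived_BV k grA Delta)
    (Delta0 : Delta 0%N =1 dA)
    (eps : A -> K) (F : nat -> set A)
    (cdbvA : complete_derived_BV k grA Delta eps F)
    (h_cont : filtered_map F F h)
    (tau_sigma_cont : filtered_map F F (tau \o sigma)) :
  let Delta' := pert_BV dB sigma tau h Delta in
  let sigma' := pert_sigma sigma h Delta in
  let tau' := pert_tau tau h Delta in
  let h' := pert_h h Delta in
  let G := induced_filtration sigma F in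
  let MC_A := MC_BV k grA Delta F in
  let MC_B := MC_BV k grB Delta' G in
  let ker_h' := [set a | text h' a = 0] in
  [/\ (* G is the only filtration making sigma and tau continuous *)
      filtered_map F G sigma /\ filtered_map G F tau,
      (forall G' : nat -> set B,
        filtered_map F G' sigma -> filtered_map G' F tau -> G' = G),
      (* tau' is a continuous morphism of complete derived BV algebras *)
      complete_derived_BV k grB Delta' (eps \o tau) G,
      derived_BV_morphism k grB Delta' grA Delta tau' /\
        (forall n, filtered_map G F (tau' n)) &
      exists push : laurent B -> laurent A,
        [/\ (forall b, MC_B b -> is_pushforward F tau' b (push b)),
            set_bij MC_B (MC_A `&` ker_h') push,
            (forall a, (MC_A `&` ker_h') a -> MC_B (text sigma' a)),
            (forall b, MC_B b -> text sigma' (push b) = b) &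
            (forall a, (MC_A `&` ker_h') a -> push (text sigma' a) = a)]].
Proof.
move=> Delta' sigma' tau' h' G MC_A MC_B ker_h'.
have T_rec : forall x, text tau' x =
  lm tau x + lm h (text (tpos Delta) (text tau' x)) := text_pert_tau tau h Delta.
have D'_rec : forall x, text Delta' x =
  lm dB x + lm sigma (text (tpos Delta) (text tau' x)) :=
  text_pert_BV dB sigma tau h Delta.
have kerP a : ker_h' a <-> lker_h h a := text_pert_h h Delta a.
have sigmaP a : lker_h h a -> text sigma' a = lm sigma a :=
  @text_pert_sigma _ _ _ sigma h Delta a.
(* From here on the perturbed operators enter through their recursions only. *)
clearbody Delta' tau'.
split.
- split; [exact: sigma_cont|exact: (tau_cont ctr tau_sigma_cont)].
- move=> G' sG tG; apply/funext => p; apply/seteqP; split=> [x /tG Fx|_ [a Fa <-]].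
    by exists (tau x) => //; exact: (ctr_sigma_tau (sf_contraction ctr)).
  exact: sG.
- exact: (transfer_complete dgA dgB ctr dbvA Delta0 T_rec D'_rec charK k_odd cdbvA h_cont).
- split; first exact: (transfer_morphism dgA dgB ctr dbvA Delta0 T_rec D'_rec).
  exact: (tau'_cont ctr T_rec cdbvA h_cont).
(* A limit is chosen for each Maurer-Cartan element; elsewhere the value of [push] is arbitrary. *)
have /choice[push pushP] : forall b, exists a, MC_B b ->
    [/\ MC_A a, lker_h h a, lm sigma a = b & is_pushforward F tau' b a].
  move=> b; have [MCb|nMCb] := pselect (MC_B b); last by exists 0.
  have [a aP] := push_MC dgA dgB ctr dbvA Delta0 T_rec D'_rec charK k_odd cdbvA h_cont
    tau_sigma_cont MCb.
  by exists a.
have sMC a : (MC_A `&` ker_h') a -> MC_B (text sigma' a).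
  move=> [MCa /kerP ha]; rewrite sigmaP //.
  by have [] := sigma_MC dgA dgB ctr dbvA Delta0 T_rec D'_rec charK cdbvA h_cont
    tau_sigma_cont MCa ha.
have sK b : MC_B b -> text sigma' (push b) = b.
  by move=> /pushP[_ hb sb _]; rewrite sigmaP.
have pK a : (MC_A `&` ker_h') a -> push (text sigma' a) = a.
  move=> aP; have [MCp hp sp _] := pushP _ (sMC a aP).
  have [MCa /kerP ha] := aP.
  apply: (sigma_MC_inj dgA dgB ctr dbvA Delta0 T_rec D'_rec charK cdbvA h_cont
    tau_sigma_cont) => //.
  by rewrite sp sigmaP.
exists push; split=> //; first by move=> b /pushP[].
split.
- by move=> b /pushP[MCp hp _ _]; split=> //; exact/kerP.
- move=> b c; rewrite !inE => MCb MCc /(congr1 (text sigma')).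
  by rewrite !sK.
by move=> a aP; exists (text sigma' a); [exact: sMC|exact: pK].
Qed.
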